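(* Assume that $b\in\mathbb{C}$, $a,c\in\mathbb{C}\setminus\mathbb{Z}_{\leqslant 0}$ and $\delta\in(0,\frac{\pi}{2}]$. Let $x\in\mathbb{C}$ with $x\neq1$, $|\arg(1-x)|<\pi$. Then, as $y\to\infty$ in the sector $|\arg(y)|\leqslant\frac{\pi}{2}-\delta$, $$\Phi_1[a,b;c;x,y]\sim\frac{\Gamma(c)}{\Gamma(a)}\,e^{y}\sum_{n=0}^{\infty}{}_2F_1\left[\begin{matrix}a,b\\ a-n\end{matrix};x\right]\frac{(1-a)_n(c-a)_n}{n!}\,y^{a-c-n}.$$ In particular, $$\Phi_1[a,b;c;x,y]\sim\frac{\Gamma(c)}{\Gamma(a)}(1-x)^{-b}y^{a-c}e^{y}.$$
   Context: $(\alpha)_n=\Gamma(\alpha+n)/\Gamma(\alpha)$ is the Pochhammer symbol, ${}_2F_1$ the (principal branch of the) Gauss hypergeometric function, powers take principal values, and $\sim$ denotes a Poincar\'e asymptotic expansion for fixed $x$ and parameters. The Humbert function $\Phi_1$ is defined for $|x|<1$, $y\in\mathbb{C}$ by $$\Phi_1[a,b;c;x,y]=\sum_{m,n=0}^{\infty}\frac{(a)_{m+n}(b)_m}{(c)_{m+n}}\frac{x^m}{m!}\frac{y^n}{n!},$$ and is continued analytically to all $x\in\mathbb{C}\setminus[1,\infty)$, $y\in\mathbb{C}$ by $$\Phi_1[a,b;c;x,y]=\sum_{n=0}^{\infty}\frac{(a)_n}{(c)_n}\,{}_2F_1\left[\begin{matrix}a+n,b\\ c+n\end{matrix};x\right]\frac{y^n}{n!}.$$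 When $a$ is a positive integer, the product $(1-a)_n\,{}_2F_1[a,b;a-n;x]$ is understood by continuity in $a$, i.e. as $(1-x)^{-b}\sum_{k=0}^{n}(-1)^k\frac{(-n)_k(b)_k}{k!}(1-a)_{n-k}\left(\frac{x}{x-1}\right)^k$. *)

(* Defs.v *)
(* Stdlib reals with Coquelicot's complex numbers. *)
From Stdlib Require Import Reals Factorial ClassicalEpsilon.
From Coquelicot Require Import Coquelicot.
Open Scope C_scope.

Definition Cexp (z : C) : C :=
  ((exp (Re z) * cos (Im z))%R, (exp (Re z) * sin (Im z))%R).

(* Principal argument, in (-PI, PI]; the value at 0 is irrelevant. *)
Definition Carg (z : C) : R :=
  if Rle_dec 0 (Im z) then acos (Re z / Cmod z) else (- acos (Re z / Cmod z))%R.

Definition Cln (z : C) : C := (ln (Cmod z), Carg z).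

(* Principal value of z^w, for z <> 0. *)
Definition Cpowc (z w : C) : C := Cexp (w * Cln z).

(* (z)_n as the product z (z+1) ... (z+n-1), which also covers the poles of
   Gamma(z+n)/Gamma(z). *)
Fixpoint poch (z : C) (n : nat) : C :=
  match n with
  | O => 1
  | S m => poch z m * (z + INR m)
  end.

Definition nonpos_int (z : C) : Prop := exists k : nat, z = RtoC (- INR k).

Definition pos_int (z : C) : Prop := exists k : nat, z = RtoC (INR (S k)).

(* Euler's limit n! n^z / (z (z+1) ... (z+n)), valid for every z that is not a
   nonpositive integer. *)
Definition CGamma (z : C) : C :=
  let u := fun n : nat => INR (fact n) * Cpowc (INR n) z / poch z (S n) in
  (real (Lim_seq (fun n => Re (u n))), real (Lim_seq (fun n => Im (u n)))).

Definition CSeries (u : nat -> C) : C :=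
  (Series (fun n => Re (u n)), Series (fun n => Im (u n))).

Definition slit_plane (x : C) : Prop := ~ (Im x = 0%R /\ (1 <= Re x)%R).

Definition analytic_at (f : C -> C) (z : C) : Prop :=
  exists (r : R) (s : nat -> C), (0 < r)%R /\
    forall w : C, (Cmod (w - z) < r)%R -> is_pseries s (w - z) (f w).

Definition hyp2F1_coef (a b c : C) (n : nat) : C :=
  poch a n * poch b n / (poch c n * INR (fact n)).

(* F is the analytic continuation of the Gauss series to C \ [1,+oo). *)
Definition is_hyp2F1 (a b c : C) (F : C -> C) : Prop :=
  (forall x : C, slit_plane x -> analytic_at F x) /\
  (forall x : C, (Cmod x < 1)%R -> is_pseries (hyp2F1_coef a b c) x (F x)).

(* Principal branch: is_hyp2F1 determines F on C \ [1,+oo) when c is not a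
   nonpositive integer; other values of c and x are never used. *)
Definition hyp2F1 (a b c : C) : C -> C :=
  epsilon (inhabits (fun _ : C => RtoC 0)) (is_hyp2F1 a b c).

(* Given by the expansion in y valid for all x in C \ [1,+oo); for |x| < 1,
   where hyp2F1 is the Gauss series in x, it is the double series
   sum_{m,n} (a)_{m+n} (b)_m / (c)_{m+n} x^m/m! y^n/n!, summed over m first. *)
Definition Phi1 (a b c x y : C) : C :=
  CSeries (fun n : nat =>
    poch a n / poch c n * hyp2F1 (a + INR n) b (c + INR n) x
    * (y ^ n / INR (fact n))).

(* (1-a)_n 2F1[a,b;a-n;x], by continuity in a at the positive integers, where
   2F1[a,b;a-n;x] is undefined for n >= a. *)
Definition poch_hyp2F1 (a b x : C) (n : nat) : C :=
  if excluded_middle_informative (pos_int a) then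
    Cpowc (1 - x) (- b) *
    sum_n (fun k : nat =>
      (- (1)) ^ k * (poch (- INR n) k * poch b k / INR (fact k))
      * poch (1 - a) (n - k) * (x / (x - 1)) ^ k) n
  else poch (1 - a) n * hyp2F1 a b (a - INR n) x.

Definition C_infinity : (C -> Prop) -> Prop :=
  fun P => exists M : R, forall y : C, (M < Cmod y)%R -> P y.

Definition sector (delta : R) (y : C) : Prop :=
  (Rabs (Carg y) <= PI / 2 - delta)%R.

(* Poincare asymptotic expansion f ~ sum_n s_n phi_n along the filter F:
   for every N, f - sum_{n <= N} s_n phi_n = o(phi_N). *)
Definition is_asymp_expansion (F : (C -> Prop) -> Prop) (f : C -> C)
    (s : nat -> C) (phi : nat -> C -> C) : Prop :=
  forall N : nat, is_domin F (phi N)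
    (fun y : C => f y - sum_n (fun n : nat => s n * phi n y) N).

(* Main.v *)
Require Import Defs.
From Stdlib Require Import Reals Factorial ClassicalEpsilon Lra Lia.
From Coquelicot Require Import Coquelicot.
Open Scope C_scope.

(** Why the theorem holds.

    Write s = c-a.  Euler's integral makes the coefficient of y^n/n! in Phi1 a
    moment on the unit interval: up to the constant Gamma(c)/(Gamma(a)Gamma(s)),
    [[
      (a)_n/(c)_n 2F1[a+n,b;c+n;x] = int_0^1 t^n (1-t)^(s-1) G(t) dt,
      G(t) = t^(a-1) (1-xt)^(-b).
    ]]
    Summing over n, Phi1 is the Laplace integral of e^(yt) (1-t)^(s-1) G(t),
    which is governed by the endpoint t = 1 when Re y is large (Watson's lemma).
    The Taylor coefficients of G in u = 1-t, called gcoef, are the numbers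
    (1-a)_n 2F1[a,b;a-n;x]/n!.  The term u^k contributes
    Gamma(s+k) e^y y^(-s-k) up to an exponentially small relative error
    (hnorm_bound), and a remainder of order u^K contributes O(e^y y^(-K-1)) with
    K as large as desired (remainder_bound).

    Neither Re a > 0 nor Re s > 0 is assumed, so the integral itself may diverge.
    For a, the moment formula is used only for n >= n0: the other terms form a
    polynomial in y, which is negligible against e^y in the sector.  For s, the
    contiguous relation
    [[
      c 2F1[a,b;c] = (c-b) 2F1[a,b;c+1] + b 2F1[a,b+1;c+1]
    ]]
    expresses Phi1[a,b;c] through Phi1 with parameters (a,b;c+1), (a,b+1;c+1) and
    (a+1,b;c+2), for which s is larger by one.  The coefficients of the expansion
    satisfy the same relation (phi_asym_S), so the expansion descends by
    induction (has_expansion_lower).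

    Since 2F1 is characterised as an analytic continuation and Gamma as Euler's
    limit, both have to be met on these terms.  Expanding Euler's integral about
    every point of the slit plane shows that it is a continuation of the Gauss
    series (is_hyp2F1_euler); the identity theorem shows that it is the only one.
    The contiguous relation extends existence to all c, and, started from
    2F1[a,b;a;x] = (1-x)^(-b), it evaluates 2F1[a,b;a-n;x] in closed form.
    Gamma enters through the exact moments int_0^1 t^n (1-t)^(s-1) dt =
    n!/(s)_(n+1), whose size is given by Euler's limit: the constant of Euler's
    integral and the constants Gamma(s+k) both come from comparison with them.

    One device recurs.  To compare a partial sum of a power series with its limit
    function, differentiate their quotient along a segment: the derivative
    telescopes to a single term, and the mean value inequality gives an explicit
    error.  The exponential series, the binomial series, and the Laplace
    integrals in the sector are all treated in this way. *)

(** * Complex numbers *)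

Lemma C_ext (z w : C) : Re z = Re w -> Im z = Im w -> z = w.
Proof. destruct z, w; simpl; intros; subst; reflexivity. Qed.

Lemma Re_minus (z w : C) : Re (z - w) = (Re z - Re w)%R.
Proof. unfold Cminus; rewrite re_plus, re_opp; ring. Qed.

Lemma Im_minus (z w : C) : Im (z - w) = (Im z - Im w)%R.
Proof. unfold Cminus; rewrite im_plus, im_opp; ring. Qed.

Lemma Im_le_Cmod (z : C) : (Rabs (Im z) <= Cmod z)%R.
Proof.
  eapply Rle_trans; [apply Rmax_r | apply (Rmax_Cmod z)].
Qed.

Lemma Cmod_le_Re_Im (z : C) : (Cmod z <= Rabs (Re z) + Rabs (Im z))%R.
Proof.
  replace z with (RtoC (Re z) + Ci * RtoC (Im z)) at 1.
  - eapply Rle_trans; [apply Cmod_triangle|].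
    rewrite Cmod_mult, Cmod_Ci, !Cmod_R; lra.
  - apply C_ext; simpl; ring.
Qed.

Lemma Cmod_sqr (z : C) : (Cmod z * Cmod z = Re z * Re z + Im z * Im z)%R.
Proof. generalize (Cmod2_alt z); simpl; lra. Qed.

Lemma Cmod_minus_comm (z w : C) : Cmod (z - w) = Cmod (w - z).
Proof. rewrite <- Cmod_opp; f_equal; ring. Qed.

Lemma Cmod_triangle_minus (z w : C) : (Cmod (z - w) <= Cmod z + Cmod w)%R.
Proof.
  unfold Cminus; eapply Rle_trans; [apply Cmod_triangle|].
  rewrite Cmod_opp; lra.
Qed.

Lemma Cmod_triangle_inv (z w : C) : (Cmod z - Cmod w <= Cmod (z - w))%R.
Proof.
  generalize (Cmod_triangle (z - w) w).
  replace (z - w + w) with z by ring; lra.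
Qed.

Lemma Cmod_triangle_inv_plus (z w : C) : (Cmod z - Cmod w <= Cmod (z + w))%R.
Proof.
  replace (z + w) with (z - - w) by ring.
  rewrite <- (Cmod_opp w); apply Cmod_triangle_inv.
Qed.

Lemma Cmod_INR (n : nat) : Cmod (INR n) = INR n.
Proof. rewrite Cmod_R; apply Rabs_pos_eq, pos_INR. Qed.

Lemma RtoC_INR_S (n : nat) : RtoC (INR (S n)) = INR n + 1.
Proof. rewrite S_INR, RtoC_plus; reflexivity. Qed.

Lemma RtoC_INR_plus (n m : nat) : RtoC (INR (n + m)) = INR n + INR m.
Proof. rewrite plus_INR, RtoC_plus; reflexivity. Qed.

Lemma RtoC_neq0 (r : R) : r <> 0%R -> RtoC r <> 0.
Proof. intros H E; apply H, RtoC_inj; exact E. Qed.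

Lemma INR_fact_neq0 (n : nat) : RtoC (INR (fact n)) <> 0.
Proof. apply RtoC_neq0, INR_fact_neq_0. Qed.

Lemma INR_S_neq0 (n : nat) : RtoC (INR (S n)) <> 0.
Proof. apply RtoC_neq0, not_0_INR; lia. Qed.

Lemma RtoC_fact_S (n : nat) :
  RtoC (INR (fact (S n))) = INR (S n) * INR (fact n).
Proof. rewrite fact_simpl, mult_INR, RtoC_mult; reflexivity. Qed.

(** * Exponential, logarithm and powers *)

Lemma Cexp_plus (z w : C) : Cexp (z + w) = Cexp z * Cexp w.
Proof.
  unfold Cexp; rewrite re_plus, im_plus, exp_plus, cos_plus, sin_plus.
  apply C_ext; simpl; ring.
Qed.

Lemma Cexp_RtoC (r : R) : Cexp r = exp r.
Proof.
  unfold Cexp; rewrite re_RtoC, im_RtoC, cos_0, sin_0.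
  apply C_ext; simpl; ring.
Qed.

Lemma Cexp_0 : Cexp 0 = 1.
Proof. rewrite Cexp_RtoC, exp_0; reflexivity. Qed.

Lemma Cmod_Cexp (z : C) : Cmod (Cexp z) = exp (Re z).
Proof.
  assert (H : (0 < exp (Re z))%R) by apply exp_pos.
  apply Rsqr_inj; [apply Cmod_ge_0 | lra |].
  unfold Rsqr; rewrite Cmod_sqr; unfold Cexp; simpl.
  generalize (sin2_cos2 (Im z)); unfold Rsqr; intros E.
  replace (exp (Re z) * cos (Im z) * (exp (Re z) * cos (Im z)) +
    exp (Re z) * sin (Im z) * (exp (Re z) * sin (Im z)))%R
  with (exp (Re z) * exp (Re z) *
    (sin (Im z) * sin (Im z) + cos (Im z) * cos (Im z)))%R by ring.
  rewrite E; ring.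
Qed.

Lemma Cexp_neq0 (z : C) : Cexp z <> 0.
Proof.
  apply Cmod_gt_0; rewrite Cmod_Cexp; apply exp_pos.
Qed.

Lemma Cexp_opp (z : C) : Cexp (- z) = / Cexp z.
Proof.
  assert (H := Cexp_neq0 z).
  assert (E : Cexp z * Cexp (- z) = 1).
  { rewrite <- Cexp_plus; replace (z + - z) with (RtoC 0) by ring; apply Cexp_0. }
  replace (Cexp (- z)) with (/ Cexp z * (Cexp z * Cexp (- z))) by (field; exact H).
  rewrite E; ring.
Qed.

Lemma Cexp_INR_mult (n : nat) (z : C) : Cexp (INR n * z) = Cexp z ^ n.
Proof.
  induction n as [|n IH].
  - simpl; replace (0 * z) with (RtoC 0) by ring; apply Cexp_0.
  - rewrite RtoC_INR_S, Cpow_S, <- IH, <- Cexp_plus; f_equal; ring.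
Qed.

Lemma Re_div_Cmod_bound (z : C) : z <> 0 -> (-1 <= Re z / Cmod z <= 1)%R.
Proof.
  intros Hz; apply Cmod_gt_0 in Hz.
  assert (H := re_le_Cmod z); apply Rabs_le_between in H.
  split; apply Rmult_le_reg_r with (Cmod z); auto;
    unfold Rdiv; rewrite Rmult_assoc, Rinv_l; lra.
Qed.

Lemma cos_Carg (z : C) : z <> 0 -> cos (Carg z) = (Re z / Cmod z)%R.
Proof.
  intros Hz; unfold Carg; destruct Rle_dec; [|rewrite cos_neg];
    apply cos_acos, Re_div_Cmod_bound, Hz.
Qed.

Lemma sin_Carg (z : C) : z <> 0 -> sin (Carg z) = (Im z / Cmod z)%R.
Proof.
  intros Hz.
  assert (Hp : (0 < Cmod z)%R) by (apply Cmod_gt_0; exact Hz).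
  assert (E : sqrt (1 - Rsqr (Re z / Cmod z)) = (Rabs (Im z) / Cmod z)%R).
  { replace (1 - Rsqr (Re z / Cmod z))%R with (Rsqr (Im z / Cmod z)).
    - rewrite sqrt_Rsqr_abs; unfold Rdiv; rewrite Rabs_mult, (Rabs_pos_eq (/ Cmod z)); auto.
      left; apply Rinv_0_lt_compat; auto.
    - assert (Q := Cmod_sqr z).
      unfold Rsqr, Rdiv.
      replace 1%R with ((Cmod z * Cmod z) * (/ Cmod z * / Cmod z))%R by (field; lra).
      rewrite Q; ring. }
  unfold Carg; destruct Rle_dec as [h|h]; [|rewrite sin_neg];
    rewrite sin_acos by (apply Re_div_Cmod_bound, Hz); rewrite E.
  - rewrite Rabs_pos_eq; auto.
  - rewrite Rabs_left; [field; lra | lra].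
Qed.

Lemma Cexp_Cln (z : C) : z <> 0 -> Cexp (Cln z) = z.
Proof.
  intros Hz.
  assert (Hp : (0 < Cmod z)%R) by (apply Cmod_gt_0; exact Hz).
  unfold Cexp, Cln; simpl.
  rewrite exp_ln, cos_Carg, sin_Carg; auto.
  apply C_ext; simpl; field; lra.
Qed.

Lemma Carg_bound (z : C) : (Rabs (Carg z) <= PI)%R.
Proof.
  unfold Carg; generalize (acos_bound (Re z / Cmod z)); intros H.
  destruct Rle_dec; [|rewrite Rabs_Ropp]; rewrite Rabs_pos_eq; lra.
Qed.

Lemma Carg_RtoC_pos (r : R) : (0 < r)%R -> Carg r = 0%R.
Proof.
  intros H; unfold Carg; rewrite im_RtoC, re_RtoC, Cmod_R, Rabs_pos_eq by lra.
  destruct Rle_dec as [_|h]; [|lra].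
  unfold Rdiv; rewrite Rinv_r, acos_1; lra.
Qed.

Lemma Cln_RtoC_pos (r : R) : (0 < r)%R -> Cln r = ln r.
Proof.
  intros H; unfold Cln; rewrite Carg_RtoC_pos, Cmod_R, Rabs_pos_eq by lra; reflexivity.
Qed.

Lemma Cpowc_plus (z w1 w2 : C) : Cpowc z (w1 + w2) = Cpowc z w1 * Cpowc z w2.
Proof. unfold Cpowc; rewrite <- Cexp_plus; f_equal; ring. Qed.

Lemma Cpowc_opp (z w : C) : Cpowc z (- w) = / Cpowc z w.
Proof. unfold Cpowc; rewrite <- Cexp_opp; f_equal; ring. Qed.

Lemma Cpowc_neq0 (z w : C) : Cpowc z w <> 0.
Proof. apply Cexp_neq0. Qed.

Lemma Cpowc_INR (z : C) (n : nat) : z <> 0 -> Cpowc z (INR n) = z ^ n.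
Proof. intros H; unfold Cpowc; rewrite Cexp_INR_mult, Cexp_Cln; auto. Qed.

Lemma Cpowc_1 (z : C) : z <> 0 -> Cpowc z 1 = z.
Proof. intros H; unfold Cpowc; rewrite Cmult_1_l, Cexp_Cln; auto. Qed.

Lemma Cpowc_base1 (w : C) : Cpowc 1 w = 1.
Proof.
  unfold Cpowc; rewrite Cln_RtoC_pos, ln_1 by lra.
  replace (w * 0) with (RtoC 0) by ring; apply Cexp_0.
Qed.

Lemma Cmod_Cpowc (z w : C) :
  Cmod (Cpowc z w) = exp (Re w * ln (Cmod z) - Im w * Carg z).
Proof.
  unfold Cpowc; rewrite Cmod_Cexp, re_mult; unfold Cln; reflexivity.
Qed.

Definition cut_plane (z : C) : Prop := ~ (Im z = 0%R /\ (Re z <= 0)%R).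

Lemma cut_plane_Cmod (z : C) : cut_plane z -> (0 < Cmod z + Re z)%R.
Proof.
  intros H.
  assert (E := Cmod_sqr z).
  assert (P := Cmod_ge_0 z).
  destruct (Rlt_dec 0 (Cmod z + Re z)) as [h|h]; auto.
  exfalso; apply H.
  assert (h1 : (Re z <= 0)%R) by lra.
  split; auto.
  assert (h2 : (Im z * Im z <= 0)%R) by nra.
  nra.
Qed.

Lemma Cmod_cut_plane (z : C) : (0 < Cmod z + Re z)%R -> cut_plane z.
Proof.
  intros H [E1 E2].
  assert (E := Cmod_sqr z); rewrite E1 in E.
  assert (P := Cmod_ge_0 z).
  nra.
Qed.

Lemma cut_plane_neq0 (z : C) : cut_plane z -> z <> 0.
Proof. intros H E; apply H; rewrite E; simpl; split; lra. Qed.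

Lemma cut_plane_RtoC_pos (r : R) : (0 < r)%R -> cut_plane r.
Proof. intros H [_ E]; rewrite re_RtoC in E; lra. Qed.

Lemma cut_plane_Re_pos (z : C) : (0 < Re z)%R -> cut_plane z.
Proof. intros H [_ E]; lra. Qed.

(** Half-angle formula: unlike arccosine, it is visibly smooth off the cut. *)
Lemma Carg_atan (z : C) :
  cut_plane z -> Carg z = (2 * atan (Im z / (Cmod z + Re z)))%R.
Proof.
  intros Hz.
  assert (H0 := cut_plane_Cmod z Hz).
  assert (Hp : (0 < Cmod z)%R) by (apply Cmod_gt_0, cut_plane_neq0, Hz).
  set (tau := (Im z / (Cmod z + Re z))%R).
  assert (Hc : cos (2 * atan tau) = (Re z / Cmod z)%R).
  { rewrite cos_2a_cos.
    assert (Q : (0 < 1 + tau * tau)%R) by nra.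
    assert (E1 : (cos (atan tau) * cos (atan tau) = / (1 + tau * tau))%R).
    { rewrite cos_atan; unfold Rsqr, Rdiv.
      rewrite Rmult_1_l, <- Rinv_mult, sqrt_sqrt by lra; reflexivity. }
    replace (2 * cos (atan tau) * cos (atan tau) - 1)%R
      with (2 * (cos (atan tau) * cos (atan tau)) - 1)%R by ring.
    rewrite E1.
    assert (E2 : (1 + tau * tau = 2 * Cmod z / (Cmod z + Re z))%R).
    { unfold tau.
      assert (E := Cmod_sqr z).
      replace (1 + Im z / (Cmod z + Re z) * (Im z / (Cmod z + Re z)))%R
        with (((Cmod z + Re z) * (Cmod z + Re z) + Im z * Im z) /
              ((Cmod z + Re z) * (Cmod z + Re z)))%R by (field; lra).
      replace ((Cmod z + Re z) * (Cmod z + Re z) + Im z * Im z)%R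
        with (2 * Cmod z * (Cmod z + Re z))%R by lra.
      field; lra. }
    rewrite E2; field; split; lra. }
  assert (B := atan_bound tau).
  assert (PP := PI_RGT_0).
  unfold Carg; rewrite <- Hc.
  destruct Rle_dec as [h|h].
  - assert (T : (0 <= tau)%R).
    { unfold tau, Rdiv; apply Rmult_le_pos; auto; left; apply Rinv_0_lt_compat; auto. }
    apply acos_cos.
    assert (0 <= atan tau)%R.
    { destruct T as [T|T]; [rewrite <- atan_0; left; apply atan_increasing; auto|
        rewrite <- T, atan_0; lra]. }
    lra.
  - assert (T : (tau < 0)%R).
    { unfold tau, Rdiv.
      assert (0 < / (Cmod z + Re z))%R by (apply Rinv_0_lt_compat; auto).
      nra. }
    assert (atan tau < 0)%R.
    { rewrite <- atan_0; apply atan_increasing; auto. }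
    replace (2 * atan tau)%R with (- (- (2 * atan tau)))%R at 1 by ring.
    rewrite cos_neg, acos_cos; lra.
Qed.

(** * Calculus of complex-valued functions of a real variable *)

Definition Cderiv (f : R -> C) (t : R) (l : C) : Prop :=
  is_derive (fun u => Re (f u)) t (Re l) /\ is_derive (fun u => Im (f u)) t (Im l).

Definition Ccont (f : R -> C) (t : R) : Prop :=
  continuous (fun u => Re (f u)) t /\ continuous (fun u => Im (f u)) t.

Lemma Cderiv_eq (f : R -> C) (t : R) (l m : C) : l = m -> Cderiv f t l -> Cderiv f t m.
Proof. intros ->; auto. Qed.

Lemma Cderiv_ext (f g : R -> C) (t : R) (l : C) :
  (forall u, f u = g u) -> Cderiv f t l -> Cderiv g t l.
Proof.
  intros E [H1 H2]; split; [apply is_derive_ext with (2 := H1) |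
    apply is_derive_ext with (2 := H2)]; intros u; rewrite E; reflexivity.
Qed.

Lemma Ccont_ext (f g : R -> C) (t : R) :
  (forall u, f u = g u) -> Ccont f t -> Ccont g t.
Proof.
  intros E [H1 H2]; split; [apply continuous_ext with (2 := H1) |
    apply continuous_ext with (2 := H2)]; intros u; rewrite E; reflexivity.
Qed.

Lemma Cderiv_Ccont (f : R -> C) (t : R) (l : C) : Cderiv f t l -> Ccont f t.
Proof.
  intros [H1 H2]; split; apply (@ex_derive_continuous R_AbsRing R_NormedModule); eexists; eassumption.
Qed.

Lemma Cderiv_const (z : C) (t : R) : Cderiv (fun _ => z) t 0.
Proof. split; apply (@is_derive_const R_AbsRing R_NormedModule). Qed.

Lemma Cderiv_RtoC (f : R -> R) (t l : R) :
  is_derive f t l -> Cderiv (fun u => RtoC (f u)) t l.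
Proof. intros H; split; simpl; [exact H | apply (@is_derive_const R_AbsRing R_NormedModule)]. Qed.

Lemma Cderiv_id (t : R) : Cderiv RtoC t 1.
Proof. apply (Cderiv_RtoC (fun u => u)), (@is_derive_id R_AbsRing). Qed.

Lemma Cderiv_plus (f g : R -> C) (t : R) (l m : C) :
  Cderiv f t l -> Cderiv g t m -> Cderiv (fun u => f u + g u) t (l + m).
Proof.
  intros [H1 H2] [H3 H4]; split; simpl.
  - apply (@is_derive_plus R_AbsRing R_NormedModule) with (1 := H1) (2 := H3).
  - apply (@is_derive_plus R_AbsRing R_NormedModule) with (1 := H2) (2 := H4).
Qed.

Lemma is_derive_Rmult (f g : R -> R) (t l m : R) :
  is_derive f t l -> is_derive g t m ->
  is_derive (fun u => f u * g u)%R t (l * g t + f t * m)%R.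
Proof. intros H1 H2; apply (is_derive_mult f g t l m H1 H2), Rmult_comm. Qed.

Lemma Cderiv_mult (f g : R -> C) (t : R) (l m : C) :
  Cderiv f t l -> Cderiv g t m ->
  Cderiv (fun u => f u * g u) t (l * g t + f t * m).
Proof.
  intros [H1 H2] [H3 H4]; split.
  - apply is_derive_ext with (fun u => Re (f u) * Re (g u) - Im (f u) * Im (g u))%R.
    { intros u; rewrite re_mult; reflexivity. }
    rewrite re_plus, !re_mult.
    evar_last.
    { apply (@is_derive_minus R_AbsRing R_NormedModule);
        apply is_derive_Rmult; eassumption. }
    simpl; unfold minus, plus, opp; simpl; ring.
  - apply is_derive_ext with (fun u => Re (f u) * Im (g u) + Im (f u) * Re (g u))%R.
    { intros u; rewrite im_mult; reflexivity. }
    rewrite im_plus, !im_mult.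
    evar_last.
    { apply (@is_derive_plus R_AbsRing R_NormedModule);
        apply is_derive_Rmult; eassumption. }
    simpl; unfold plus; simpl; ring.
Qed.

Lemma Cderiv_scal (z : C) (f : R -> C) (t : R) (l : C) :
  Cderiv f t l -> Cderiv (fun u => z * f u) t (z * l).
Proof.
  intros H; eapply Cderiv_eq; [|apply Cderiv_mult; [apply Cderiv_const|exact H]]; cbv beta; ring.
Qed.

Lemma Cderiv_opp (f : R -> C) (t : R) (l : C) :
  Cderiv f t l -> Cderiv (fun u => - f u) t (- l).
Proof.
  intros H; eapply Cderiv_eq; [|eapply Cderiv_ext; [|apply (Cderiv_scal (- (1))), H]].
  - ring.
  - intros u; simpl; ring.
Qed.

Lemma Cderiv_minus (f g : R -> C) (t : R) (l m : C) :
  Cderiv f t l -> Cderiv g t m -> Cderiv (fun u => f u - g u) t (l - m).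
Proof. intros; apply Cderiv_plus; auto; apply Cderiv_opp; auto. Qed.

Lemma Cderiv_Cexp (f : R -> C) (t : R) (l : C) :
  Cderiv f t l -> Cderiv (fun u => Cexp (f u)) t (l * Cexp (f t)).
Proof.
  intros [H1 H2]; unfold Cexp; split.
  - evar_last.
    { simpl; apply is_derive_Rmult.
      - apply (is_derive_comp exp (fun u => Re (f u))); [apply is_derive_exp|exact H1].
      - apply (is_derive_comp cos (fun u => Im (f u))); [apply is_derive_cos|exact H2]. }
    rewrite re_mult; unfold scal; simpl; unfold mult; simpl; ring.
  - evar_last.
    { simpl; apply is_derive_Rmult.
      - apply (is_derive_comp exp (fun u => Re (f u))); [apply is_derive_exp|exact H1].
      - apply (is_derive_comp sin (fun u => Im (f u))); [apply is_derive_sin|exact H2]. }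
    rewrite im_mult; unfold scal; simpl; unfold mult; simpl; ring.
Qed.

Lemma Cderiv_pow (f : R -> C) (t : R) (l : C) (n : nat) :
  Cderiv f t l -> Cderiv (fun u => f u ^ S n) t (INR (S n) * l * f t ^ n).
Proof.
  intros H; induction n as [|n IH].
  - apply Cderiv_eq with l; [simpl; ring|].
    apply Cderiv_ext with f; auto; intros u; simpl; ring.
  - eapply Cderiv_eq; [|apply Cderiv_ext with (fun u => f u * f u ^ S n);
      [reflexivity|apply Cderiv_mult; eassumption]].
    rewrite (RtoC_INR_S (S n)), (Cpow_S _ n); ring.
Qed.

Lemma Cderiv_line (p q : C) (t : R) : Cderiv (fun l => p + l * q) t q.
Proof.
  eapply Cderiv_eq; [|apply Cderiv_plus; [apply Cderiv_const|
    apply Cderiv_mult; [apply Cderiv_id|apply Cderiv_const]]]; cbv beta; ring.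
Qed.

(** Straight lines are the only paths used below; along them the derivative of
    the logarithm is a computation with two real functions of one variable. *)
Lemma Cderiv_Cln (p q : C) (t : R) :
  cut_plane (p + t * q) -> Cderiv (fun l => Cln (p + l * q)) t (q / (p + t * q)).
Proof.
  intros Hz.
  destruct p as [p1 p2], q as [q1 q2].
  set (X := fun l : R => (p1 + l * q1)%R).
  set (Y := fun l : R => (p2 + l * q2)%R).
  assert (EX : forall l : R, Re ((p1, p2) + l * (q1, q2)) = X l)
    by (intros l; unfold X; simpl; ring).
  assert (EY : forall l : R, Im ((p1, p2) + l * (q1, q2)) = Y l)
    by (intros l; unfold Y; simpl; ring).
  assert (EM : forall l : R, Cmod ((p1, p2) + l * (q1, q2)) =
     sqrt (X l * X l + Y l * Y l)).
  { intros l; unfold Cmod; f_equal; change fst with Re; change snd with Im.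
    rewrite EX, EY; ring. }
  assert (HP := cut_plane_Cmod _ Hz).
  assert (HN : (0 < X t * X t + Y t * Y t)%R).
  { assert (0 < Cmod ((p1, p2) + t * (q1, q2)))%R by (apply Cmod_gt_0, cut_plane_neq0, Hz).
    generalize (Cmod_sqr ((p1, p2) + t * (q1, q2))); rewrite EX, EY; nra. }
  assert (HS := sqrt_lt_R0 _ HN).
  assert (HSS : (sqrt (X t * X t + Y t * Y t) * sqrt (X t * X t + Y t * Y t) =
     X t * X t + Y t * Y t)%R) by (apply sqrt_sqrt; lra).
  rewrite EM, EX in HP.
  assert (EQ : (q1, q2) / ((p1, p2) + t * (q1, q2)) =
    ((q1 * X t + q2 * Y t) / (X t * X t + Y t * Y t),
     (q2 * X t - q1 * Y t) / (X t * X t + Y t * Y t))%R).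
  { replace ((p1, p2) + t * (q1, q2)) with ((X t, Y t) : C)
      by (apply C_ext; [rewrite EX|rewrite EY]; reflexivity).
    apply C_ext; simpl; field; nra. }
  split.
  - apply is_derive_ext with (fun l => ln (sqrt (X l * X l + Y l * Y l))).
    { intros l; simpl; rewrite EM; reflexivity. }
    rewrite EQ; simpl.
    unfold X, Y in *.
    set (S := sqrt ((p1 + t * q1) * (p1 + t * q1) + (p2 + t * q2) * (p2 + t * q2))) in *.
    auto_derive.
    + fold S; repeat split; auto; lra.
    + fold S.
      rewrite <- HSS; field; lra.
  - apply is_derive_ext_loc with
      (fun l => 2 * atan (Y l / (sqrt (X l * X l + Y l * Y l) + X l)))%R.
    { assert (HC : continuous (fun l => sqrt (X l * X l + Y l * Y l) + X l)%R t).
      { apply (@ex_derive_continuous R_AbsRing R_NormedModule).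
        unfold X, Y in *; auto_derive; repeat split; auto; lra. }
      assert (HL := HC (fun v => (0 < v)%R) (open_gt 0 _ HP)).
      destruct HL as [eps HL]; exists eps; intros l Hl.
      specialize (HL l Hl); simpl in HL.
      simpl; rewrite Carg_atan.
      - rewrite EM, EX, EY; reflexivity.
      - apply Cmod_cut_plane; rewrite EM, EX; exact HL. }
    rewrite EQ; simpl.
    unfold X, Y in *.
    set (S := sqrt ((p1 + t * q1) * (p1 + t * q1) + (p2 + t * q2) * (p2 + t * q2))) in *.
    auto_derive.
    + fold S; repeat split; auto; lra.
    + fold S.
      rewrite <- HSS.
      set (x := (p1 + t * q1)%R) in *; set (y := (p2 + t * q2)%R) in *.
      assert (N1 : ((S + x) * (S + x) + y * y = 2 * S * (S + x))%R) by lra.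
      assert (N2 : (y * y = S * S - x * x)%R) by lra.
      replace (1 + y * / (S + x) * (y * / (S + x) * 1))%R
        with (2 * S / (S + x))%R.
      2:{ replace (2 * S / (S + x))%R with (2 * S * (S + x) / ((S + x) * (S + x)))%R
            by (field; lra).
          rewrite <- N1; field; lra. }
      transitivity ((q2 * (S * S + S * x - y * y) - y * q1 * (x + S)) / (S * S * (S + x)))%R.
      * field; lra.
      * rewrite N2; field; lra.
Qed.

(** Mean value inequality.  The factor 2 is the price of treating the real and
    imaginary parts separately; it never matters below. *)
Lemma Cderiv_bound (f : R -> C) (df : R -> C) (g dg : R -> R) (a b : R) :
  (a <= b)%R ->
  (forall t, (a <= t <= b)%R -> Cderiv f t (df t)) ->
  (forall t, (a <= t <= b)%R -> is_derive g t (dg t)) ->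
  (forall t, (a <= t <= b)%R -> (Cmod (df t) <= dg t)%R) ->
  (Cmod (f b - f a) <= 2 * (g b - g a))%R.
Proof.
  intros Hab Hf Hg Hb.
  assert (K : forall (h dh : R -> R),
    (forall t, (a <= t <= b)%R -> is_derive h t (dh t)) ->
    (forall t, (a <= t <= b)%R -> (0 <= dh t)%R) -> (h a <= h b)%R).
  { intros h dh H1 H2.
    destruct (MVT_gen h a b dh) as [c [Hc E]].
    - rewrite Rmin_left, Rmax_right by auto; intros; apply H1; lra.
    - rewrite Rmin_left, Rmax_right by auto; intros; apply continuity_pt_filterlim.
      apply (@ex_derive_continuous R_AbsRing R_NormedModule); eexists; apply H1; lra.
    - rewrite Rmin_left, Rmax_right in Hc by auto.
      specialize (H2 c Hc); nra. }
  assert (K2 : forall (h dh : R -> R),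
    (forall t, (a <= t <= b)%R -> is_derive h t (dh t)) ->
    (forall t, (a <= t <= b)%R -> (Rabs (dh t) <= dg t)%R) ->
    (Rabs (h b - h a) <= g b - g a)%R).
  { intros h dh H1 H2.
    assert (Q1 : (g a - h a <= g b - h b)%R).
    { apply (K (fun t => g t - h t)%R (fun t => dg t - dh t)%R).
      - intros t Ht; apply (@is_derive_minus R_AbsRing R_NormedModule); auto.
      - intros t Ht; specialize (H2 t Ht); apply Rabs_le_between in H2; lra. }
    assert (Q2 : (g a + h a <= g b + h b)%R).
    { apply (K (fun t => g t + h t)%R (fun t => dg t + dh t)%R).
      - intros t Ht; apply (@is_derive_plus R_AbsRing R_NormedModule); auto.
      - intros t Ht; specialize (H2 t Ht); apply Rabs_le_between in H2; lra. }
    apply Rabs_le; lra. }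
  eapply Rle_trans; [apply Cmod_le_Re_Im|].
  rewrite Re_minus, Im_minus.
  assert (H1 := K2 (fun t => Re (f t)) (fun t => Re (df t))
    (fun t Ht => proj1 (Hf t Ht))
    (fun t Ht => Rle_trans _ _ _ (re_le_Cmod _) (Hb t Ht))).
  assert (H2 := K2 (fun t => Im (f t)) (fun t => Im (df t))
    (fun t Ht => proj2 (Hf t Ht))
    (fun t Ht => Rle_trans _ _ _ (Im_le_Cmod _) (Hb t Ht))).
  simpl in H1, H2; lra.
Qed.

Lemma Cderiv_bound_const (f df : R -> C) (M a b : R) :
  (a <= b)%R ->
  (forall t, (a <= t <= b)%R -> Cderiv f t (df t)) ->
  (forall t, (a <= t <= b)%R -> (Cmod (df t) <= M)%R) ->
  (Cmod (f b - f a) <= 2 * M * (b - a))%R.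
Proof.
  intros Hab Hf Hb.
  replace (2 * M * (b - a))%R with (2 * (M * b - M * a))%R by ring.
  apply Cderiv_bound with (df := df) (g := fun t => (M * t)%R) (dg := fun _ => M); auto.
  intros t _; auto_derive; auto; ring.
Qed.

Lemma Ccont_const (z : C) (t : R) : Ccont (fun _ => z) t.
Proof. eapply Cderiv_Ccont, Cderiv_const. Qed.

Lemma Ccont_RtoC (f : R -> R) (t : R) : continuous f t -> Ccont (fun u => RtoC (f u)) t.
Proof. intros H; split; simpl; [exact H | apply continuous_const]. Qed.

Lemma Ccont_plus (f g : R -> C) (t : R) :
  Ccont f t -> Ccont g t -> Ccont (fun u => f u + g u) t.
Proof.
  intros [H1 H2] [H3 H4]; split.
  - apply (continuous_plus (fun u => Re (f u)) (fun u => Re (g u))); auto.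
  - apply (continuous_plus (fun u => Im (f u)) (fun u => Im (g u))); auto.
Qed.

Lemma Ccont_mult (f g : R -> C) (t : R) :
  Ccont f t -> Ccont g t -> Ccont (fun u => f u * g u) t.
Proof.
  intros [H1 H2] [H3 H4]; split.
  - apply (continuous_minus (fun u => Re (f u) * Re (g u))%R (fun u => Im (f u) * Im (g u))%R);
      apply (@continuous_mult R_UniformSpace R_AbsRing); auto.
  - apply (continuous_plus (fun u => Re (f u) * Im (g u))%R (fun u => Im (f u) * Re (g u))%R);
      apply (@continuous_mult R_UniformSpace R_AbsRing); auto.
Qed.

Lemma Ccont_scal (z : C) (f : R -> C) (t : R) :
  Ccont f t -> Ccont (fun u => z * f u) t.
Proof. intros H; apply Ccont_mult; auto; apply Ccont_const. Qed.

Lemma Ccont_opp (f : R -> C) (t : R) : Ccont f t -> Ccont (fun u => - f u) t.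
Proof.
  intros H; apply Ccont_ext with (fun u => (- (1)) * f u); [intros; ring|].
  apply Ccont_scal, H.
Qed.

Lemma Ccont_minus (f g : R -> C) (t : R) :
  Ccont f t -> Ccont g t -> Ccont (fun u => f u - g u) t.
Proof. intros; apply Ccont_plus; auto; apply Ccont_opp; auto. Qed.

Lemma Ccont_pow (f : R -> C) (t : R) (n : nat) :
  Ccont f t -> Ccont (fun u => f u ^ n) t.
Proof.
  intros H; induction n as [|n IH]; [apply Ccont_const|].
  apply (Ccont_mult f (fun u => f u ^ n)); auto.
Qed.

Lemma Ccont_Cexp (f : R -> C) (t : R) :
  Ccont f t -> Ccont (fun u => Cexp (f u)) t.
Proof.
  intros [H1 H2]; unfold Cexp; split; simpl;
    apply (@continuous_mult R_UniformSpace R_AbsRing).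
  - apply (continuous_comp (fun u => Re (f u)) exp); auto.
    apply (@ex_derive_continuous R_AbsRing R_NormedModule); eexists; apply is_derive_exp.
  - apply (continuous_comp (fun u => Im (f u)) cos); auto.
    apply (@ex_derive_continuous R_AbsRing R_NormedModule); eexists; apply is_derive_cos.
  - apply (continuous_comp (fun u => Re (f u)) exp); auto.
    apply (@ex_derive_continuous R_AbsRing R_NormedModule); eexists; apply is_derive_exp.
  - apply (continuous_comp (fun u => Im (f u)) sin); auto.
    apply (@ex_derive_continuous R_AbsRing R_NormedModule); eexists; apply is_derive_sin.
Qed.

Lemma Ccont_line (p q : C) (t : R) : Ccont (fun l => p + l * q) t.
Proof. eapply Cderiv_Ccont, Cderiv_line. Qed.

Lemma Cderiv_Cpowc (p q w : C) (t : R) :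
  cut_plane (p + t * q) ->
  Cderiv (fun l => Cpowc (p + l * q) w) t (w * q / (p + t * q) * Cpowc (p + t * q) w).
Proof.
  intros H; unfold Cpowc.
  eapply Cderiv_eq; [|apply Cderiv_Cexp, Cderiv_scal, Cderiv_Cln, H].
  cbv beta; field; apply cut_plane_neq0, H.
Qed.

(** * Integrals over the unit interval *)

Definition CInt (f : R -> C) : C :=
  (RInt (fun t => Re (f t)) 0 1, RInt (fun t => Im (f t)) 0 1).

Definition Ccont01 (f : R -> C) : Prop := forall t, (0 <= t <= 1)%R -> Ccont f t.

Lemma Ccont01_Re (f : R -> C) : Ccont01 f -> ex_RInt (fun t => Re (f t)) 0 1.
Proof.
  intros H; apply (@ex_RInt_continuous R_CompleteNormedModule).
  rewrite Rmin_left, Rmax_right by lra; intros t Ht; apply H, Ht.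
Qed.

Lemma Ccont01_Im (f : R -> C) : Ccont01 f -> ex_RInt (fun t => Im (f t)) 0 1.
Proof.
  intros H; apply (@ex_RInt_continuous R_CompleteNormedModule).
  rewrite Rmin_left, Rmax_right by lra; intros t Ht; apply H, Ht.
Qed.

Lemma CInt_ext (f g : R -> C) :
  (forall t, (0 < t < 1)%R -> f t = g t) -> CInt f = CInt g.
Proof.
  intros H; unfold CInt; f_equal; apply RInt_ext;
    rewrite Rmin_left, Rmax_right by lra; intros t Ht; rewrite H; auto.
Qed.

Lemma CInt_plus (f g : R -> C) :
  Ccont01 f -> Ccont01 g -> CInt (fun t => f t + g t) = CInt f + CInt g.
Proof.
  intros Hf Hg; unfold CInt; apply C_ext; simpl.
  - apply (RInt_plus (fun t => Re (f t)) (fun t => Re (g t)) 0 1); apply Ccont01_Re; auto.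
  - apply (RInt_plus (fun t => Im (f t)) (fun t => Im (g t)) 0 1); apply Ccont01_Im; auto.
Qed.

Lemma CInt_scal (z : C) (f : R -> C) :
  Ccont01 f -> CInt (fun t => z * f t) = z * CInt f.
Proof.
  intros Hf.
  assert (H1 := Ccont01_Re f Hf); assert (H2 := Ccont01_Im f Hf).
  unfold CInt; apply C_ext.
  - rewrite re_mult.
    transitivity (RInt (fun t => minus (scal (Re z) (Re (f t))) (scal (Im z) (Im (f t)))) 0 1).
    + apply RInt_ext; intros t _; rewrite re_mult; reflexivity.
    + rewrite (RInt_minus (fun t => scal (Re z) (Re (f t))) (fun t => scal (Im z) (Im (f t))));
        [|apply (@ex_RInt_scal R_NormedModule); auto..].
      rewrite (RInt_scal (fun t => Re (f t))), (RInt_scal (fun t => Im (f t))); auto.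
  - rewrite im_mult.
    transitivity (RInt (fun t => plus (scal (Re z) (Im (f t))) (scal (Im z) (Re (f t)))) 0 1).
    + apply RInt_ext; intros t _; rewrite im_mult; reflexivity.
    + rewrite (RInt_plus (fun t => scal (Re z) (Im (f t))) (fun t => scal (Im z) (Re (f t))));
        [|apply (@ex_RInt_scal R_NormedModule); auto..].
      rewrite (RInt_scal (fun t => Re (f t))), (RInt_scal (fun t => Im (f t))); auto.
Qed.

Lemma CInt_minus (f g : R -> C) :
  Ccont01 f -> Ccont01 g -> CInt (fun t => f t - g t) = CInt f - CInt g.
Proof.
  intros Hf Hg.
  transitivity (CInt (fun t => f t + (- (1)) * g t)).
  - apply CInt_ext; intros; ring.
  - rewrite CInt_plus, CInt_scal; auto; [ring|].
    intros t Ht; apply Ccont_scal; auto.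
Qed.

Lemma CInt_deriv (f df : R -> C) :
  (forall t, (0 <= t <= 1)%R -> Cderiv f t (df t)) -> Ccont01 df ->
  CInt df = f 1%R - f 0%R.
Proof.
  intros H1 H2; unfold CInt; apply C_ext; [rewrite Re_minus|rewrite Im_minus]; simpl;
    apply is_RInt_unique.
  - apply (is_RInt_derive (fun t => Re (f t)) (fun t => Re (df t)));
      rewrite Rmin_left, Rmax_right by lra; intros t Ht; [apply H1|apply H2]; auto.
  - apply (is_RInt_derive (fun t => Im (f t)) (fun t => Im (df t)));
      rewrite Rmin_left, Rmax_right by lra; intros t Ht; [apply H1|apply H2]; auto.
Qed.

Lemma CInt_bound (f : R -> C) (g : R -> R) :
  Ccont01 f -> (forall t, (0 <= t <= 1)%R -> continuous g t) ->
  (forall t, (0 < t < 1)%R -> (Cmod (f t) <= g t)%R) ->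
  (Cmod (CInt f) <= 2 * RInt g 0 1)%R.
Proof.
  intros Hf Hg H.
  assert (Hg' : ex_RInt g 0 1).
  { apply (@ex_RInt_continuous R_CompleteNormedModule).
    rewrite Rmin_left, Rmax_right by lra; exact Hg. }
  assert (Hg2 : ex_RInt (fun t => - g t)%R 0 1)
    by (apply (@ex_RInt_opp R_NormedModule g); auto).
  assert (E2 : RInt (fun t => - g t)%R 0 1 = (- RInt g 0 1)%R)
    by (apply (RInt_opp g); auto).
  assert (K : forall h : R -> R, ex_RInt h 0 1 ->
    (forall t, (0 < t < 1)%R -> (Rabs (h t) <= g t)%R) -> (Rabs (RInt h 0 1) <= RInt g 0 1)%R).
  { intros h Hh Hb; apply Rabs_le; rewrite <- E2; split; apply RInt_le; auto; try lra;
      intros t Ht; specialize (Hb t Ht); apply Rabs_le_between in Hb; lra. }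
  eapply Rle_trans; [apply Cmod_le_Re_Im|].
  unfold CInt; simpl.
  assert (Q1 := K _ (Ccont01_Re f Hf)
    (fun t Ht => Rle_trans _ _ _ (re_le_Cmod _) (H t Ht))).
  assert (Q2 := K _ (Ccont01_Im f Hf)
    (fun t Ht => Rle_trans _ _ _ (Im_le_Cmod _) (H t Ht))).
  lra.
Qed.

Lemma CInt_bound_const (f : R -> C) (M : R) :
  Ccont01 f -> (forall t, (0 < t < 1)%R -> (Cmod (f t) <= M)%R) ->
  (Cmod (CInt f) <= 2 * M)%R.
Proof.
  intros Hf H.
  assert (Q := CInt_bound f (fun _ => M) Hf (fun t _ => continuous_const M t) H).
  rewrite RInt_const in Q; unfold scal in Q; simpl in Q; unfold mult in Q; simpl in Q; lra.
Qed.

(** * Finite sums, limits and series of complex numbers *)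

Fixpoint Csum (f : nat -> C) (n : nat) : C :=
  match n with
  | O => 0
  | S m => Csum f m + f m
  end.

Lemma sum_n_Csum (f : nat -> C) (n : nat) : sum_n f n = Csum f (S n).
Proof.
  induction n as [|n IH].
  - rewrite sum_O; simpl; ring.
  - rewrite sum_Sn, IH; reflexivity.
Qed.

Lemma Csum_ext (f g : nat -> C) (n : nat) :
  (forall k, (k < n)%nat -> f k = g k) -> Csum f n = Csum g n.
Proof.
  induction n as [|n IH]; intros H; simpl; auto.
  rewrite IH, H; auto.
Qed.

Lemma Csum_plus (f g : nat -> C) (n : nat) :
  Csum (fun k => f k + g k) n = Csum f n + Csum g n.
Proof. induction n as [|n IH]; simpl; [ring|rewrite IH; ring]. Qed.

Lemma Csum_scal (z : C) (f : nat -> C) (n : nat) :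
  Csum (fun k => z * f k) n = z * Csum f n.
Proof. induction n as [|n IH]; simpl; [ring|rewrite IH; ring]. Qed.

Lemma Csum_minus (f g : nat -> C) (n : nat) :
  Csum (fun k => f k - g k) n = Csum f n - Csum g n.
Proof. induction n as [|n IH]; simpl; [ring|rewrite IH; ring]. Qed.

Lemma Csum_zero (f : nat -> C) (n : nat) :
  (forall k, (k < n)%nat -> f k = 0) -> Csum f n = 0.
Proof.
  induction n as [|n IH]; intros H; simpl; auto.
  rewrite IH, H; auto; ring.
Qed.

Lemma Csum_S (f : nat -> C) (n : nat) : Csum f (S n) = Csum f n + f n.
Proof. reflexivity. Qed.

Lemma Csum_S_l (f : nat -> C) (n : nat) :
  Csum f (S n) = f O + Csum (fun k => f (S k)) n.
Proof.
  induction n as [|n IH]; [simpl; ring|].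
  change (Csum f (S (S n))) with (Csum f (S n) + f (S n)); rewrite IH; simpl; ring.
Qed.

Lemma Csum_add (f : nat -> C) (n m : nat) :
  Csum f (n + m) = Csum f n + Csum (fun k => f (n + k)%nat) m.
Proof.
  induction m as [|m IH]; [rewrite Nat.add_0_r; simpl; ring|].
  rewrite Nat.add_succ_r; simpl; rewrite IH; ring.
Qed.

Lemma Cmod_Csum_le (f : nat -> C) (g : nat -> R) (n : nat) :
  (forall k, (k < n)%nat -> (Cmod (f k) <= g k)%R) ->
  (Cmod (Csum f n) <= Re (Csum (fun k => RtoC (g k)) n))%R.
Proof.
  induction n as [|n IH]; intros H; simpl.
  - rewrite Cmod_0; lra.
  - eapply Rle_trans; [apply Cmod_triangle|].
    apply Rplus_le_compat; [apply IH; auto|apply H; auto].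
Qed.

Lemma Ccont_Csum (f : nat -> R -> C) (n : nat) (t : R) :
  (forall k, (k < n)%nat -> Ccont (f k) t) -> Ccont (fun u => Csum (fun k => f k u) n) t.
Proof.
  induction n as [|n IH]; intros H; simpl; [apply Ccont_const|].
  apply Ccont_plus; auto.
Qed.

Lemma CInt_Csum (f : nat -> R -> C) (n : nat) :
  (forall k, (k < n)%nat -> Ccont01 (f k)) ->
  CInt (fun u => Csum (fun k => f k u) n) = Csum (fun k => CInt (f k)) n.
Proof.
  induction n as [|n IH]; intros H; simpl.
  - unfold CInt; apply C_ext; simpl; rewrite RInt_const; unfold scal; simpl;
      unfold mult; simpl; ring.
  - rewrite CInt_plus, IH; auto.
    intros t Ht; apply Ccont_Csum; intros k Hk; apply H; auto.
Qed.

Definition Ccv (u : nat -> C) (l : C) : Prop := is_lim_seq (fun n => Cmod (u n - l)) 0%R.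

Lemma Ccv_spec (u : nat -> C) (l : C) :
  Ccv u l <-> forall eps : R, (0 < eps)%R ->
    exists N, forall n, (N <= n)%nat -> (Cmod (u n - l) < eps)%R.
Proof.
  split.
  - intros H eps He; apply is_lim_seq_spec in H.
    destruct (H (mkposreal eps He)) as [N HN]; exists N; intros n Hn.
    specialize (HN n Hn); simpl in HN.
    rewrite Rminus_0_r, Rabs_pos_eq in HN; auto; apply Cmod_ge_0.
  - intros H; apply is_lim_seq_spec; intros eps.
    destruct (H eps (cond_pos eps)) as [N HN]; exists N; intros n Hn.
    rewrite Rminus_0_r, Rabs_pos_eq; [apply HN, Hn|apply Cmod_ge_0].
Qed.

Lemma is_lim_seq_squeeze0 (u v : nat -> R) (N : nat) :
  (forall n, (N <= n)%nat -> (0 <= u n <= v n)%R) -> is_lim_seq v 0%R -> is_lim_seq u 0%R.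
Proof.
  intros H Hv; apply is_lim_seq_le_le_loc with (u := fun _ => 0%R) (w := v); auto.
  - exists N; exact H.
  - apply is_lim_seq_const.
Qed.

Lemma Ccv_le (u : nat -> C) (l : C) (v : nat -> R) (N : nat) :
  (forall n, (N <= n)%nat -> (Cmod (u n - l) <= v n)%R) -> is_lim_seq v 0%R -> Ccv u l.
Proof.
  intros H Hv; apply is_lim_seq_squeeze0 with v N; auto.
  intros n Hn; split; [apply Cmod_ge_0|apply H, Hn].
Qed.

Lemma Ccv_ext_ge (u v : nat -> C) (l : C) (N : nat) :
  (forall n, (N <= n)%nat -> u n = v n) -> Ccv u l -> Ccv v l.
Proof.
  intros E H; apply Ccv_le with (fun n => Cmod (u n - l)) N; auto.
  intros n Hn; rewrite E; auto; lra.
Qed.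

Lemma Ccv_ext (u v : nat -> C) (l : C) : (forall n, u n = v n) -> Ccv u l -> Ccv v l.
Proof. intros E; apply Ccv_ext_ge with O; auto. Qed.

Lemma Ccv_const (l : C) : Ccv (fun _ => l) l.
Proof.
  apply Ccv_le with (fun _ => 0%R) O; [|apply is_lim_seq_const].
  intros; replace (l - l) with (RtoC 0) by ring; rewrite Cmod_0; lra.
Qed.

Lemma is_lim_seq_plus0 (u v : nat -> R) :
  is_lim_seq u 0%R -> is_lim_seq v 0%R -> is_lim_seq (fun n => u n + v n)%R 0%R.
Proof.
  intros H1 H2; replace 0%R with (0 + 0)%R by ring; apply is_lim_seq_plus'; auto.
Qed.

Lemma is_lim_seq_scal0 (c : R) (u : nat -> R) :
  is_lim_seq u 0%R -> is_lim_seq (fun n => c * u n)%R 0%R.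
Proof.
  intros H; replace (Finite 0%R) with (Rbar_mult c 0%R) by (simpl; f_equal; ring).
  apply is_lim_seq_scal_l, H.
Qed.

Lemma Ccv_plus (u v : nat -> C) (l m : C) :
  Ccv u l -> Ccv v m -> Ccv (fun n => u n + v n) (l + m).
Proof.
  intros H1 H2; apply Ccv_le with (fun n => Cmod (u n - l) + Cmod (v n - m))%R O.
  - intros n _; replace (u n + v n - (l + m)) with ((u n - l) + (v n - m)) by ring.
    apply Cmod_triangle.
  - apply is_lim_seq_plus0; auto.
Qed.

Lemma Ccv_bounded (u : nat -> C) (l : C) :
  Ccv u l -> exists M, (0 <= M)%R /\ forall n, (Cmod (u n) <= M)%R.
Proof.
  intros H; apply Ccv_spec with (eps := 1%R) in H; [|lra].
  destruct H as [N HN].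
  assert (K : exists M, (0 <= M)%R /\ forall n, (n < N)%nat -> (Cmod (u n) <= M)%R).
  { clear HN; induction N as [|N [M [HM IH]]].
    - exists 0%R; split; [lra|intros; lia].
    - exists (M + Cmod (u N))%R; assert (P := Cmod_ge_0 (u N)); split; [lra|].
      intros n Hn; destruct (Nat.eq_dec n N) as [->|E]; [lra|].
      specialize (IH n ltac:(lia)); lra. }
  destruct K as [M [HM K]].
  exists (M + (Cmod l + 1))%R; assert (P := Cmod_ge_0 l); split; [lra|].
  intros n; destruct (Nat.lt_ge_cases n N) as [h|h].
  - specialize (K n h); lra.
  - specialize (HN n h); generalize (Cmod_triangle_inv (u n) l); lra.
Qed.

Lemma Ccv_mult (u v : nat -> C) (l m : C) :
  Ccv u l -> Ccv v m -> Ccv (fun n => u n * v n) (l * m).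
Proof.
  intros H1 H2; destruct (Ccv_bounded u l H1) as [M [HM B]].
  apply Ccv_le with (fun n => M * Cmod (v n - m) + Cmod m * Cmod (u n - l))%R O.
  - intros n _; replace (u n * v n - l * m) with (u n * (v n - m) + m * (u n - l)) by ring.
    eapply Rle_trans; [apply Cmod_triangle|]; rewrite !Cmod_mult.
    specialize (B n); assert (P := Cmod_ge_0 (v n - m)); nra.
  - apply is_lim_seq_plus0; apply is_lim_seq_scal0; auto.
Qed.

Lemma Ccv_scal (z : C) (u : nat -> C) (l : C) :
  Ccv u l -> Ccv (fun n => z * u n) (z * l).
Proof. intros H; apply Ccv_mult; auto; apply Ccv_const. Qed.

Lemma Ccv_minus (u v : nat -> C) (l m : C) :
  Ccv u l -> Ccv v m -> Ccv (fun n => u n - v n) (l - m).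
Proof.
  intros H1 H2; apply Ccv_ext with (fun n => u n + (- (1)) * v n); [intros; ring|].
  replace (l - m) with (l + (- (1)) * m) by ring.
  apply Ccv_plus, Ccv_scal; auto.
Qed.

Lemma Ccv_inv (u : nat -> C) (l : C) :
  l <> 0 -> (forall n, u n <> 0) -> Ccv u l -> Ccv (fun n => / u n) (/ l).
Proof.
  intros Hl Hu H; apply Ccv_spec; intros eps He.
  assert (Pl : (0 < Cmod l)%R) by (apply Cmod_gt_0, Hl).
  set (e1 := Rmin (Cmod l / 2) (eps * (Cmod l * Cmod l / 2))).
  assert (Pe : (0 < e1)%R).
  { apply Rmin_pos; [lra|]; apply Rmult_lt_0_compat; auto.
    assert (0 < Cmod l * Cmod l)%R by (apply Rmult_lt_0_compat; auto); lra. }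
  destruct (proj1 (Ccv_spec _ _) H e1 Pe) as [N0 HN]; exists N0; intros n Hn.
  specialize (HN n Hn).
  assert (M1 : (e1 <= Cmod l / 2)%R) by apply Rmin_l.
  assert (M2 : (e1 <= eps * (Cmod l * Cmod l / 2))%R) by apply Rmin_r.
  assert (Pu : (Cmod l / 2 < Cmod (u n))%R).
  { generalize (Cmod_triangle_inv l (u n)); rewrite (Cmod_minus_comm l); lra. }
  replace (/ u n - / l) with (- ((u n - l) / (u n * l))) by (field; auto).
  rewrite Cmod_opp, Cmod_div, Cmod_mult by (apply Cmult_neq_0; auto).
  set (L := Cmod l) in *; set (U := Cmod (u n)) in *.
  assert (PUL : (0 < U * L)%R) by (apply Rmult_lt_0_compat; lra).
  apply Rmult_lt_reg_r with (U * L)%R; auto.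
  unfold Rdiv; rewrite Rmult_assoc, Rinv_l, Rmult_1_r by lra.
  assert (eps * (L * L / 2) <= eps * (U * L))%R by (apply Rmult_le_compat_l; nra).
  lra.
Qed.

Lemma Ccv_limit_le (u : nat -> C) (l : C) (v : nat -> R) (M : R) (N : nat) :
  (forall n, (N <= n)%nat -> (Cmod (u n) <= v n)%R) -> is_lim_seq v M ->
  Ccv u l -> (Cmod l <= M)%R.
Proof.
  intros H Hv Hu.
  assert (L : is_lim_seq (fun n => v n + Cmod (u n - l))%R M).
  { replace M with (M + 0)%R by ring; apply is_lim_seq_plus'; auto. }
  change (Rbar_le (Cmod l) M).
  apply is_lim_seq_le_loc with (u := fun _ => Cmod l) (2 := is_lim_seq_const _) (3 := L).
  exists N; intros n Hn; specialize (H n Hn).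
  generalize (Cmod_triangle_inv l (u n)); rewrite (Cmod_minus_comm l); lra.
Qed.

Lemma Ccv_unique (u : nat -> C) (l m : C) : Ccv u l -> Ccv u m -> l = m.
Proof.
  intros H1 H2; apply Ceq_minus, Cmod_eq_0, Rle_antisym; [|apply Cmod_ge_0].
  apply Ccv_limit_le with (u := fun n => u n - u n) (v := fun _ => 0%R) (N := O).
  - intros n _; replace (u n - u n) with (RtoC 0) by ring; rewrite Cmod_0; lra.
  - apply is_lim_seq_const.
  - apply Ccv_minus; auto.
Qed.

Lemma Ccv_incr (u : nat -> C) (l : C) (k : nat) :
  Ccv u l -> Ccv (fun n => u (n + k)%nat) l.
Proof. intros H; apply (is_lim_seq_incr_n (fun n => Cmod (u n - l)) k), H. Qed.

Lemma Ccv_decr (u : nat -> C) (l : C) (k : nat) :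
  Ccv (fun n => u (n + k)%nat) l -> Ccv u l.
Proof. intros H; apply (is_lim_seq_incr_n (fun n => Cmod (u n - l)) k), H. Qed.

Lemma Ccv_Re_Im (u : nat -> C) (l : C) :
  Ccv u l <-> is_lim_seq (fun n => Re (u n)) (Re l) /\ is_lim_seq (fun n => Im (u n)) (Im l).
Proof.
  assert (K : forall (f : nat -> R) (m : R),
    is_lim_seq f m <-> is_lim_seq (fun n => Rabs (f n - m))%R 0%R).
  { intros f m; rewrite <- !is_lim_seq_spec; split; intros H eps; destruct (H eps) as [N HN];
      exists N; intros n Hn; specialize (HN n Hn);
      rewrite Rminus_0_r, Rabs_Rabsolu in *; exact HN. }
  rewrite (K _ (Re l)), (K _ (Im l)).
  split; [intros H; split|intros [H1 H2]].
  - apply is_lim_seq_squeeze0 with (fun n => Cmod (u n - l)) O; auto.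
    intros n _; rewrite <- Re_minus; split; [apply Rabs_pos|apply re_le_Cmod].
  - apply is_lim_seq_squeeze0 with (fun n => Cmod (u n - l)) O; auto.
    intros n _; rewrite <- Im_minus; split; [apply Rabs_pos|apply Im_le_Cmod].
  - apply Ccv_le with (fun n => Rabs (Re (u n) - Re l) + Rabs (Im (u n) - Im l))%R O.
    + intros n _; rewrite <- Re_minus, <- Im_minus; apply Cmod_le_Re_Im.
    + apply is_lim_seq_plus0; auto.
Qed.

Lemma Csum_cv_abs (u : nat -> C) (v : nat -> R) :
  (forall n, (Cmod (u n) <= v n)%R) -> ex_series v -> exists l, Ccv (Csum u) l.
Proof.
  intros H Hv.
  assert (K1 : ex_series (fun n => Re (u n))).
  { apply (ex_series_le (K := R_AbsRing) (V := R_CompleteNormedModule)) with (b := v); auto.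
    intros n; eapply Rle_trans; [apply (re_le_Cmod (u n))|apply H]. }
  assert (K2 : ex_series (fun n => Im (u n))).
  { apply (ex_series_le (K := R_AbsRing) (V := R_CompleteNormedModule)) with (b := v); auto.
    intros n; eapply Rle_trans; [apply (Im_le_Cmod (u n))|apply H]. }
  destruct K1 as [l1 K1], K2 as [l2 K2].
  exists (l1, l2); apply Ccv_decr with 1%nat, Ccv_Re_Im; split; simpl.
  - apply is_lim_seq_ext with (2 := K1); intros n.
    rewrite Nat.add_1_r, <- sum_n_Csum.
    induction n as [|n IH]; [rewrite !sum_O; reflexivity|].
    rewrite !sum_Sn, IH; reflexivity.
  - apply is_lim_seq_ext with (2 := K2); intros n.
    rewrite Nat.add_1_r, <- sum_n_Csum.
    induction n as [|n IH]; [rewrite !sum_O; reflexivity|].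
    rewrite !sum_Sn, IH; reflexivity.
Qed.

Lemma is_series_Ccv (u : nat -> C) (l : C) : is_series u l <-> Ccv (Csum u) l.
Proof.
  split; intros H.
  - apply Ccv_decr with 1%nat, Ccv_spec; intros eps He.
    destruct (proj1 (filterlim_locally _ _) H (mkposreal (eps / 2) ltac:(lra)))
      as [N HN]; exists N; intros n Hn.
    specialize (HN n Hn); rewrite sum_n_Csum in HN.
    rewrite Nat.add_1_r.
    destruct HN as [H1 H2].
    change (Rabs (Re (Csum u (S n)) - Re l) < eps / 2)%R in H1.
    change (Rabs (Im (Csum u (S n)) - Im l) < eps / 2)%R in H2.
    rewrite <- Re_minus in H1; rewrite <- Im_minus in H2.
    eapply Rle_lt_trans; [apply Cmod_le_Re_Im|lra].
  - apply Ccv_incr with (k := 1%nat) in H.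
    apply filterlim_locally; intros eps.
    apply Ccv_spec with (eps := eps) in H; [|apply cond_pos].
    destruct H as [N HN]; exists N; intros n Hn; specialize (HN n Hn).
    rewrite Nat.add_1_r, <- sum_n_Csum in HN.
    apply C_NormedModule_mixin_compat1; exact HN.
Qed.

Lemma CSeries_unique (u : nat -> C) (l : C) : Ccv (Csum u) l -> CSeries u = l.
Proof.
  intros H; apply Ccv_incr with (k := 1%nat), Ccv_Re_Im in H; destruct H as [H1 H2].
  assert (E : forall n, Re (Csum u (n + 1)%nat) = sum_n (fun n => Re (u n)) n /\
     Im (Csum u (n + 1)%nat) = sum_n (fun n => Im (u n)) n).
  { intros n; rewrite Nat.add_1_r, <- sum_n_Csum.
    induction n as [|n [IH1 IH2]]; [rewrite !sum_O; split; reflexivity|].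
    rewrite !sum_Sn, <- IH1, <- IH2; split; reflexivity. }
  unfold CSeries; apply C_ext; simpl; apply is_series_unique.
  - apply is_lim_seq_ext with (2 := H1); intros n; apply E.
  - apply is_lim_seq_ext with (2 := H2); intros n; apply E.
Qed.

Lemma pow_n_Cpow (z : C) (n : nat) : pow_n z n = z ^ n.
Proof. induction n as [|n IH]; [reflexivity|]; simpl; rewrite IH; reflexivity. Qed.

Lemma scal_pow_n (s w : C) (k : nat) : scal (pow_n w k) s = s * w ^ k.
Proof.
  change (pow_n w k * s = s * w ^ k); rewrite pow_n_Cpow; ring.
Qed.

Lemma is_pseries_Ccv (s : nat -> C) (w l : C) :
  is_pseries s w l <-> Ccv (Csum (fun k => s k * w ^ k)) l.
Proof.
  unfold is_pseries; rewrite is_series_Ccv.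
  split; apply Ccv_ext; intros n; apply Csum_ext; intros k _;
    [|symmetry]; apply scal_pow_n.
Qed.

Lemma ratio_lim0 (e : nat -> R) (r : R) (N : nat) :
  (0 <= r < 1)%R -> (forall n, (0 <= e n)%R) ->
  (forall n, (N <= n)%nat -> (e (S n) <= r * e n)%R) -> is_lim_seq e 0%R.
Proof.
  intros Hr He H.
  apply is_lim_seq_incr_n with (N := N).
  assert (K : forall k, (e (k + N)%nat <= e N * r ^ k)%R).
  { induction k as [|k IH]; [simpl; lra|].
    simpl; eapply Rle_trans; [apply H; lia|].
    assert (r * e (k + N)%nat <= r * (e N * r ^ k))%R by (apply Rmult_le_compat_l; lra).
    lra. }
  apply is_lim_seq_squeeze0 with (fun k => e N * r ^ k)%R O.
  - intros k _; split; auto.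
  - apply is_lim_seq_scal0, is_lim_seq_geom; rewrite Rabs_pos_eq; lra.
Qed.

Lemma is_lim_seq_inv_INR : is_lim_seq (fun n => / INR n)%R 0%R.
Proof.
  replace (Finite 0%R) with (Rbar_inv p_infty) by reflexivity.
  apply is_lim_seq_inv; [apply is_lim_seq_INR|discriminate].
Qed.

Lemma pow_fact_lim0 (x : R) : is_lim_seq (fun n => x ^ S n / INR (fact n))%R 0%R.
Proof.
  apply is_lim_seq_ext with (fun n => x * (x ^ n / INR (fact n)))%R.
  - intros n; simpl; field; apply INR_fact_neq_0.
  - apply is_lim_seq_scal0, is_lim_seq_Reals, cv_speed_pow_fact.
Qed.

(** * Pochhammer symbols *)

Lemma poch_S_l (z : C) (n : nat) : poch z (S n) = z * poch (z + 1) n.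
Proof.
  induction n as [|n IH].
  - simpl; ring.
  - change (poch z (S (S n))) with (poch z (S n) * (z + INR (S n))).
    rewrite IH, RtoC_INR_S; simpl; ring.
Qed.

Lemma poch_shift (z : C) (n : nat) : poch (z + 1) n * z = poch z n * (z + INR n).
Proof. rewrite Cmult_comm, <- poch_S_l; reflexivity. Qed.

Lemma poch_add (z : C) (n m : nat) : poch z (n + m) = poch z n * poch (z + INR n) m.
Proof.
  induction m as [|m IH].
  - rewrite Nat.add_0_r; simpl; ring.
  - rewrite Nat.add_succ_r; simpl; rewrite IH, RtoC_INR_plus; ring.
Qed.

Lemma not_nonpos_int_plus (z : C) (n : nat) : ~ nonpos_int z -> z + INR n <> 0.
Proof.
  intros H E; apply H; exists n.
  rewrite RtoC_opp; replace z with (z + INR n - INR n) by ring; rewrite E; ring.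
Qed.

Lemma not_nonpos_int_neq0 (z : C) : ~ nonpos_int z -> z <> 0.
Proof. intros H; generalize (not_nonpos_int_plus z 0 H); simpl; rewrite Cplus_0_r; auto. Qed.

Lemma not_nonpos_int_add (z : C) (n : nat) : ~ nonpos_int z -> ~ nonpos_int (z + INR n).
Proof.
  intros H [k E]; apply H; exists (k + n)%nat.
  rewrite RtoC_opp in *; rewrite RtoC_INR_plus.
  replace z with (z + INR n - INR n) by ring; rewrite E; ring.
Qed.

Lemma not_nonpos_int_S (z : C) : ~ nonpos_int z -> ~ nonpos_int (z + 1).
Proof. apply (not_nonpos_int_add z 1). Qed.

Lemma Re_pos_not_nonpos_int (z : C) : (0 < Re z)%R -> ~ nonpos_int z.
Proof. intros H [k E]; rewrite E, re_RtoC in H; generalize (pos_INR k); lra. Qed.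

Lemma poch_neq0 (z : C) (n : nat) : ~ nonpos_int z -> poch z n <> 0.
Proof.
  intros H; induction n as [|n IH]; simpl; [apply C1_nz|].
  apply Cmult_neq_0; auto; apply not_nonpos_int_plus; auto.
Qed.

(** * The exponential series and the binomial series *)

Lemma Cmod_Cexp_le (z : C) : (Cmod (Cexp z) <= exp (Cmod z))%R.
Proof.
  rewrite Cmod_Cexp.
  destruct (Req_dec (Re z) (Cmod z)) as [E|E]; [rewrite E; lra|].
  left; apply exp_increasing.
  assert (H := re_le_Cmod z); apply Rabs_le_between in H; lra.
Qed.

Lemma exp_le (x y : R) : (x <= y)%R -> (exp x <= exp y)%R.
Proof. intros [H|H]; [left; apply exp_increasing, H|rewrite H; lra]. Qed.

(** With S_N the partial sum, the derivative in l of e^(-lz) S_N(lz) telescopes to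
    -e^(-lz) z^(N+1) l^N/N!.  The bound depends on |z| only, which is what allows
    integration term by term. *)
Lemma Cexp_series_bound (z : C) (N : nat) :
  (Cmod (Csum (fun k => z ^ k / INR (fact k))%C (S N) - Cexp z)
   <= 2 * exp (2 * Cmod z) * (Cmod z ^ S N / INR (fact N)))%R.
Proof.
  set (f := fun l : R => Cexp (l * - z) * Csum (fun k => (l * z) ^ k / INR (fact k)) (S N)).
  set (df := fun l : R => - (Cexp (l * - z) * (z ^ S N * l ^ N / INR (fact N)))).
  assert (Dz : forall (l : R), Cderiv (fun u => u * z) l z).
  { intros l; apply Cderiv_ext with (fun u => 0 + u * z); [intros; ring|apply Cderiv_line]. }
  assert (De : forall (l : R), Cderiv (fun u => Cexp (u * - z)) l (- z * Cexp (l * - z))).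
  { intros l; apply (Cderiv_Cexp (fun u => u * - z)).
    apply Cderiv_ext with (fun u => 0 + u * - z); [intros; ring|apply Cderiv_line]. }
  assert (D : forall l, Cderiv f l (df l)).
  { intros l; unfold f, df; clear f df; induction N as [|N IH].
    - eapply Cderiv_eq; [|apply Cderiv_ext with (fun u => Cexp (u * - z)); [|apply De]].
      + simpl; field.
      + intros u; simpl; field.
    - eapply Cderiv_eq; [|apply Cderiv_ext with (fun u =>
         Cexp (u * - z) * Csum (fun k => (u * z) ^ k / INR (fact k)) (S N) +
         Cexp (u * - z) * (/ INR (fact (S N)) * (u * z) ^ S N));
        [|apply Cderiv_plus; [apply IH|apply Cderiv_mult;
           [apply De|apply Cderiv_scal, Cderiv_pow, Dz]]]].
      + cbv beta; rewrite !Cpow_mult_l, !Cpow_S, RtoC_fact_S.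
        field; split; [apply INR_fact_neq0|apply INR_S_neq0].
      + intros u; rewrite (Csum_S _ (S N)); unfold Cdiv; ring. }
  assert (B : forall l : R, (0 <= l <= 1)%R ->
    (Cmod (df l) <= exp (Cmod z) * (Cmod z ^ S N / INR (fact N)))%R).
  { intros l Hl; unfold df.
    rewrite Cmod_opp, Cmod_mult, Cmod_div, Cmod_mult, !Cmod_pow, Cmod_INR, Cmod_R
      by apply INR_fact_neq0.
    rewrite (Rabs_pos_eq l) by lra.
    apply Rmult_le_compat; try apply Cmod_ge_0.
    - apply Rmult_le_pos; [apply Rmult_le_pos; apply pow_le; [apply Cmod_ge_0|lra]|].
      left; apply Rinv_0_lt_compat, INR_fact_lt_0.
    - eapply Rle_trans; [apply Cmod_Cexp_le|apply exp_le].
      rewrite Cmod_mult, Cmod_opp, Cmod_R, Rabs_pos_eq by lra.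
      generalize (Cmod_ge_0 z); nra.
    - unfold Rdiv; apply Rmult_le_compat_r; [left; apply Rinv_0_lt_compat, INR_fact_lt_0|].
      assert (l ^ N <= 1)%R by (rewrite <- (pow1 N); apply pow_incr; lra).
      assert (0 <= Cmod z ^ S N)%R by (apply pow_le, Cmod_ge_0).
      nra. }
  assert (Q := Cderiv_bound_const f df _ 0 1 ltac:(lra) (fun t _ => D t) B).
  assert (E0 : f 0%R = 1).
  { unfold f; rewrite Csum_S_l.
    rewrite (Csum_zero (fun k => _)).
    - replace (0 * - z) with (RtoC 0) by ring; rewrite Cexp_0; simpl; field.
    - intros k _; rewrite Cpow_S; field; apply INR_fact_neq0. }
  assert (E1 : f 1%R = / Cexp z * Csum (fun k => z ^ k / INR (fact k)) (S N)).
  { unfold f; rewrite <- Cexp_opp; f_equal; [f_equal; ring|].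
    apply Csum_ext; intros k _; do 2 f_equal; ring. }
  rewrite E0, E1 in Q.
  set (S0 := Csum _ (S N)) in *.
  replace (S0 - Cexp z) with (Cexp z * (/ Cexp z * S0 - 1)) by (field; apply Cexp_neq0).
  rewrite Cmod_mult.
  assert (P := Cmod_Cexp_le z).
  replace (2 * Cmod z)%R with (Cmod z + Cmod z)%R by ring; rewrite exp_plus.
  assert (H1 := Cmod_ge_0 (Cexp z)); assert (H2 := Cmod_ge_0 (/ Cexp z * S0 - 1)).
  eapply Rle_trans; [apply Rmult_le_compat; [exact H1|exact H2|exact P|exact Q]|].
  right; ring.
Qed.

Lemma Cexp_series (z : C) : Ccv (Csum (fun k => z ^ k / INR (fact k))) (Cexp z).
Proof.
  apply Ccv_decr with 1%nat.
  eapply Ccv_le with (N := O); [intros n _; rewrite Nat.add_1_r; apply Cexp_series_bound|].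
  apply is_lim_seq_scal0, pow_fact_lim0.
Qed.

Definition binc (b : C) (k : nat) : C := poch b k / INR (fact k).

Lemma binc_0 (b : C) : binc b 0 = 1.
Proof. unfold binc; simpl; field. Qed.

(** Size of the single term left after telescoping for the binomial series. *)
Definition bin_err (b : C) (r : R) (N : nat) : R :=
  (Cmod (poch b (S N)) / INR (fact N) * r ^ S N)%R.

Lemma bin_err_pos (b : C) (r : R) (N : nat) : (0 <= r)%R -> (0 <= bin_err b r N)%R.
Proof.
  intros H; unfold bin_err; apply Rmult_le_pos; [|apply pow_le, H].
  apply Rmult_le_pos; [apply Cmod_ge_0|left; apply Rinv_0_lt_compat, INR_fact_lt_0].
Qed.

Lemma bin_err_le (b : C) (r r' : R) (N : nat) :
  (0 <= r <= r')%R -> (bin_err b r N <= bin_err b r' N)%R.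
Proof.
  intros H; unfold bin_err; apply Rmult_le_compat_l; [|apply pow_incr; lra].
  apply Rmult_le_pos; [apply Cmod_ge_0|left; apply Rinv_0_lt_compat, INR_fact_lt_0].
Qed.

(** Consecutive terms have ratio at most r(1+|b|/N), eventually below (1+r)/2. *)
Lemma bin_err_lim (b : C) (r : R) : (0 <= r < 1)%R -> is_lim_seq (bin_err b r) 0%R.
Proof.
  intros Hr.
  destruct (nfloor_ex (2 * (Cmod b + 1) / (1 - r))) as [N HN].
  { apply Rmult_le_pos; [generalize (Cmod_ge_0 b); lra|left; apply Rinv_0_lt_compat; lra]. }
  apply ratio_lim0 with (r := ((1 + r) / 2)%R) (N := S N); [lra|intros; apply bin_err_pos; lra|].
  intros n Hn.
  assert (E : (bin_err b r (S n) <= (Cmod b + INR (S n)) / INR (S n) * r * bin_err b r n)%R).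
  { unfold bin_err.
    change (poch b (S (S n))) with (poch b (S n) * (b + INR (S n))).
    rewrite Cmod_mult, fact_simpl, mult_INR.
    assert (T : (Cmod (b + INR (S n)) <= Cmod b + INR (S n))%R).
    { eapply Rle_trans; [apply Cmod_triangle|]; rewrite Cmod_INR; lra. }
    assert (P1 := INR_fact_lt_0 n).
    assert (P2 : (0 < INR (S n))%R) by (apply lt_0_INR; lia).
    replace ((Cmod b + INR (S n)) / INR (S n) * r *
      (Cmod (poch b (S n)) / INR (fact n) * r ^ S n))%R
      with (Cmod (poch b (S n)) * (Cmod b + INR (S n)) / (INR (S n) * INR (fact n)) * r ^ S (S n))%R
      by (change (r ^ S (S n))%R with (r * r ^ S n)%R; field; split; lra).
    apply Rmult_le_compat_r; [apply pow_le; lra|].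
    apply Rmult_le_compat_r; [left; apply Rinv_0_lt_compat, Rmult_lt_0_compat; auto|].
    apply Rmult_le_compat_l; auto; apply Cmod_ge_0. }
  eapply Rle_trans; [exact E|].
  apply Rmult_le_compat_r; [apply bin_err_pos; lra|].
  assert (H1 : (INR (S N) <= INR (S n))%R) by (apply le_INR; lia).
  rewrite (S_INR N) in H1.
  assert (H2 : (2 * (Cmod b + 1) / (1 - r) < INR (S n))%R) by lra.
  apply (Rmult_lt_compat_r (1 - r)) in H2; [|lra].
  unfold Rdiv in H2; rewrite Rmult_assoc, Rinv_l, Rmult_1_r in H2 by lra.
  assert (P := Cmod_ge_0 b).
  assert (P2 : (0 < INR (S n))%R) by (apply lt_0_INR; lia).
  apply Rmult_le_reg_r with (INR (S n)); auto.
  replace ((Cmod b + INR (S n)) / INR (S n) * r * INR (S n))%R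
    with ((Cmod b + INR (S n)) * r)%R by (field; lra).
  nra.
Qed.

Lemma ln_le_bound (m M r : R) :
  (0 < m)%R -> (m <= r <= M)%R -> (Rabs (ln r) <= Rabs (ln m) + Rabs (ln M))%R.
Proof.
  intros Hm [H1 H2].
  assert (ln m <= ln r)%R by (destruct H1 as [H1|H1]; [left; apply ln_increasing; lra|rewrite H1; lra]).
  assert (ln r <= ln M)%R by (destruct H2 as [H2|H2]; [left; apply ln_increasing; lra|rewrite H2; lra]).
  assert (Q1 := Rabs_pos (ln m)); assert (Q2 := Rabs_pos (ln M)).
  assert (Q3 := Rle_abs (ln M)); assert (Q4 := Rle_abs (- ln m)); rewrite Rabs_Ropp in Q4.
  apply Rabs_le; lra.
Qed.

Lemma Cmod_Cpowc_le (z w : C) (m M : R) :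
  (0 < m)%R -> (m <= Cmod z <= M)%R ->
  (Cmod (Cpowc z w) <= exp (Cmod w * (Rabs (ln m) + Rabs (ln M) + PI)))%R.
Proof.
  intros Hm H; unfold Cpowc.
  eapply Rle_trans; [apply Cmod_Cexp_le|apply exp_le].
  rewrite Cmod_mult; apply Rmult_le_compat_l; [apply Cmod_ge_0|].
  eapply Rle_trans; [apply Cmod_le_Re_Im|]; unfold Cln; simpl.
  generalize (ln_le_bound m M _ Hm H) (Carg_bound z); lra.
Qed.

(** Binomial expansion of (p+d)^(-b) along the segment from p to p+d.  The
    ratio d/p may be large here: only the segment has to stay away from the
    cut.  This gives at once the principal-branch power series (when d/p is
    small) and Taylor's formula with remainder (when N is fixed). *)
Lemma binomial_bound (b : C) (m M : R) :
  (0 < m)%R ->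
  exists K : R, (0 <= K)%R /\ forall (p d : C) (N : nat),
    (forall l : R, (0 <= l <= 1)%R ->
       cut_plane (p + l * d) /\ (m <= Cmod (p + l * d) <= M)%R) ->
    (Cmod (Cpowc (p + d) (- b) -
       Cpowc p (- b) * Csum (fun k => binc b k * (- d / p) ^ k)%C (S N))
     <= K * bin_err b (Cmod (d / p)) N)%R.
Proof.
  intros Hm.
  set (E := exp (Cmod b * (Rabs (ln m) + Rabs (ln M) + PI))).
  assert (HE : (0 < E)%R) by apply exp_pos.
  exists (2 * (E * (Rabs M / m)) * (E * E))%R; split.
  { assert (0 <= Rabs M / m)%R by
      (apply Rmult_le_pos; [apply Rabs_pos|left; apply Rinv_0_lt_compat; auto]).
    apply Rmult_le_pos; [|apply Rmult_le_pos; lra]; apply Rmult_le_pos; [lra|apply Rmult_le_pos; lra]. }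
  intros p d N H.
  assert (Hp : p <> 0).
  { destruct (H 0%R ltac:(lra)) as [H0 _].
    replace (p + 0 * d) with p in H0 by ring; apply cut_plane_neq0, H0. }
  assert (HpM : (m <= Cmod p <= M)%R).
  { destruct (H 0%R ltac:(lra)) as [_ H0].
    replace (p + 0 * d) with p in H0 by ring; exact H0. }
  assert (HdM : (m <= Cmod (p + d) <= M)%R).
  { destruct (H 1%R ltac:(lra)) as [_ H0].
    replace (p + 1 * d) with (p + d) in H0 by ring; exact H0. }
  set (q := - d / p).
  assert (Eq : d = - (q * p)) by (unfold q; field; auto).
  set (f := fun l : R => Cpowc (p + l * d) b * Csum (fun k => binc b k * (l * q) ^ k) (S N)).
  set (df := fun l : R => - (poch b (S N) / INR (fact N) * q ^ S N * l ^ N *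
     (p / (p + l * d)) * Cpowc (p + l * d) b)).
  assert (Dq : forall (l : R), Cderiv (fun u => u * q) l q).
  { intros l; apply Cderiv_ext with (fun u => 0 + u * q); [intros; ring|apply Cderiv_line]. }
  assert (D : forall l, (0 <= l <= 1)%R -> Cderiv f l (df l)).
  { intros l Hl; destruct (H l Hl) as [Hc _].
    assert (Hn := cut_plane_neq0 _ Hc).
    unfold f, df; clear f df; induction N as [|N IH].
    - eapply Cderiv_eq; [|apply Cderiv_ext with (fun u => Cpowc (p + u * d) b);
        [|apply Cderiv_Cpowc, Hc]].
      + simpl; rewrite Eq; rewrite Eq in Hn; field; auto.
      + intros u; simpl; rewrite binc_0; ring.
    - eapply Cderiv_eq; [|apply Cderiv_ext with (fun u =>
         Cpowc (p + u * d) b * Csum (fun k => binc b k * (u * q) ^ k) (S N) +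
         Cpowc (p + u * d) b * (binc b (S N) * (u * q) ^ S N));
        [|apply Cderiv_plus; [apply IH|apply Cderiv_mult;
           [apply Cderiv_Cpowc, Hc|apply Cderiv_scal, Cderiv_pow, Dq]]]].
      + cbv beta; unfold binc; rewrite !Cpow_mult_l, !Cpow_S, RtoC_fact_S.
        change (poch b (S (S N))) with (poch b (S N) * (b + INR (S N))).
        rewrite Eq; rewrite Eq in Hn.
        field; repeat split; auto; [apply INR_fact_neq0|apply INR_S_neq0].
      + intros u; rewrite (Csum_S _ (S N)); ring. }
  assert (Eqm : Cmod q = Cmod (d / p)).
  { unfold q; rewrite <- (Cmod_opp (d / p)); f_equal; field; auto. }
  set (r := Cmod (d / p)) in *.
  assert (B : forall l : R, (0 <= l <= 1)%R ->
    (Cmod (df l) <= E * (Rabs M / m) * bin_err b r N)%R).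
  { intros l Hl; destruct (H l Hl) as [Hc Hb]; unfold df.
    assert (Hn := cut_plane_neq0 _ Hc).
    rewrite Cmod_opp, !Cmod_mult, !Cmod_div, !Cmod_pow, Cmod_INR, Cmod_R, Eqm
      by (auto; apply INR_fact_neq0).
    rewrite (Rabs_pos_eq l) by lra.
    assert (Q1 := Cmod_Cpowc_le (p + l * d) b m M Hm Hb); fold E in Q1.
    assert (Q2 : (l ^ N <= 1)%R) by (rewrite <- (pow1 N); apply pow_incr; lra).
    assert (Q2' : (0 <= l ^ N)%R) by (apply pow_le; lra).
    assert (Q3 : (Cmod p / Cmod (p + l * d) <= Rabs M / m)%R).
    { apply Rmult_le_compat.
      - apply Cmod_ge_0.
      - left; apply Rinv_0_lt_compat; lra.
      - generalize (Rle_abs M); lra.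
      - apply Rinv_le_contravar; lra. }
    assert (Q3' : (0 <= Cmod p / Cmod (p + l * d))%R).
    { apply Rmult_le_pos; [apply Cmod_ge_0|left; apply Rinv_0_lt_compat; lra]. }
    assert (Q4 := Cmod_ge_0 (Cpowc (p + l * d) b)).
    assert (Q5 : (0 <= bin_err b r N)%R) by (apply bin_err_pos, Cmod_ge_0).
    fold (bin_err b r N).
    set (e := bin_err b r N) in *.
    replace (E * (Rabs M / m) * e)%R with (e * 1 * (Rabs M / m) * E)%R by ring.
    apply Rmult_le_compat; [|exact Q4| |exact Q1].
    { apply Rmult_le_pos; [apply Rmult_le_pos; [exact Q5|exact Q2']|exact Q3']. }
    apply Rmult_le_compat; [|exact Q3'| |exact Q3].
    { apply Rmult_le_pos; [exact Q5|exact Q2']. }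
    apply Rmult_le_compat_l; [exact Q5|exact Q2]. }
  assert (Q := Cderiv_bound_const f df _ 0 1 ltac:(lra) D B).
  set (S0 := Csum (fun k => binc b k * q ^ k) (S N)).
  assert (E0 : f 0%R = Cpowc p b).
  { unfold f; rewrite Csum_S_l.
    rewrite (Csum_zero (fun k => _)).
    - replace (p + 0 * d) with p by ring; simpl; rewrite binc_0; ring.
    - intros k _; rewrite Cpow_S; ring. }
  assert (E1 : f 1%R = Cpowc (p + d) b * S0).
  { unfold f, S0; replace (p + 1 * d) with (p + d) by ring; f_equal.
    apply Csum_ext; intros k _; do 2 f_equal; ring. }
  rewrite E0, E1 in Q.
  assert (N1 := Cpowc_neq0 p b); assert (N2 := Cpowc_neq0 (p + d) b).
  replace (Cpowc (p + d) (- b) - Cpowc p (- b) * S0)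
    with (- (Cpowc (p + d) (- b) * Cpowc p (- b) * (Cpowc (p + d) b * S0 - Cpowc p b)))
    by (rewrite !Cpowc_opp; field; auto).
  rewrite Cmod_opp, !Cmod_mult.
  assert (T1 := Cmod_Cpowc_le (p + d) (- b) m M Hm HdM).
  assert (T2 := Cmod_Cpowc_le p (- b) m M Hm HpM).
  rewrite Cmod_opp in T1, T2; fold E in T1, T2.
  assert (P1 := Cmod_ge_0 (Cpowc (p + d) (- b))); assert (P2 := Cmod_ge_0 (Cpowc p (- b))).
  assert (P3 := Cmod_ge_0 (Cpowc (p + d) b * S0 - Cpowc p b)).
  eapply Rle_trans.
  - apply Rmult_le_compat; [apply Rmult_le_pos; auto|auto|
      apply Rmult_le_compat; eauto|exact Q].
  - right; ring.
Qed.

(** * Complex powers of real numbers *)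

(** Extending by 0 makes t^w continuously differentiable on the whole line when
    the real part of w is large, so that no improper integral is ever met. *)
Definition tpow (w : C) (t : R) : C :=
  if Rle_dec t 0 then 0 else Cexp (w * ln t).

Lemma tpow_pos (w : C) (t : R) : (0 < t)%R -> tpow w t = Cexp (w * ln t).
Proof. intros H; unfold tpow; destruct Rle_dec; auto; lra. Qed.

Lemma tpow_npos (w : C) (t : R) : (t <= 0)%R -> tpow w t = 0.
Proof. intros H; unfold tpow; destruct Rle_dec; auto; lra. Qed.

Lemma tpow_Cpowc (w : C) (t : R) : (0 < t)%R -> tpow w t = Cpowc t w.
Proof. intros H; rewrite tpow_pos by auto; unfold Cpowc; rewrite Cln_RtoC_pos; auto. Qed.

Lemma tpow_1 (w : C) : tpow w 1 = 1.
Proof. rewrite tpow_Cpowc by lra; apply Cpowc_base1. Qed.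

Lemma tpow_S (w : C) (t : R) : tpow (w + 1) t = t * tpow w t.
Proof.
  destruct (Rle_dec t 0) as [h|h].
  - rewrite !tpow_npos by auto; ring.
  - rewrite !tpow_Cpowc, Cpowc_plus, Cpowc_1 by (try apply RtoC_neq0; lra); ring.
Qed.

Lemma tpow_add (w : C) (n : nat) (t : R) : tpow (w + INR n) t = t ^ n * tpow w t.
Proof.
  induction n as [|n IH].
  - simpl; rewrite Cplus_0_r; ring.
  - rewrite RtoC_INR_S, Cplus_assoc, tpow_S, IH; simpl; ring.
Qed.

Lemma Cmod_tpow (w : C) (t : R) : (0 < t)%R -> Cmod (tpow w t) = exp (Re w * ln t).
Proof. intros H; rewrite tpow_pos, Cmod_Cexp, re_scal_r by auto; reflexivity. Qed.

Lemma Cmod_tpow_le (w : C) (m : nat) (t : R) :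
  (INR m <= Re w)%R -> (0 <= t <= 1)%R -> (Cmod (tpow w t) <= t ^ m)%R.
Proof.
  intros Hw [H1 H2]; destruct H1 as [H1|H1].
  - rewrite Cmod_tpow by auto.
    rewrite <- (exp_ln (t ^ m)), ln_pow by (auto; apply pow_lt; auto).
    apply exp_le.
    assert (ln t <= 0)%R.
    { rewrite <- ln_1; destruct H2 as [H2|H2]; [left; apply ln_increasing; auto|rewrite H2; lra]. }
    nra.
  - rewrite tpow_npos by lra; rewrite Cmod_0; apply pow_le; lra.
Qed.

Lemma Cderiv_locally (f g : R -> C) (t : R) (l : C) :
  locally t (fun u => f u = g u) -> Cderiv f t l -> Cderiv g t l.
Proof.
  intros H [H1 H2]; split.
  - apply is_derive_ext_loc with (2 := H1).
    destruct H as [e H]; exists e; intros u Hu; rewrite H; auto.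
  - apply is_derive_ext_loc with (2 := H2).
    destruct H as [e H]; exists e; intros u Hu; rewrite H; auto.
Qed.

Lemma is_derive_quadratic0 (f : R -> R) :
  (forall h : R, (Rabs h <= 1)%R -> (Rabs (f h) <= Rabs h * Rabs h)%R) -> is_derive f 0 0.
Proof.
  intros H; apply is_derive_Reals.
  assert (F0 : f 0%R = 0%R).
  { assert (Q := H 0%R); rewrite Rabs_R0 in Q; specialize (Q ltac:(lra)).
    apply Rabs_eq_0; generalize (Rabs_pos (f 0)); lra. }
  intros eps He.
  assert (Hd : (0 < Rmin eps 1)%R) by (apply Rmin_pos; lra).
  exists (mkposreal _ Hd); intros h Hh Hl; simpl in Hl.
  rewrite Rplus_0_l, F0, !Rminus_0_r.
  assert (M1 := Rmin_l eps 1); assert (M2 := Rmin_r eps 1).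
  assert (P := Rabs_pos_lt h Hh).
  unfold Rdiv; rewrite Rabs_mult, Rabs_inv.
  specialize (H h ltac:(lra)).
  apply Rmult_lt_reg_r with (Rabs h); auto.
  rewrite Rmult_assoc, Rinv_l by lra; nra.
Qed.

Lemma Cderiv_tpow (w : C) (t : R) :
  (2 <= Re w)%R -> Cderiv (tpow w) t (w * tpow (w - 1) t).
Proof.
  intros Hw; destruct (Rtotal_order t 0) as [h|[h|h]].
  - rewrite tpow_npos by lra.
    apply Cderiv_locally with (fun _ => RtoC 0).
    + exists (mkposreal (- t) ltac:(lra)); intros u Hu.
      change (Rabs (u - t) < - t)%R in Hu; apply Rabs_lt_between in Hu.
      rewrite tpow_npos; auto; lra.
    + eapply Cderiv_eq; [|apply Cderiv_const]; ring.
  - rewrite h, tpow_npos by lra.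
    assert (B : forall u : R, (Rabs u <= 1)%R -> (Cmod (tpow w u) <= Rabs u * Rabs u)%R).
    { intros u Hu; destruct (Rle_dec u 0) as [h1|h1].
      - rewrite tpow_npos, Cmod_0 by auto; generalize (Rabs_pos u); nra.
      - rewrite Rabs_pos_eq in * by lra.
        eapply Rle_trans; [apply (Cmod_tpow_le w 2); simpl; lra|simpl; lra]. }
    split; rewrite Cmult_0_r; apply is_derive_quadratic0; intros u Hu.
    + eapply Rle_trans; [apply re_le_Cmod|auto].
    + eapply Rle_trans; [apply Im_le_Cmod|auto].
  - apply Cderiv_locally with (fun u => Cexp (w * ln u)).
    + exists (mkposreal t h); intros u Hu.
      change (Rabs (u - t) < t)%R in Hu; apply Rabs_lt_between in Hu.
      rewrite tpow_pos; auto; lra.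
    + eapply Cderiv_eq; [|apply Cderiv_Cexp, Cderiv_scal, Cderiv_RtoC;
        apply is_derive_Reals, derivable_pt_lim_ln, h].
      rewrite tpow_Cpowc by auto; unfold Cminus; rewrite Cpowc_plus, Cpowc_opp, Cpowc_1
        by (apply RtoC_neq0; lra).
      unfold Cpowc; rewrite Cln_RtoC_pos by auto.
      rewrite RtoC_inv by lra; cbv beta; ring.
Qed.

Lemma Ccont_tpow (w : C) (t : R) : (1 <= Re w)%R -> Ccont (tpow w) t.
Proof.
  intros Hw; destruct (Rtotal_order t 0) as [h|[h|h]].
  - eapply Cderiv_Ccont, Cderiv_locally with (fun _ => RtoC 0); [|apply Cderiv_const].
    exists (mkposreal (- t) ltac:(lra)); intros u Hu.
    change (Rabs (u - t) < - t)%R in Hu; apply Rabs_lt_between in Hu.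
    rewrite tpow_npos; auto; lra.
  - rewrite h.
    assert (B : forall u : R, (Rabs u <= 1)%R -> (Cmod (tpow w u) <= Rabs u)%R).
    { intros u Hu; destruct (Rle_dec u 0) as [h1|h1].
      - rewrite tpow_npos, Cmod_0 by auto; apply Rabs_pos.
      - rewrite Rabs_pos_eq in * by lra.
        eapply Rle_trans; [apply (Cmod_tpow_le w 1); simpl; lra|simpl; lra]. }
    assert (K : forall f : R -> R, f 0%R = 0%R ->
      (forall u : R, (Rabs u <= 1)%R -> (Rabs (f u) <= Rabs u)%R) -> continuous f 0).
    { intros f F0 Hf; apply continuity_pt_filterlim; intros eps He.
      exists (Rmin eps 1); split; [apply Rmin_pos; lra|].
      intros u [_ Hu]; simpl in *; unfold R_dist in *.
      rewrite F0, !Rminus_0_r in *.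
      assert (M1 := Rmin_l eps 1); assert (M2 := Rmin_r eps 1).
      specialize (Hf u ltac:(lra)); lra. }
    split; apply K.
    + rewrite tpow_npos; simpl; lra.
    + intros u Hu; eapply Rle_trans; [apply re_le_Cmod|auto].
    + rewrite tpow_npos; simpl; lra.
    + intros u Hu; eapply Rle_trans; [apply Im_le_Cmod|auto].
  - eapply Cderiv_Ccont, Cderiv_locally with (fun u => Cexp (w * ln u)).
    + exists (mkposreal t h); intros u Hu.
      change (Rabs (u - t) < t)%R in Hu; apply Rabs_lt_between in Hu.
      rewrite tpow_pos; auto; lra.
    + apply Cderiv_Cexp, Cderiv_scal, Cderiv_RtoC; apply is_derive_Reals, derivable_pt_lim_ln, h.
Qed.

Lemma Cderiv_reflect (f : R -> C) (t : R) (l : C) :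
  Cderiv f (1 - t) l -> Cderiv (fun u => f (1 - u)%R) t (- l).
Proof.
  assert (D : is_derive (fun u => 1 - u)%R t (-1)%R) by (auto_derive; auto; ring).
  intros [H1 H2]; split.
  - evar_last; [apply (is_derive_comp (fun u => Re (f u)) (fun u => 1 - u)%R); eassumption|].
    rewrite re_opp; unfold scal; simpl; unfold mult; simpl; ring.
  - evar_last; [apply (is_derive_comp (fun u => Im (f u)) (fun u => 1 - u)%R); eassumption|].
    rewrite im_opp; unfold scal; simpl; unfold mult; simpl; ring.
Qed.

Lemma Ccont_reflect (f : R -> C) (t : R) :
  Ccont f (1 - t) -> Ccont (fun u => f (1 - u)%R) t.
Proof.
  assert (D : continuous (fun u => 1 - u)%R t).
  { apply (@ex_derive_continuous R_AbsRing R_NormedModule); auto_derive; auto. }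
  intros [H1 H2]; split.
  - apply (continuous_comp (fun u => 1 - u)%R (fun u => Re (f u))); auto.
  - apply (continuous_comp (fun u => 1 - u)%R (fun u => Im (f u))); auto.
Qed.

Lemma Ccont_RtoC_pow (n : nat) (t : R) : Ccont (fun u => RtoC u ^ n) t.
Proof. apply Ccont_pow; eapply Cderiv_Ccont, Cderiv_id. Qed.

Lemma Ccont_tpow_reflect (w : C) (t : R) :
  (1 <= Re w)%R -> Ccont (fun u => tpow w (1 - u)) t.
Proof. intros H; apply Ccont_reflect, Ccont_tpow, H. Qed.

(** * Euler's limit for the Gamma function *)

Definition gam_u (z : C) (n : nat) : C :=
  INR (fact n) * Cpowc (INR n) z / poch z (S n).

(** A sequence comparable with 1/n^2 whose sum telescopes. *)
Definition tele (n : nat) : R := (/ INR (S n) - / INR (S (S n)))%R.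

Lemma tele_eq (n : nat) : tele n = (/ (INR (S n) * INR (S (S n))))%R.
Proof.
  unfold tele; rewrite (S_INR (S n)).
  assert (0 < INR (S n))%R by (apply lt_0_INR; lia).
  field; lra.
Qed.

Lemma tele_decr (n m : nat) : (tele (n + m) <= tele n)%R.
Proof.
  rewrite !tele_eq; apply Rinv_le_contravar.
  - apply Rmult_lt_0_compat; apply lt_0_INR; lia.
  - apply Rmult_le_compat; try apply pos_INR; apply le_INR; lia.
Qed.

Lemma ex_series_tele : ex_series tele.
Proof.
  exists 1%R.
  change (is_lim_seq (sum_n tele) 1%R).
  apply is_lim_seq_ext with (fun n => 1 - / INR (S (S n)))%R.
  - induction n as [|n IH].
    + rewrite sum_O; unfold tele; simpl; field.
    + rewrite sum_Sn, <- IH; unfold tele, plus; simpl; ring.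
  - replace (Finite 1) with (Finite (1 - 0)) by (f_equal; ring).
    apply is_lim_seq_minus'; [apply is_lim_seq_const|].
    apply is_lim_seq_ext with (fun n => / INR (n + 2))%R.
    + intros n; do 2 f_equal; lia.
    + apply (is_lim_seq_incr_n (fun n => / INR n)%R 2), is_lim_seq_inv_INR.
Qed.

(** Multiplied by exp(K/(n+1)), the modulus of u_n is nonincreasing because
    1+v <= e^v; hence u is bounded and its increments are summable. *)
Lemma prod_cv (u w : nat -> C) (K : R) :
  (0 <= K)%R -> (forall n, u (S n) = u n * (1 + w n)) ->
  (forall n, (Cmod (w n) <= K * tele n)%R) -> exists l, Ccv u l.
Proof.
  intros HK Hu Hw.
  assert (B : forall n, (Cmod (u n) * exp (K * / INR (S n)) <= Cmod (u 0%nat) * exp K)%R).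
  { induction n as [|n IH]; [simpl; rewrite Rinv_1, Rmult_1_r; lra|].
    eapply Rle_trans; [|exact IH].
    rewrite Hu, Cmod_mult.
    replace (K * / INR (S n))%R with (K * tele n + K * / INR (S (S n)))%R
      by (unfold tele; ring).
    rewrite exp_plus, Rmult_assoc.
    apply Rmult_le_compat_l; [apply Cmod_ge_0|].
    apply Rmult_le_compat_r; [left; apply exp_pos|].
    eapply Rle_trans; [apply Cmod_triangle|]; rewrite Cmod_1.
    generalize (exp_ineq1_le (K * tele n)) (Hw n); lra. }
  assert (B' : forall n, (Cmod (u n) <= Cmod (u 0%nat) * exp K)%R).
  { intros n; eapply Rle_trans; [|apply (B n)].
    assert (1 <= exp (K * / INR (S n)))%R.
    { rewrite <- exp_0; apply exp_le, Rmult_le_pos; auto.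
      left; apply Rinv_0_lt_compat, lt_0_INR; lia. }
    generalize (Cmod_ge_0 (u n)); nra. }
  destruct (Csum_cv_abs (fun n => u (S n) - u n)
    (fun n => Cmod (u 0%nat) * exp K * K * tele n)%R) as [l Hl].
  - intros n; rewrite Hu; replace (u n * (1 + w n) - u n) with (u n * w n) by ring.
    rewrite Cmod_mult, (Rmult_assoc (_ * exp K)).
    apply Rmult_le_compat; auto; apply Cmod_ge_0.
  - apply (ex_series_scal (K := R_AbsRing) (V := R_NormedModule)
      (Cmod (u 0%nat) * exp K * K)%R tele), ex_series_tele.
  - exists (u 0%nat + l); apply Ccv_ext with (fun n => u 0%nat + Csum (fun n => u (S n) - u n) n).
    + induction n as [|n IH]; [simpl; ring|].
      rewrite Csum_S, Cplus_assoc, IH; ring.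
    + apply Ccv_plus; auto; apply Ccv_const.
Qed.

(** The reciprocals 1/u_n eventually satisfy the hypothesis of prod_cv as well,
    so they converge too and the limit of u cannot be 0. *)
Lemma prod_cv_neq0 (u w : nat -> C) (K : R) (N : nat) :
  (0 <= K)%R -> (forall n, (N <= n)%nat -> u (S n) = u n * (1 + w n)) ->
  (forall n, (N <= n)%nat -> (Cmod (w n) <= K * tele n)%R) ->
  (forall n, (N <= n)%nat -> u n <> 0) -> exists l : C, l <> 0 /\ Ccv u l.
Proof.
  intros HK Hu Hw Hn.
  destruct (nfloor_ex (2 * K) ltac:(lra)) as [N1 HN1].
  set (M := (N + N1)%nat).
  assert (T : forall n, (K * tele (n + M) <= / 2)%R).
  { intros n.
    assert (Q : (tele (n + M) <= / INR (S N1))%R).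
    { rewrite tele_eq; apply Rinv_le_contravar; [apply lt_0_INR; lia|].
      assert (INR (S N1) <= INR (S (n + M)))%R by (apply le_INR; unfold M; lia).
      assert (1 <= INR (S (S (n + M))))%R by (apply (le_INR 1); lia).
      assert (0 < INR (S N1))%R by (apply lt_0_INR; lia).
      nra. }
    rewrite S_INR in Q.
    apply Rle_trans with (K * / (INR N1 + 1))%R; [apply Rmult_le_compat_l; auto|].
    apply Rmult_le_reg_r with (INR N1 + 1)%R; [lra|].
    rewrite Rmult_assoc, Rinv_l by lra; lra. }
  assert (W1 : forall n, (Cmod (w (n + M)%nat) <= / 2)%R).
  { intros n; eapply Rle_trans; [apply Hw; unfold M; lia|apply T]. }
  assert (W2 : forall n, (/ 2 <= Cmod (1 + w (n + M)%nat))%R).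
  { intros n; generalize (Cmod_triangle_inv_plus 1 (w (n + M)%nat)) (W1 n).
    rewrite Cmod_1; lra. }
  assert (W3 : forall n, 1 + w (n + M)%nat <> 0).
  { intros n; apply Cmod_gt_0; generalize (W2 n); lra. }
  destruct (prod_cv (fun n => u (n + M)%nat) (fun n => w (n + M)%nat) K HK) as [l Hl].
  { intros n; apply (Hu (n + M)%nat); unfold M; lia. }
  { intros n; eapply Rle_trans; [apply Hw; unfold M; lia|].
    apply Rmult_le_compat_l; auto; apply tele_decr. }
  destruct (prod_cv (fun n => / u (n + M)%nat)
    (fun n => - w (n + M)%nat / (1 + w (n + M)%nat)) (2 * K)) as [m Hm]; [lra| | |].
  { intros n; cbv beta; change (S n + M)%nat with (S (n + M)); rewrite (Hu (n + M)%nat) by (unfold M; lia).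
    field; split; [apply W3|apply Hn; unfold M; lia]. }
  { intros n; rewrite Cmod_div, Cmod_opp by apply W3.
    apply Rle_trans with (2 * Cmod (w (n + M)%nat))%R.
    - rewrite (Rmult_comm 2); apply Rmult_le_compat_l; [apply Cmod_ge_0|].
      replace 2%R with (/ / 2)%R by field; apply Rinv_le_contravar; [lra|apply W2].
    - rewrite Rmult_assoc; apply Rmult_le_compat_l; [lra|].
      eapply Rle_trans; [apply Hw; unfold M; lia|].
      apply Rmult_le_compat_l; auto; apply tele_decr. }
  exists l; split; [|apply Ccv_decr with M, Hl].
  intros E; apply C1_nz.
  apply Ccv_unique with (fun _ : nat => RtoC 1); [apply Ccv_const|].
  replace (RtoC 0) with (l * m) by (rewrite E; ring).
  apply Ccv_ext with (2 := Ccv_mult _ _ _ _ Hl Hm).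
  intros n; simpl; field; apply Hn; unfold M; lia.
Qed.

Lemma ln_le_sub1 (x : R) : (0 < x)%R -> (ln x <= x - 1)%R.
Proof.
  intros H; generalize (exp_ineq1_le (ln x)); rewrite exp_ln by auto; lra.
Qed.

Lemma ln_succ_bounds (n : nat) :
  (1 <= n)%nat -> (/ INR (S n) <= ln (INR (S n)) - ln (INR n) <= / INR n)%R.
Proof.
  intros H.
  assert (H1 : (0 < INR n)%R) by (apply lt_0_INR; lia).
  assert (H2 : (0 < INR (S n))%R) by (apply lt_0_INR; lia).
  assert (E := S_INR n).
  split.
  - assert (Q := ln_le_sub1 (INR n / INR (S n)) ltac:(apply Rdiv_lt_0_compat; auto)).
    rewrite ln_div in Q by auto.
    replace (INR n / INR (S n) - 1)%R with (- / INR (S n))%R in Q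
      by (rewrite E; field; lra).
    lra.
  - rewrite <- ln_div by auto.
    eapply Rle_trans; [apply ln_le_sub1, Rdiv_lt_0_compat; auto|].
    right; rewrite E; field; lra.
Qed.

Lemma Cmod_Cexp_sub (w : C) :
  (Cmod (Cexp w - 1 - w) <= 2 * exp (2 * Cmod w) * (Cmod w * Cmod w))%R.
Proof.
  assert (Q := Cexp_series_bound w 1).
  rewrite Cmod_minus_comm in Q; simpl in Q.
  replace (Cexp w - (0 + 1 / 1 + w * 1 / 1)) with (Cexp w - 1 - w) in Q by field.
  eapply Rle_trans; [exact Q|]; right; field.
Qed.

Lemma gam_u_neq0 (z : C) (n : nat) : ~ nonpos_int z -> gam_u z n <> 0.
Proof.
  intros Hz; unfold gam_u, Cdiv; apply Cmult_neq_0; [apply Cmult_neq_0|].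
  - apply INR_fact_neq0.
  - apply Cpowc_neq0.
  - apply Cmod_gt_0; rewrite Cmod_inv by (apply poch_neq0, Hz).
    apply Rinv_0_lt_compat, Cmod_gt_0, poch_neq0, Hz.
Qed.

(** Consecutive terms of Euler's sequence have ratio
    (1+1/n)^z (n+1)/(z+n+1) = 1+O(1/n^2). *)
Lemma gam_u_cv (z : C) : ~ nonpos_int z -> exists l : C, l <> 0 /\ Ccv (gam_u z) l.
Proof.
  intros Hz.
  set (w := fun n : nat => INR (S n) / (z + INR (S n)) *
    Cexp (z * (ln (INR (S n)) - ln (INR n))%R) - 1).
  set (A := Cmod z).
  assert (HA : (0 <= A)%R) by apply Cmod_ge_0.
  destruct (nfloor_ex (2 * A) ltac:(lra)) as [N0 HN0].
  set (D := (4 * exp (2 * A) * (A * A) + A)%R).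
  assert (HD : (0 <= D)%R).
  { unfold D; assert (0 < exp (2 * A))%R by apply exp_pos.
    assert (0 <= A * A)%R by nra. nra. }
  apply (prod_cv_neq0 (gam_u z) w (12 * D) (S N0)); [lra| | |intros; apply gam_u_neq0, Hz].
  - intros n Hn; unfold gam_u, w, Cpowc.
    rewrite !Cln_RtoC_pos by (apply lt_0_INR; lia).
    rewrite RtoC_fact_S.
    replace (z * ln (INR (S n))) with (z * ln (INR n) + z * (ln (INR (S n)) - ln (INR n))%R)
      by (rewrite RtoC_minus; ring).
    rewrite Cexp_plus.
    change (poch z (S (S n))) with (poch z (S n) * (z + INR (S n))).
    field; split; [apply not_nonpos_int_plus, Hz|apply poch_neq0, Hz].
  - intros n Hn.
    assert (Hn1 : (1 <= n)%nat) by lia.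
    assert (B := ln_succ_bounds n Hn1).
    set (dl := (ln (INR (S n)) - ln (INR n))%R) in *.
    assert (Pn : (0 < INR n)%R) by (apply lt_0_INR; lia).
    assert (Pn1 : (1 <= INR n)%R) by (apply (le_INR 1); lia).
    assert (En := S_INR n).
    assert (PS : (0 < / INR (S n))%R) by (apply Rinv_0_lt_compat; lra).
    assert (Pi : (/ INR n <= 1)%R).
    { rewrite <- Rinv_1; apply Rinv_le_contravar; lra. }
    assert (NZ : z + INR (S n) <> 0) by (apply not_nonpos_int_plus, Hz).
    assert (E : w n = (INR (S n) * (Cexp (z * dl) - 1 - z * dl) + z * (INR (S n) * dl - 1)) /
      (z + INR (S n))) by (unfold w; fold dl; field; auto).
    assert (Hzd : (Cmod (z * dl) <= A * / INR n)%R).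
    { rewrite Cmod_mult, Cmod_R, Rabs_pos_eq by lra; apply Rmult_le_compat_l; auto; lra. }
    assert (Hzd2 : (Cmod (z * dl) <= A)%R) by nra.
    assert (N1 : (Cmod (Cexp (z * dl) - 1 - z * dl) <=
      2 * exp (2 * A) * (A * A) * (/ INR n * / INR n))%R).
    { eapply Rle_trans; [apply Cmod_Cexp_sub|].
      rewrite (Rmult_assoc (2 * exp (2 * A))).
      assert (P := Cmod_ge_0 (z * dl)).
      apply Rmult_le_compat; [generalize (exp_pos (2 * Cmod (z * dl))); lra|nra| |].
      - apply Rmult_le_compat_l; [lra|apply exp_le; lra].
      - replace (A * A * (/ INR n * / INR n))%R with ((A * / INR n) * (A * / INR n))%R by ring.
        apply Rmult_le_compat; auto. }
    assert (N2 : (Cmod (z * (INR (S n) * dl - 1)) <= A * / INR n)%R).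
    { rewrite Cmod_mult, <- RtoC_mult, <- RtoC_minus, Cmod_R.
      apply Rmult_le_compat_l; auto.
      assert (1 <= INR (S n) * dl)%R.
      { replace 1%R with (INR (S n) * / INR (S n))%R by (field; lra).
        apply Rmult_le_compat_l; lra. }
      assert (INR (S n) * dl <= 1 + / INR n)%R.
      { replace (1 + / INR n)%R with (INR (S n) * / INR n)%R by (rewrite En; field; lra).
        apply Rmult_le_compat_l; lra. }
      rewrite Rabs_pos_eq; lra. }
    assert (N3 : (INR n / 2 <= Cmod (z + INR (S n)))%R).
    { rewrite Cplus_comm.
      generalize (Cmod_triangle_inv_plus (INR (S n)) z); rewrite Cmod_INR; fold A.
      assert (INR (S N0) <= INR n)%R by (apply le_INR; lia).
      rewrite S_INR in *; lra. }
    rewrite E, Cmod_div by auto.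
    assert (N4 : (Cmod (INR (S n) * (Cexp (z * dl) - 1 - z * dl) +
        z * (INR (S n) * dl - 1)) <= D * / INR n)%R).
    { eapply Rle_trans; [apply Cmod_triangle|].
      rewrite Cmod_mult, Cmod_INR.
      assert (INR (S n) * Cmod (Cexp (z * dl) - 1 - z * dl) <=
        (2 * INR n) * (2 * exp (2 * A) * (A * A) * (/ INR n * / INR n)))%R.
      { apply Rmult_le_compat; auto; [lra|apply Cmod_ge_0|lra]. }
      replace ((2 * INR n) * (2 * exp (2 * A) * (A * A) * (/ INR n * / INR n)))%R
        with (4 * exp (2 * A) * (A * A) * / INR n)%R in H by (field; lra).
      unfold D; lra. }
    apply Rle_trans with (D * / INR n * / (INR n / 2))%R.
    { apply Rmult_le_compat; auto; [apply Cmod_ge_0|left; apply Rinv_0_lt_compat; lra|].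
      apply Rinv_le_contravar; lra. }
    rewrite tele_eq, (S_INR (S n)), En.
    replace (D * / INR n * / (INR n / 2))%R with (D * (2 * / (INR n * INR n)))%R
      by (field; lra).
    rewrite (Rmult_comm 12), Rmult_assoc; apply Rmult_le_compat_l; auto.
    apply Rmult_le_reg_r with ((INR n * INR n) * ((INR n + 1) * (INR n + 1 + 1)))%R; [nra|].
    field_simplify; [nra|lra|lra].
Qed.

Lemma CGamma_cv (z : C) : ~ nonpos_int z -> Ccv (gam_u z) (CGamma z) /\ CGamma z <> 0.
Proof.
  intros Hz; destruct (gam_u_cv z Hz) as [l [Hl Hc]].
  assert (E : CGamma z = l).
  { apply Ccv_Re_Im in Hc; destruct Hc as [H1 H2].
    apply C_ext.
    - change (real (Lim_seq (fun n => Re (gam_u z n))) = Re l).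
      rewrite (is_lim_seq_unique _ _ H1); reflexivity.
    - change (real (Lim_seq (fun n => Im (gam_u z n))) = Im l).
      rewrite (is_lim_seq_unique _ _ H2); reflexivity. }
  rewrite E; auto.
Qed.

Lemma CGamma_S (z : C) : ~ nonpos_int z -> CGamma (z + 1) = z * CGamma z.
Proof.
  intros Hz.
  assert (Hz1 := not_nonpos_int_S z Hz).
  destruct (CGamma_cv z Hz) as [H _].
  destruct (CGamma_cv _ Hz1) as [H1 _].
  apply Ccv_unique with (gam_u (z + 1)); auto.
  assert (L : Ccv (fun n => INR n / (z + INR (S n))) 1).
  { destruct (nfloor_ex (2 * Cmod z) ltac:(generalize (Cmod_ge_0 z); lra)) as [N0 HN0].
    apply Ccv_le with (fun n => 2 * Cmod (z + 1) * / INR n)%R (S N0).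
    - intros n Hn.
      assert (NZ : z + INR (S n) <> 0) by (apply not_nonpos_int_plus, Hz).
      assert (Pn : (0 < INR n)%R) by (apply lt_0_INR; lia).
      assert (INR (S N0) <= INR n)%R by (apply le_INR; lia).
      replace (INR n / (z + INR (S n)) - 1) with (- (z + 1) / (z + INR (S n))).
      2:{ rewrite RtoC_INR_S in *; field; auto. }
      rewrite Cmod_div, Cmod_opp by auto.
      assert (N3 : (INR n / 2 <= Cmod (z + INR (S n)))%R).
      { rewrite Cplus_comm.
        generalize (Cmod_triangle_inv_plus (INR (S n)) z); rewrite Cmod_INR.
        rewrite ?S_INR in *; lra. }
      replace (2 * Cmod (z + 1) * / INR n)%R with (Cmod (z + 1) * / (INR n / 2))%R
        by (field; lra).
      apply Rmult_le_compat_l; [apply Cmod_ge_0|apply Rinv_le_contravar; lra].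
    - apply is_lim_seq_scal0, is_lim_seq_inv_INR. }
  apply Ccv_ext_ge with (fun n => z * (gam_u z n * (INR n / (z + INR (S n))))) 1%nat.
  - intros n Hn; unfold gam_u.
    assert (Q := poch_S_l z (S n)).
    assert (Pn : (0 < INR n)%R) by (apply lt_0_INR; lia).
    rewrite Cpowc_plus, Cpowc_1 by (apply RtoC_neq0; lra).
    change (poch z (S (S n))) with (poch z (S n) * (z + INR (S n))) in Q.
    assert (N1 := poch_neq0 z (S n) Hz).
    assert (N2 := poch_neq0 (z + 1) (S n) Hz1).
    assert (N3 := not_nonpos_int_plus z (S n) Hz).
    assert (N4 := not_nonpos_int_neq0 z Hz).
    replace (poch (z + 1) (S n)) with (poch z (S n) * (z + INR (S n)) / z)
      by (rewrite Q; field; auto).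
    field; auto.
  - apply Ccv_scal; replace (CGamma z) with (CGamma z * 1) by ring.
    apply Ccv_mult; auto.
Qed.

Lemma CGamma_poch (z : C) (n : nat) :
  ~ nonpos_int z -> CGamma (z + INR n) = poch z n * CGamma z.
Proof.
  intros Hz; induction n as [|n IH]; [simpl; rewrite Cplus_0_r; ring|].
  rewrite RtoC_INR_S, Cplus_assoc, CGamma_S, IH by (apply not_nonpos_int_add, Hz).
  simpl; ring.
Qed.

(** * Beta integrals *)

Definition wt (s : C) (t : R) : C := tpow (s - 1) (1 - t).

Lemma Ccont_wt (s : C) (t : R) : (2 <= Re s)%R -> Ccont (wt s) t.
Proof.
  intros H; apply (Ccont_tpow_reflect (s - 1)); rewrite Re_minus, re_RtoC; lra.
Qed.

Lemma wt_S (s : C) (t : R) : wt (s + 1) t = (1 - t)%R * wt s t.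
Proof.
  unfold wt; replace (s + 1 - 1) with (s - 1 + 1) by ring; apply tpow_S.
Qed.

Lemma wt_add (s : C) (k : nat) (t : R) : wt (s + INR k) t = RtoC (1 - t) ^ k * wt s t.
Proof.
  unfold wt; replace (s + INR k - 1) with (s - 1 + INR k) by ring; apply tpow_add.
Qed.

Lemma Cderiv_wt_S (s : C) (t : R) :
  (2 <= Re s)%R -> Cderiv (wt (s + 1)) t (- (s * wt s t)).
Proof.
  intros H; unfold wt; apply Cderiv_reflect.
  apply Cderiv_ext with (tpow s); [intros u; f_equal; ring|].
  apply Cderiv_tpow, H.
Qed.

Lemma wt_at_1 (s : C) : wt s 1 = 0.
Proof. unfold wt; apply tpow_npos; lra. Qed.

Lemma wt_at_0 (s : C) : wt s 0 = 1.
Proof. unfold wt; rewrite Rminus_0_r; apply tpow_1. Qed.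

Lemma Cmod_wt_le (s : C) (t : R) : (1 <= Re s)%R -> (0 <= t <= 1)%R -> (Cmod (wt s t) <= 1)%R.
Proof.
  intros H Ht; unfold wt.
  eapply Rle_trans; [apply (Cmod_tpow_le _ 0)|simpl; lra]; [|lra].
  rewrite Re_minus, re_RtoC; simpl; lra.
Qed.

Definition moment (s : C) (n : nat) : C := CInt (fun t => RtoC t ^ n * wt s t).

Lemma moment_eq (s : C) (n : nat) :
  (2 <= Re s)%R -> moment s n = INR (fact n) / poch s (S n).
Proof.
  intros Hs.
  assert (Hn : ~ nonpos_int s) by (apply Re_pos_not_nonpos_int; lra).
  assert (Hc : forall n, Ccont01 (fun t => RtoC t ^ n * wt s t)).
  { intros k t _; apply Ccont_mult; [apply Ccont_RtoC_pow|apply Ccont_wt; lra]. }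
  induction n as [|n IH].
  - assert (Q := CInt_deriv (fun t => - / s * wt (s + 1) t) (fun t => RtoC t ^ 0 * wt s t)).
    unfold moment; rewrite Q; auto.
    + rewrite wt_at_1, wt_at_0; simpl; field; apply not_nonpos_int_neq0; auto.
    + intros t _; eapply Cderiv_eq; [|apply Cderiv_scal, Cderiv_wt_S; lra].
      simpl; field; apply not_nonpos_int_neq0; auto.
  - assert (E : INR (S n) * moment s n - (s + INR (S n)) * moment s (S n) = 0).
    { unfold moment; rewrite <- !CInt_scal, <- CInt_minus; auto.
      2,3: intros t Ht; apply Ccont_scal, Hc; auto.
      rewrite (CInt_deriv (fun t => RtoC t ^ S n * wt (s + 1) t)).
      - rewrite wt_at_1; replace (RtoC 0 ^ S n) with (RtoC 0) by (simpl; ring); ring.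
      - intros t _; eapply Cderiv_eq; [|apply Cderiv_mult;
          [apply Cderiv_pow, Cderiv_id|apply Cderiv_wt_S; lra]].
        cbv beta; rewrite wt_S, RtoC_minus, Cpow_S; ring.
      - intros t Ht; apply Ccont_minus; apply Ccont_scal, Hc; auto. }
    assert (N1 := not_nonpos_int_plus s (S n) Hn).
    assert (E2 : moment s (S n) = INR (S n) / (s + INR (S n)) * moment s n).
    { apply Ceq_minus.
      replace (moment s (S n) - INR (S n) / (s + INR (S n)) * moment s n)
        with (- / (s + INR (S n)) *
          (INR (S n) * moment s n - (s + INR (S n)) * moment s (S n))) by (field; auto).
      rewrite E; ring. }
    rewrite E2, IH, RtoC_fact_S.
    change (poch s (S (S n))) with (poch s (S n) * (s + INR (S n))).
    field; split; auto; apply poch_neq0, Hn.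
Qed.

Definition beta (al s : C) : C := CInt (fun t => tpow (al - 1) t * wt s t).

Lemma Ccont_beta (al s : C) (t : R) :
  (2 <= Re al)%R -> (2 <= Re s)%R -> Ccont (fun t => tpow (al - 1) t * wt s t) t.
Proof.
  intros Ha Hs; apply Ccont_mult; [|apply Ccont_wt; lra].
  apply Ccont_tpow; rewrite Re_minus, re_RtoC; lra.
Qed.

Lemma beta_S (al s : C) :
  (2 <= Re al)%R -> (2 <= Re s)%R -> (al + s) * beta (al + 1) s = al * beta al s.
Proof.
  intros Ha Hs.
  assert (Ha1 : (2 <= Re (al + 1))%R) by (rewrite re_plus, re_RtoC; lra).
  apply Ceq_minus; unfold beta.
  rewrite <- !CInt_scal, <- CInt_minus;
    try (intros t _; try apply Ccont_scal; apply Ccont_beta; lra).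
  rewrite (CInt_deriv (fun t => - (tpow al t * wt (s + 1) t))).
  - rewrite wt_at_1, (tpow_npos al 0) by lra; ring.
  - intros t _; eapply Cderiv_eq; [|apply Cderiv_opp, Cderiv_mult;
      [apply Cderiv_tpow; lra|apply Cderiv_wt_S; lra]].
    cbv beta; replace (al + 1 - 1) with al by ring.
    replace (tpow al t) with (tpow (al - 1 + 1) t) by (f_equal; ring).
    rewrite tpow_S, wt_S, RtoC_minus; ring.
  - intros t Ht; apply Ccont_minus; apply Ccont_scal, Ccont_beta; auto.
Qed.

Lemma beta_add (al s : C) (m : nat) :
  (2 <= Re al)%R -> (2 <= Re s)%R ->
  poch (al + s) m * beta (al + INR m) s = poch al m * beta al s.
Proof.
  intros Ha Hs; induction m as [|m IH]; [simpl; rewrite Cplus_0_r; ring|].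
  assert (Q := beta_S (al + INR m) s).
  rewrite re_plus, re_RtoC in Q.
  specialize (Q ltac:(generalize (pos_INR m); lra) Hs).
  rewrite RtoC_INR_S, Cplus_assoc; simpl.
  replace (poch (al + s) m * (al + s + INR m) * beta (al + INR m + 1) s)
    with (poch (al + s) m * ((al + INR m + s) * beta (al + INR m + 1) s)) by ring.
  rewrite Q.
  replace (poch (al + s) m * ((al + INR m) * beta (al + INR m) s))
    with ((al + INR m) * (poch (al + s) m * beta (al + INR m) s)) by ring.
  rewrite IH; ring.
Qed.

(** * Laplace-type integrals near t = 1 *)

Lemma continuous_laplace (m : nat) (r t : R) :
  continuous (fun t => exp (- r * (1 - t)) * (1 - t) ^ m)%R t.
Proof.
  apply (@ex_derive_continuous R_AbsRing R_NormedModule); auto_derive; auto.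
Qed.

Lemma ex_RInt_laplace (m : nat) (r : R) :
  ex_RInt (fun t => exp (- r * (1 - t)) * (1 - t) ^ m)%R 0 1.
Proof.
  apply (@ex_RInt_continuous R_CompleteNormedModule); intros; apply continuous_laplace.
Qed.

Lemma RInt_laplace (m : nat) (r : R) :
  (0 < r)%R ->
  (RInt (fun t => exp (- r * (1 - t)) * (1 - t) ^ m) 0 1 <= INR (fact m) / r ^ S m)%R.
Proof.
  intros Hr; induction m as [|m IH].
  - assert (E : is_RInt (fun t => exp (- r * (1 - t)) * (1 - t) ^ 0)%R 0 1
      (minus (/ r * exp (- r * (1 - 1))) (/ r * exp (- r * (1 - 0))))%R).
    { apply (is_RInt_derive (fun t => / r * exp (- r * (1 - t)))%R).
      - intros t _; auto_derive; auto; simpl; unfold Rminus; field; lra.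
      - intros; apply continuous_laplace. }
    rewrite (is_RInt_unique _ _ _ _ E).
    unfold minus, plus, opp; simpl.
    replace (- r * (1 - 1))%R with 0%R by ring; rewrite exp_0.
    assert (0 < / r * exp (- r * (1 - 0)))%R
      by (apply Rmult_lt_0_compat; [apply Rinv_0_lt_compat; auto|apply exp_pos]).
    replace (1 / (r * 1))%R with (/ r)%R by (field; lra); lra.
  - assert (E : is_RInt (fun t => minus
        (scal r (exp (- r * (1 - t)) * (1 - t) ^ S m))
        (scal (INR (S m)) (exp (- r * (1 - t)) * (1 - t) ^ m)))%R 0 1
      (minus (exp (- r * (1 - 1)) * (1 - 1) ^ S m) (exp (- r * (1 - 0)) * (1 - 0) ^ S m))%R).
    { apply (is_RInt_derive (fun t => exp (- r * (1 - t)) * (1 - t) ^ S m)%R).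
      - intros t _; auto_derive; auto.
        unfold minus, plus, opp, scal; simpl; unfold mult; simpl Nat.pred.
        change (match m with 0%nat => 1%R | S _ => (INR m + 1)%R end) with (INR (S m)).
        simpl; unfold Rminus; ring.
      - intros t _.
        apply (@ex_derive_continuous R_AbsRing R_NormedModule).
        unfold minus, plus, opp, scal; simpl; unfold mult; simpl.
        auto_derive; auto. }
    assert (E2 := is_RInt_unique _ _ _ _ E).
    rewrite (RInt_minus (fun t => scal r (exp (- r * (1 - t)) * (1 - t) ^ S m)%R)
      (fun t => scal (INR (S m)) (exp (- r * (1 - t)) * (1 - t) ^ m)%R)) in E2
      by (apply (@ex_RInt_scal R_NormedModule); apply ex_RInt_laplace).
    rewrite (RInt_scal (fun t => exp (- r * (1 - t)) * (1 - t) ^ S m)%R),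
      (RInt_scal (fun t => exp (- r * (1 - t)) * (1 - t) ^ m)%R) in E2
      by apply ex_RInt_laplace.
    set (I1 := RInt (fun t => exp (- r * (1 - t)) * (1 - t) ^ S m)%R 0 1) in *.
    set (I0 := RInt (fun t => exp (- r * (1 - t)) * (1 - t) ^ m)%R 0 1) in *.
    assert (E3 : (r * I1 - INR (S m) * I0 <= 0)%R).
    { change (r * I1 + - (INR (S m) * I0) = exp (- r * (1 - 1)) * (1 - 1) ^ S m +
        - (exp (- r * (1 - 0)) * (1 - 0) ^ S m))%R in E2.
      rewrite Rminus_0_r, pow1, Rminus_diag, pow_ne_zero in E2 by lia.
      generalize (exp_pos (- r * 1)); lra. }
    apply Rmult_le_reg_l with r; auto.
    rewrite fact_simpl, mult_INR.
    replace (r * (INR (S m) * INR (fact m) / r ^ S (S m)))%R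
      with (INR (S m) * (INR (fact m) / r ^ S m))%R
      by (simpl; field; split; [apply pow_nonzero|]; lra).
    apply Rle_trans with (INR (S m) * I0)%R; [lra|].
    apply Rmult_le_compat_l; auto; apply pos_INR.
Qed.

(** Bounds a real power by the two neighbouring integer powers, whose Laplace
    integrals are elementary. *)
Lemma exp_interp (m : nat) (p v : R) :
  (INR m <= p <= INR m + 1)%R -> (0 < v)%R ->
  (exp (p * ln v) <= v ^ m + v ^ S m)%R.
Proof.
  intros Hp Hv.
  assert (E : forall k, (v ^ k = exp (INR k * ln v))%R).
  { intros k; rewrite <- ln_pow, exp_ln; auto; apply pow_lt; auto. }
  rewrite !E, S_INR.
  assert (P1 := exp_pos (INR m * ln v)); assert (P2 := exp_pos ((INR m + 1) * ln v)).
  destruct (Rle_dec 0 (ln v)) as [h|h].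
  - assert (exp (p * ln v) <= exp ((INR m + 1) * ln v))%R by (apply exp_le; nra). lra.
  - assert (exp (p * ln v) <= exp (INR m * ln v))%R by (apply exp_le; nra). lra.
Qed.

(** An error factor u(1+ku) at distance u=1-t from the endpoint gains a whole
    power of k over the leading behaviour k^(-s). *)
Lemma decay_lim (s : C) (j : nat) (A : R) (f : nat -> R -> C) :
  (1 <= Re s)%R -> (0 <= A)%R ->
  (forall k, (1 <= k)%nat -> Ccont01 (f k)) ->
  (forall k t, (1 <= k)%nat -> (0 < t < 1)%R ->
    (Cmod (f k t) <= A * (1 + INR k * (1 - t)) * exp (- INR k * (1 - t)) *
       exp (Re s * ln (1 - t)))%R) ->
  Ccv (fun k => Cpowc (INR (k + j)) s * CInt (f k)) 0.
Proof.
  intros Hs HA Hc Hb.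
  set (q := Re s) in *.
  destruct (nfloor_ex q ltac:(lra)) as [m Hm].
  set (K := (INR (fact m) + 2 * INR (fact (S m)) + INR (fact (S (S m))))%R).
  apply Ccv_le with (fun k => 2 * A * K * exp (q * INR j) * / INR k)%R 1%nat.
  2:{ apply is_lim_seq_scal0, is_lim_seq_inv_INR. }
  intros k Hk.
  replace (Cpowc (INR (k + j)) s * CInt (f k) - 0)
    with (Cpowc (INR (k + j)) s * CInt (f k)) by ring.
  assert (Pk : (0 < INR k)%R) by (apply lt_0_INR; lia).
  assert (Pk1 : (1 <= INR k)%R) by (apply (le_INR 1); lia).
  set (r := INR k) in *.
  set (L := fun m t => (exp (- r * (1 - t)) * (1 - t) ^ m)%R).
  set (g := fun t => (A * exp (- q * ln r) *
    (r ^ m * L m t + 2 * r ^ S m * L (S m) t + r ^ S (S m) * L (S (S m)) t))%R).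
  assert (CL : forall m t, continuous (L m) t) by (intros; apply continuous_laplace).
  assert (B1 : (Cmod (CInt (f k)) <= 2 * RInt g 0 1)%R).
  { apply CInt_bound; auto.
    - intros t _; unfold g, L.
      apply (@ex_derive_continuous R_AbsRing R_NormedModule).
      auto_derive; auto.
    - intros t Ht; eapply Rle_trans; [apply (Hb k t); auto|].
      fold r; set (v := (r * (1 - t))%R).
      assert (Hv : (0 < v)%R) by (apply Rmult_lt_0_compat; lra).
      assert (E : exp (q * ln (1 - t)) = (exp (- q * ln r) * exp (q * ln v))%R).
      { rewrite <- exp_plus; f_equal; unfold v; rewrite ln_mult by lra; ring. }
      rewrite E.
      assert (I := exp_interp m q v ltac:(lra) Hv).
      unfold g, L.
      replace (A * exp (- q * ln r) *
        (r ^ m * (exp (- r * (1 - t)) * (1 - t) ^ m) +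
         2 * r ^ S m * (exp (- r * (1 - t)) * (1 - t) ^ S m) +
         r ^ S (S m) * (exp (- r * (1 - t)) * (1 - t) ^ S (S m))))%R
        with (A * (1 + v) * exp (- r * (1 - t)) * (exp (- q * ln r) * (v ^ m + v ^ S m)))%R
        by (unfold v; rewrite !Rpow_mult_distr; simpl; ring).
      apply Rmult_le_compat_l.
      + apply Rmult_le_pos; [apply Rmult_le_pos; lra|left; apply exp_pos].
      + apply Rmult_le_compat_l; auto; left; apply exp_pos. }
  assert (EL : forall m, ex_RInt (L m) 0 1) by (intros; apply ex_RInt_laplace).
  assert (IL : forall m, (RInt (L m) 0 1 <= INR (fact m) / r ^ S m)%R)
    by (intros; apply RInt_laplace; auto).
  assert (B2 : (RInt g 0 1 <= A * exp (- q * ln r) * (K * / r))%R).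
  { assert (E : RInt g 0 1 = (A * exp (- q * ln r) * (r ^ m * RInt (L m) 0 1 +
      2 * r ^ S m * RInt (L (S m)) 0 1 + r ^ S (S m) * RInt (L (S (S m))) 0 1))%R).
    { apply is_RInt_unique; unfold g.
      apply (is_RInt_scal (V := R_NormedModule)).
      apply (is_RInt_plus (V := R_NormedModule)); [apply (is_RInt_plus (V := R_NormedModule))|];
        apply (is_RInt_scal (V := R_NormedModule)), (RInt_correct (V := R_CompleteNormedModule)), EL. }
    rewrite E; apply Rmult_le_compat_l.
    { apply Rmult_le_pos; auto; left; apply exp_pos. }
    assert (T : forall i, (r ^ i * RInt (L i) 0 1 <= INR (fact i) * / r)%R).
    { intros i; assert (Pi : (0 < r ^ i)%R) by (apply pow_lt; auto).
      apply Rle_trans with (r ^ i * (INR (fact i) / r ^ S i))%R.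
      - apply Rmult_le_compat_l; [lra|apply IL].
      - right; simpl; field; split; lra. }
    generalize (T m) (T (S m)) (T (S (S m))); unfold K; lra. }
  rewrite Cmod_mult, Cmod_Cpowc, Carg_RtoC_pos, Rmult_0_r, Rminus_0_r, Cmod_INR
    by (apply lt_0_INR; lia).
  fold q.
  assert (B3 : (exp (q * ln (INR (k + j))) <= exp (q * INR j) * exp (q * ln r))%R).
  { rewrite <- exp_plus; apply exp_le.
    assert (ln (INR (k + j)) <= INR j + ln r)%R; [|nra].
    rewrite plus_INR; fold r.
    replace (r + INR j)%R with (r * (1 + INR j / r))%R by (field; lra).
    assert (Q : (0 <= INR j / r <= INR j)%R).
    { assert (Pj := pos_INR j).
      assert (0 < / r <= 1)%R.
      { split; [apply Rinv_0_lt_compat; auto|rewrite <- Rinv_1; apply Rinv_le_contravar; lra]. }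
      unfold Rdiv; nra. }
    rewrite ln_mult by lra.
    generalize (ln_le_sub1 (1 + INR j / r) ltac:(lra)); lra. }
  assert (PK : (0 <= K)%R) by (unfold K; generalize (pos_INR (fact m)) (pos_INR (fact (S m)))
    (pos_INR (fact (S (S m)))); lra).
  apply Rle_trans with ((exp (q * INR j) * exp (q * ln r)) *
    (2 * (A * exp (- q * ln r) * (K * / r))))%R.
  - apply Rmult_le_compat; [left; apply exp_pos|apply Cmod_ge_0|auto|lra].
  - replace ((exp (q * INR j) * exp (q * ln r)) * (2 * (A * exp (- q * ln r) * (K * / r))))%R
      with ((exp (q * ln r) * exp (- q * ln r)) * (2 * A * K * exp (q * INR j) * / r))%R by ring.
    rewrite <- exp_plus; replace (q * ln r + - q * ln r)%R with 0%R by ring.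
    rewrite exp_0; lra.
Qed.

Lemma moment_lim (s : C) :
  (2 <= Re s)%R -> Ccv (fun n => Cpowc (INR n) s * moment s n) (CGamma s).
Proof.
  intros Hs.
  destruct (CGamma_cv s) as [H _]; [apply Re_pos_not_nonpos_int; lra|].
  apply Ccv_ext with (2 := H); intros n.
  rewrite moment_eq by auto; unfold gam_u.
  field; apply poch_neq0, Re_pos_not_nonpos_int; lra.
Qed.

Lemma Cmod_wt (s : C) (t : R) :
  (t < 1)%R -> Cmod (wt s t) = exp ((Re s - 1) * ln (1 - t)).
Proof.
  intros H; unfold wt; rewrite Cmod_tpow, Re_minus, re_RtoC by lra; reflexivity.
Qed.

Lemma pow_le_exp (k : nat) (t : R) : (0 <= t <= 1)%R -> (t ^ k <= exp (- INR k * (1 - t)))%R.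
Proof.
  intros Ht.
  replace (exp (- INR k * (1 - t))) with (exp (- (1 - t)) ^ k)%R.
  - apply pow_incr; split; [lra|].
    generalize (exp_ineq1_le (- (1 - t))); lra.
  - rewrite <- Rpower_pow by apply exp_pos; unfold Rpower; rewrite ln_exp; f_equal; ring.
Qed.

Lemma exp_mul_ln_S (p v : R) : (0 < v)%R -> (v * exp ((p - 1) * ln v))%R = exp (p * ln v).
Proof.
  intros H; rewrite <- (exp_ln v) at 1 by auto; rewrite <- exp_plus; f_equal; ring.
Qed.

(** Compared with the exact moments n!/(s)_(n+1), the integrand gains a factor
    1-t because t^(al-1) and t^(j+1) agree at t = 1; decay_lim makes the
    difference negligible, and Euler's limit gives the value. *)
Lemma beta_lim (al s : C) (j : nat) :
  (3 <= Re al)%R -> (2 <= Re s)%R ->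
  Ccv (fun k => Cpowc (INR (k + S j)) s * beta (al + INR k) s) (CGamma s).
Proof.
  intros Ha Hs.
  set (h := fun t => tpow (al - 1) t - RtoC t ^ S j).
  set (dh := fun t => (al - 1) * tpow (al - 1 - 1) t - INR (S j) * 1 * RtoC t ^ j).
  assert (Hre : Re (al - 1) = (Re al - 1)%R) by (rewrite Re_minus, re_RtoC; ring).
  assert (Hre2 : Re (al - 1 - 1) = (Re al - 2)%R) by (rewrite !Re_minus, re_RtoC; ring).
  set (A := (2 * (Cmod (al - 1) + INR (S j)))%R).
  assert (HA : (0 <= A)%R) by (unfold A; generalize (Cmod_ge_0 (al - 1)) (pos_INR (S j)); lra).
  assert (Bh : forall t, (0 <= t <= 1)%R -> (Cmod (h t) <= A * (1 - t))%R).
  { intros t Ht.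
    assert (D : forall u, (t <= u <= 1)%R -> Cderiv h u (dh u)).
    { intros u Hu; unfold h, dh; apply Cderiv_minus.
      - apply Cderiv_tpow; lra.
      - apply Cderiv_pow, Cderiv_id. }
    assert (B : forall u, (t <= u <= 1)%R -> (Cmod (dh u) <= Cmod (al - 1) + INR (S j))%R).
    { intros u Hu; unfold dh.
      eapply Rle_trans; [apply Cmod_triangle_minus|].
      rewrite !Cmod_mult, Cmod_1, Cmod_INR, Cmod_pow, Cmod_R, Rabs_pos_eq by lra.
      assert (Q1 := Cmod_tpow_le (al - 1 - 1) 0 u ltac:(rewrite Hre2; simpl; lra) ltac:(lra)).
      simpl in Q1.
      assert (Q2 : (u ^ j <= 1)%R) by (rewrite <- (pow1 j); apply pow_incr; lra).
      generalize (Cmod_ge_0 (al - 1)) (pos_INR (S j)); nra. }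
    assert (Q := Cderiv_bound_const h dh _ t 1 ltac:(lra) D B).
    assert (E1 : h 1%R = 0) by (unfold h; rewrite tpow_1, Cpow_1_l; ring).
    rewrite E1 in Q; rewrite <- Cmod_opp.
    replace (- h t) with (0 - h t) by ring.
    unfold A; lra. }
  set (f := fun (k : nat) t => RtoC t ^ k * h t * wt s t).
  assert (Cf : forall k, Ccont01 (f k)).
  { intros k t _; unfold f, h; apply Ccont_mult; [apply Ccont_mult; [apply Ccont_RtoC_pow|
      apply Ccont_minus; [apply Ccont_tpow; lra|apply (Ccont_RtoC_pow (S j))]]|apply Ccont_wt; lra]. }
  assert (L : Ccv (fun k => Cpowc (INR (k + S j)) s * CInt (f k)) 0).
  { apply decay_lim with A; auto; [lra|].
    intros k t Hk Ht; unfold f.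
    rewrite !Cmod_mult, Cmod_pow, Cmod_R, Rabs_pos_eq, Cmod_wt by lra.
    assert (P1 := pow_le_exp k t ltac:(lra)).
    assert (P2 := Bh t ltac:(lra)).
    assert (P3 : (0 <= t ^ k)%R) by (apply pow_le; lra).
    apply Rle_trans with (exp (- INR k * (1 - t)) * (A * (1 - t)) * exp ((Re s - 1) * ln (1 - t)))%R.
    - apply Rmult_le_compat_r; [left; apply exp_pos|].
      apply Rmult_le_compat; auto; apply Cmod_ge_0.
    - replace (exp (- INR k * (1 - t)) * (A * (1 - t)) * exp ((Re s - 1) * ln (1 - t)))%R
        with (A * exp (- INR k * (1 - t)) * ((1 - t) * exp ((Re s - 1) * ln (1 - t))))%R by ring.
      rewrite exp_mul_ln_S by lra.
      apply Rmult_le_compat_r; [left; apply exp_pos|].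
      apply Rmult_le_compat_r; [left; apply exp_pos|].
      assert (Pk := pos_INR k); assert (0 <= INR k * (1 - t))%R by nra; nra. }
  assert (M := Ccv_incr _ _ (S j) (moment_lim s Hs)).
  assert (E : forall k, beta (al + INR k) s = CInt (f k) + moment s (k + S j)).
  { intros k; unfold moment; rewrite <- CInt_plus; auto.
    - apply CInt_ext; intros t Ht; unfold f, h.
      replace (al + INR k - 1) with (al - 1 + INR k) by ring.
      rewrite tpow_add, Cpow_add_r; ring.
    - intros t _; apply Ccont_mult; [apply Ccont_RtoC_pow|apply Ccont_wt; lra]. }
  replace (CGamma s) with (0 + CGamma s) by ring.
  apply Ccv_ext with (2 := Ccv_plus _ _ _ _ L M).
  intros k; rewrite E; ring.
Qed.

Lemma pow_diff_le (a b : R) (k : nat) :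
  (0 <= b <= a)%R -> (0 <= a ^ S k - b ^ S k <= INR (S k) * (a - b) * a ^ k)%R.
Proof.
  intros H; induction k as [|k IH]; [simpl; lra|].
  assert (Pa : (0 <= a ^ k)%R) by (apply pow_le; lra).
  assert (Q : (0 <= b ^ S k <= a ^ S k)%R).
  { split; [apply pow_le; lra|apply pow_incr; lra]. }
  change (a ^ S (S k))%R with (a * a ^ S k)%R; change (b ^ S (S k))%R with (b * b ^ S k)%R.
  rewrite (S_INR (S k)).
  replace (a * a ^ S k - b * b ^ S k)%R
    with (a * (a ^ S k - b ^ S k) + (a - b) * b ^ S k)%R by ring.
  change (a ^ S k)%R with (a * a ^ k)%R in *.
  assert (0 <= a * (a * a ^ k - b ^ S k) <= a * (INR (S k) * (a - b) * a ^ k))%R.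
  { split; [apply Rmult_le_pos; lra|apply Rmult_le_compat_l; lra]. }
  assert (0 <= (a - b) * b ^ S k <= (a - b) * (a * a ^ k))%R.
  { split; [apply Rmult_le_pos; lra|apply Rmult_le_compat_l; lra]. }
  lra.
Qed.

Lemma exp_pow_eq (c : R) (k : nat) : (exp c ^ k)%R = exp (INR k * c).
Proof. rewrite <- Rpower_pow by apply exp_pos; unfold Rpower; rewrite ln_exp; reflexivity. Qed.

Lemma exp_sub_pow (t : R) (k : nat) :
  (0 <= t <= 1)%R ->
  (0 <= exp (- INR (S k) * (1 - t)) - t ^ S k
     <= INR (S k) * ((1 - t) * (1 - t)) * exp (- INR k * (1 - t)))%R.
Proof.
  intros Ht; set (u := (1 - t)%R).
  assert (A1 : (t <= exp (- u))%R) by (generalize (exp_ineq1_le (- u)); unfold u; lra).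
  assert (A2 : (exp (- u) <= t + u * u)%R).
  { assert (Q := exp_ineq1_le u); assert (P := exp_pos (- u)).
    assert (E : (exp u * exp (- u) = 1)%R)
      by (rewrite <- exp_plus; replace (u + - u)%R with 0%R by ring; apply exp_0).
    unfold u in *; nra. }
  assert (B := pow_diff_le (exp (- u)) t k ltac:(lra)).
  rewrite !exp_pow_eq in B.
  replace (INR (S k) * - u)%R with (- INR (S k) * u)%R in B by ring.
  replace (INR k * - u)%R with (- INR k * u)%R in B by ring.
  split; [lra|]; eapply Rle_trans; [apply B|].
  apply Rmult_le_compat_r; [left; apply exp_pos|].
  apply Rmult_le_compat_l; [apply pos_INR|lra].
Qed.

Lemma Ccont_exp_wt (s y : C) (t : R) :
  (2 <= Re s)%R -> Ccont (fun t => Cexp (t * y) * wt s t) t.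
Proof.
  intros Hs; apply Ccont_mult; [|apply Ccont_wt; lra].
  apply (Ccont_Cexp (fun t => t * y)).
  apply Ccont_ext with (fun u => 0 + u * y); [intros; ring|apply Ccont_line].
Qed.

(** This is e^y y^(-s) times the lower incomplete Gamma function of (s,y); its
    Taylor coefficients at y = 0 are 1/(s)_(n+1). *)
Definition hser (s y : C) : C := CInt (fun t => Cexp (t * y) * wt s t).

Lemma hser_series (s y : C) :
  (2 <= Re s)%R -> Ccv (Csum (fun n => y ^ n / poch s (S n))) (hser s y).
Proof.
  intros Hs; apply Ccv_decr with 1%nat.
  set (M := Cmod y).
  assert (HM : (0 <= M)%R) by apply Cmod_ge_0.
  assert (C1 : forall n : nat, Ccont01 (fun t => RtoC t ^ n * wt s t)).
  { intros n t _; apply Ccont_mult; [apply Ccont_RtoC_pow|apply Ccont_wt; lra]. }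
  apply Ccv_le with (fun N => 2 * (2 * exp (2 * M)) * (M ^ S N / INR (fact N)))%R O;
    [|apply is_lim_seq_scal0, pow_fact_lim0].
  intros N _; rewrite Nat.add_1_r.
  assert (E : Csum (fun n => y ^ n / poch s (S n)) (S N) =
    CInt (fun t => Csum (fun n => y ^ n / INR (fact n) * (RtoC t ^ n * wt s t)) (S N))).
  { rewrite (CInt_Csum (fun n t => y ^ n / INR (fact n) * (RtoC t ^ n * wt s t))).
    - apply Csum_ext; intros k _; rewrite CInt_scal by auto.
      fold (moment s k); rewrite moment_eq by lra.
      field; split; [apply poch_neq0, Re_pos_not_nonpos_int; lra|apply INR_fact_neq0].
    - intros k _ t Ht; apply Ccont_scal, C1; auto. }
  rewrite E; unfold hser; rewrite <- CInt_minus.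
  - rewrite Rmult_assoc; apply CInt_bound_const.
    + intros t Ht; apply Ccont_minus; [|apply Ccont_exp_wt; auto].
      apply (Ccont_Csum (fun n t => y ^ n / INR (fact n) * (RtoC t ^ n * wt s t))).
      intros k _; apply Ccont_scal, C1; auto.
    + intros t Ht.
      replace (Csum _ (S N) - Cexp (t * y) * wt s t)
        with ((Csum (fun k => (t * y) ^ k / INR (fact k)) (S N) - Cexp (t * y)) * wt s t).
      2:{ rewrite (Csum_ext (fun n => y ^ n / INR (fact n) * (RtoC t ^ n * wt s t)) (fun k => wt s t * ((t * y) ^ k / INR (fact k))) (S N)).
          - rewrite Csum_scal; ring.
          - intros k _; rewrite Cpow_mult_l; unfold Cdiv; ring. }
      rewrite Cmod_mult.
      assert (B := Cexp_series_bound (t * y) N).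
      assert (W := Cmod_wt_le s t ltac:(lra) ltac:(lra)).
      assert (My : (Cmod (t * y) <= M)%R).
      { rewrite Cmod_mult, Cmod_R, Rabs_pos_eq by lra; fold M; nra. }
      assert (P := Cmod_ge_0 (t * y)).
      assert (B2 : (2 * exp (2 * Cmod (t * y)) * (Cmod (t * y) ^ S N / INR (fact N)) <=
        2 * exp (2 * M) * (M ^ S N / INR (fact N)))%R).
      { assert (F := Rinv_0_lt_compat _ (INR_fact_lt_0 N)).
        apply Rmult_le_compat.
        - generalize (exp_pos (2 * Cmod (t * y))); lra.
        - apply Rmult_le_pos; [apply pow_le; auto|lra].
        - apply Rmult_le_compat_l; [lra|apply exp_le; lra].
        - apply Rmult_le_compat_r; [lra|apply pow_incr; lra]. }
      rewrite <- (Rmult_1_r (2 * exp (2 * M) * _)).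
      apply Rmult_le_compat; try apply Cmod_ge_0; auto; lra.
  - intros t Ht.
    apply (Ccont_Csum (fun n t => y ^ n / INR (fact n) * (RtoC t ^ n * wt s t))).
    intros k _; apply Ccont_scal, C1; auto.
  - intros t _; apply Ccont_exp_wt; auto.
Qed.

(** The lower incomplete Gamma function; its limit at infinity is Gamma(s). *)
Definition hnorm (s y : C) : C := Cexp (- y) * Cpowc y s * hser s y.

(** At y = n the integrand e^(-n(1-t)) (1-t)^(s-1) differs little from that of
    the exact moment, because e^(-u) and 1-u agree to second order. *)
Lemma hnorm_INR_lim (s : C) :
  (2 <= Re s)%R -> Ccv (fun n => hnorm s (INR n)) (CGamma s).
Proof.
  intros Hs; apply Ccv_decr with 1%nat.
  set (f := fun (k : nat) t => (exp (- INR (S k) * (1 - t)) - t ^ S k)%R * wt s t).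
  assert (Cf : forall k, Ccont01 (f k)).
  { intros k t _; unfold f; apply Ccont_mult; [|apply Ccont_wt; lra].
    apply Ccont_RtoC, (@ex_derive_continuous R_AbsRing R_NormedModule).
    auto_derive; auto. }
  assert (L : Ccv (fun k => Cpowc (INR (k + 1)) s * CInt (f k)) 0).
  { apply decay_lim with 2%R; auto; try lra.
    intros k t Hk Ht; unfold f.
    assert (B := exp_sub_pow t k ltac:(lra)).
    rewrite Cmod_mult, Cmod_R, (Rabs_pos_eq _ (proj1 B)), Cmod_wt by lra.
    rewrite <- (exp_mul_ln_S (Re s)) by lra.
    set (e := exp ((Re s - 1) * ln (1 - t))).
    assert (Pe : (0 < e)%R) by apply exp_pos.
    eapply Rle_trans; [apply Rmult_le_compat_r; [lra|apply B]|].
    rewrite S_INR.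
    set (E := exp (- INR k * (1 - t))).
    assert (PE : (0 < E)%R) by apply exp_pos.
    replace ((INR k + 1) * ((1 - t) * (1 - t)) * E * e)%R
      with (((INR k + 1) * (1 - t)) * (E * ((1 - t) * e)))%R by ring.
    replace (2 * (1 + INR k * (1 - t)) * E * ((1 - t) * e))%R
      with ((2 * (1 + INR k * (1 - t))) * (E * ((1 - t) * e)))%R by ring.
    apply Rmult_le_compat_r.
    - apply Rmult_le_pos; [lra|apply Rmult_le_pos; lra].
    - assert (P := pos_INR k); nra. }
  assert (M := Ccv_incr _ _ 1 (moment_lim s Hs)).
  replace (CGamma s) with (0 + CGamma s) by ring.
  apply Ccv_ext with (2 := Ccv_plus _ _ _ _ L M).
  intros k; cbv beta; rewrite Nat.add_1_r.
  unfold hnorm, hser, moment.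
  rewrite <- Cmult_plus_distr_l, <- CInt_plus; auto.
  2:{ intros t _; apply Ccont_mult; [apply (Ccont_RtoC_pow (S k))|apply Ccont_wt; lra]. }
  rewrite (Cmult_comm (Cexp _)), <- Cmult_assoc; f_equal.
  rewrite <- CInt_scal by (intros t _; apply Ccont_exp_wt; auto).
  apply CInt_ext; intros t Ht; unfold f.
  rewrite Cmult_assoc, <- Cexp_plus.
  replace (- INR (S k) + t * INR (S k)) with (RtoC (- INR (S k) * (1 - t)))
    by (rewrite RtoC_mult, RtoC_opp, RtoC_minus; ring).
  rewrite Cexp_RtoC, RtoC_minus, RtoC_pow; ring.
Qed.

(** Half of the exponential absorbs the power of w, uniformly in the sector. *)
Lemma cone_bound (s : C) (kap : R) :
  (2 <= Re s)%R -> (0 < kap)%R ->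
  exists D : R, (0 <= D)%R /\ forall w : C, w <> 0 -> (kap * Cmod w <= Re w)%R ->
    (Cmod (Cexp (- w) * Cpowc w s / w) <= D * exp (- (Re w / 2)))%R.
Proof.
  intros Hs Hk.
  set (e := (kap / (2 * (Re s - 1)))%R).
  assert (He : (0 < e)%R) by (apply Rdiv_lt_0_compat; lra).
  exists (exp ((Re s - 1) * - ln e + Rabs (Im s) * PI)); split; [left; apply exp_pos|].
  intros w Hw Hc.
  assert (Pw : (0 < Cmod w)%R) by (apply Cmod_gt_0, Hw).
  rewrite Cmod_div, Cmod_mult, Cmod_Cexp, Cmod_Cpowc, re_opp by auto.
  replace (exp (- Re w) * exp (Re s * ln (Cmod w) - Im s * Carg w) / Cmod w)%R
    with (exp (- Re w + (Re s - 1) * ln (Cmod w) - Im s * Carg w)).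
  2:{ rewrite <- (exp_ln (Cmod w)) at 3 by auto.
      unfold Rdiv; rewrite <- exp_Ropp, <- !exp_plus; f_equal; ring. }
  rewrite <- exp_plus; apply exp_le.
  assert (L := ln_le_sub1 (e * Cmod w) ltac:(apply Rmult_lt_0_compat; auto)).
  rewrite ln_mult in L by auto.
  assert (L2 : ((Re s - 1) * ln (Cmod w) <= (Re s - 1) * - ln e + kap * Cmod w / 2)%R).
  { replace (kap * Cmod w / 2)%R with ((Re s - 1) * (e * Cmod w))%R
      by (unfold e; field; lra).
    rewrite <- Rmult_plus_distr_l; apply Rmult_le_compat_l; lra. }
  assert (L3 : (- (Im s * Carg w) <= Rabs (Im s) * PI)%R).
  { eapply Rle_trans; [apply Rle_abs|]; rewrite Rabs_Ropp, Rabs_mult.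
    apply Rmult_le_compat_l; [apply Rabs_pos|apply Carg_bound]. }
  lra.
Qed.

Lemma Cmod_poch_ge (s : C) (N : nat) :
  (1 <= Re s)%R -> (INR (fact N) <= Cmod (poch s N))%R.
Proof.
  intros Hs; induction N as [|N IH]; [simpl; rewrite Cmod_1; lra|].
  simpl poch; rewrite fact_simpl, mult_INR, Cmod_mult, Rmult_comm.
  apply Rmult_le_compat; try apply pos_INR; auto.
  eapply Rle_trans; [|apply re_le_Cmod].
  rewrite re_plus, re_RtoC, S_INR; eapply Rle_trans; [|apply Rle_abs]; lra.
Qed.

Lemma fact_S_ge (N : nat) : (INR (fact N) <= INR (fact (S N)))%R.
Proof. apply le_INR, fact_le; lia. Qed.

(** The product rule gives two terms for each power of w = p+lq, and the second
    term for w^n cancels the first for w^(n+1). *)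
Lemma Cderiv_hnorm_partial (s p q : C) (l : R) (N : nat) :
  ~ nonpos_int s -> cut_plane (p + l * q) ->
  Cderiv (fun l => Cexp (- (p + l * q)) * Cpowc (p + l * q) s *
      Csum (fun n => (p + l * q) ^ n / poch s (S n)) (S N)) l
    (q * (Cexp (- (p + l * q)) * Cpowc (p + l * q) s / (p + l * q)) *
      (1 - (p + l * q) ^ S N / poch s (S N))).
Proof.
  intros Hs Hc.
  assert (Hn := cut_plane_neq0 _ Hc).
  assert (D0 : Cderiv (fun l => Cexp (- (p + l * q)) * Cpowc (p + l * q) s) l
    (- q * Cexp (- (p + l * q)) * Cpowc (p + l * q) s + Cexp (- (p + l * q)) *
      (s * q / (p + l * q) * Cpowc (p + l * q) s))).
  { apply (Cderiv_mult (fun l => Cexp (- (p + l * q)))).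
    - apply (Cderiv_Cexp (fun l => - (p + l * q))), Cderiv_opp, Cderiv_line.
    - apply Cderiv_Cpowc, Hc. }
  induction N as [|N IH].
  - eapply Cderiv_eq; [|apply Cderiv_ext with (fun l =>
      Cexp (- (p + l * q)) * Cpowc (p + l * q) s * (/ s)); [|apply Cderiv_mult;
        [apply D0|apply Cderiv_const]]].
    + simpl; assert (Hs0 := not_nonpos_int_neq0 s Hs); field.
      split; auto; intros E; apply Hs0; rewrite <- E; ring.
    + intros u; simpl; assert (Hs0 := not_nonpos_int_neq0 s Hs); field.
      intros E; apply Hs0; rewrite <- E; ring.
  - eapply Cderiv_eq; [|apply Cderiv_ext with (fun l =>
      Cexp (- (p + l * q)) * Cpowc (p + l * q) s *
        Csum (fun n => (p + l * q) ^ n / poch s (S n)) (S N) +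
      Cexp (- (p + l * q)) * Cpowc (p + l * q) s *
        (/ poch s (S (S N)) * (p + l * q) ^ S N)); [|apply Cderiv_plus; [apply IH|
        apply Cderiv_mult; [apply D0|apply Cderiv_scal, Cderiv_pow, Cderiv_line]]]].
    + cbv beta; rewrite !(Cpow_S (p + l * q)).
      change (poch s (S (S N))) with (poch s (S N) * (s + INR (S N))).
      field; repeat split; auto; [apply not_nonpos_int_plus, Hs|apply poch_neq0, Hs].
    + intros u; rewrite (Csum_S _ (S N)); unfold Cdiv; ring.
Qed.

(** The limit along the integers is transported to y along a segment, which
    stays in the sector; there the derivative is exponentially small. *)
Lemma hnorm_bound (s : C) (kap : R) :
  (2 <= Re s)%R -> (0 < kap)%R ->
  exists K : R, (0 <= K)%R /\ forall y : C, y <> 0 -> (kap * Cmod y <= Re y)%R ->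
    (Cmod (hnorm s y - CGamma s) <= K * exp (- (Re y / 2)))%R.
Proof.
  intros Hs Hk.
  assert (Hs' : ~ nonpos_int s) by (apply Re_pos_not_nonpos_int; lra).
  destruct (cone_bound s kap Hs Hk) as [D [HD HB]].
  exists (12 * D)%R; split; [lra|].
  intros y Hy Hc.
  assert (Py : (0 < Cmod y)%R) by (apply Cmod_gt_0, Hy).
  assert (Pre : (0 < Re y)%R) by nra.
  assert (Rle : (Re y <= Cmod y)%R) by (eapply Rle_trans; [apply Rle_abs|apply re_le_Cmod]).
  assert (K1 : (kap <= 1)%R) by nra.
  (* For n >= 2|y| the segment from y to n is at most three times as long as its
     projection on the real axis. *)
  destruct (nfloor_ex (2 * Cmod y) ltac:(lra)) as [n0 Hn0].
  assert (Main : forall n : nat, (S n0 <= n)%nat ->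
    (Cmod (hnorm s (INR n) - hnorm s y) <= 12 * D * exp (- (Re y / 2)))%R).
  { intros n Hn.
    assert (Hn' : (2 * Cmod y <= INR n)%R).
    { assert (INR (S n0) <= INR n)%R by (apply le_INR; lia). rewrite S_INR in *; lra. }
    set (q := INR n - y).
    set (w := fun l : R => y + l * q).
    assert (Rew : forall l : R, Re (w l) = (Re y + l * (INR n - Re y))%R).
    { intros l; unfold w, q; rewrite re_plus, re_scal_l, Re_minus, re_RtoC; reflexivity. }
    assert (Mw : forall l : R, (0 <= l <= 1)%R ->
      (Cmod (w l) <= (1 - l) * Cmod y + l * INR n)%R).
    { intros l Hl; replace (w l) with (RtoC (1 - l) * y + RtoC l * INR n)
        by (unfold w, q; rewrite RtoC_minus; ring).
      eapply Rle_trans; [apply Cmod_triangle|].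
      rewrite !Cmod_mult, Cmod_INR, !Cmod_R, !Rabs_pos_eq by lra; lra. }
    assert (Cw : forall l : R, (0 <= l <= 1)%R -> (kap * Cmod (w l) <= Re (w l))%R).
    { intros l Hl; rewrite Rew; specialize (Mw l Hl).
      apply Rle_trans with (kap * ((1 - l) * Cmod y + l * INR n))%R;
        [apply Rmult_le_compat_l; lra|].
      assert ((1 - l) * (kap * Cmod y) <= (1 - l) * Re y)%R by (apply Rmult_le_compat_l; lra).
      assert (kap * (l * INR n) <= l * INR n)%R.
      { assert (0 <= l * INR n)%R by (apply Rmult_le_pos; lra). nra. }
      lra. }
    assert (Pw : forall l : R, (0 <= l <= 1)%R -> (0 < Re (w l))%R).
    { intros l Hl; rewrite Rew; nra. }
    assert (Nw : forall l : R, (0 <= l <= 1)%R -> w l <> 0).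
    { intros l Hl E; generalize (Pw l Hl); rewrite E, re_RtoC; lra. }
    set (R0 := (Cmod y + INR n)%R).
    set (eN := fun N : nat => (R0 ^ S N / INR (fact N))%R).
    assert (HeN : forall N, (0 <= eN N)%R).
    { intros N; unfold eN; apply Rmult_le_pos; [apply pow_le; unfold R0; lra|].
      left; apply Rinv_0_lt_compat, INR_fact_lt_0. }
    set (v := fun N (l : R) => Cexp (- (w l)) * Cpowc (w l) s *
      Csum (fun k => (w l) ^ k / poch s (S k)) (S N)).
    set (dv := fun N (l : R) => q * (Cexp (- (w l)) * Cpowc (w l) s / (w l)) *
      (1 - (w l) ^ S N / poch s (S N))).
    set (del := (INR n - Re y)%R).
    assert (Hdel : (0 < del)%R) by (unfold del; lra).
    assert (Hq : (Cmod q <= 3 * del)%R).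
    { unfold q; eapply Rle_trans; [apply Cmod_triangle_minus|]; rewrite Cmod_INR.
      unfold del; lra. }
    assert (VB : forall N, (Cmod (v N 1%R - v N 0%R) <=
      12 * D * exp (- (Re y / 2)) * (1 + eN N))%R).
    { intros N.
      set (A := (3 * D * (1 + eN N))%R).
      assert (HA : (0 <= A)%R) by (unfold A; generalize (HeN N); intros; apply Rmult_le_pos; lra).
      assert (Q := Cderiv_bound (v N) (dv N)
        (fun l => - (2 * A) * exp (- ((Re y + l * del) / 2)))%R
        (fun l => A * del * exp (- ((Re y + l * del) / 2)))%R 0 1 ltac:(lra)).
      assert (Q' : (Cmod (v N 1%R - v N 0%R) <= 2 *
        (- (2 * A) * exp (- ((Re y + 1 * del) / 2)) -
         - (2 * A) * exp (- ((Re y + 0 * del) / 2))))%R).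
      { apply Q.
        - intros l Hl; apply Cderiv_hnorm_partial; auto.
          apply cut_plane_Re_pos, (Pw l Hl).
        - intros l Hl; auto_derive; auto; unfold Rdiv; field.
        - intros l Hl; unfold dv.
          rewrite Cmod_mult, Cmod_mult.
          assert (B1 := HB (w l) (Nw l Hl) (Cw l Hl)).
          rewrite Rew in B1; fold del in B1.
          assert (B2 : (Cmod (1 - w l ^ S N / poch s (S N)) <= 1 + eN N)%R).
          { eapply Rle_trans; [apply Cmod_triangle_minus|]; rewrite Cmod_1.
            apply Rplus_le_compat_l.
            rewrite Cmod_div, Cmod_pow by (apply poch_neq0, Hs').
            unfold eN; apply Rmult_le_compat.
            - apply pow_le, Cmod_ge_0.
            - left; apply Rinv_0_lt_compat, Cmod_gt_0, poch_neq0, Hs'.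
            - apply pow_incr; split; [apply Cmod_ge_0|].
              specialize (Mw l Hl); unfold R0.
              assert (0 <= l * Cmod y)%R by (apply Rmult_le_pos; lra).
              assert (0 <= (1 - l) * INR n)%R by (apply Rmult_le_pos; lra). lra.
            - apply Rinv_le_contravar; [apply INR_fact_lt_0|].
              eapply Rle_trans; [apply fact_S_ge|apply Cmod_poch_ge; lra]. }
          replace (A * del * exp (- ((Re y + l * del) / 2)))%R
            with (3 * del * (D * exp (- ((Re y + l * del) / 2))) * (1 + eN N))%R
            by (unfold A; ring).
          apply Rmult_le_compat; auto; [apply Rmult_le_pos; apply Cmod_ge_0|apply Cmod_ge_0|].
          apply Rmult_le_compat; auto; apply Cmod_ge_0. }
      rewrite Rmult_0_l, Rplus_0_r in Q'.
      assert (P1 : (0 <= A * exp (- ((Re y + 1 * del) / 2)))%R)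
        by (apply Rmult_le_pos; auto; left; apply exp_pos).
      replace (12 * D * exp (- (Re y / 2)) * (1 + eN N))%R
        with (4 * (A * exp (- (Re y / 2))))%R by (unfold A; ring).
      lra. }
    assert (W1 : w 1%R = INR n) by (unfold w, q; ring).
    assert (W0 : w 0%R = y) by (unfold w, q; ring).
    assert (LV : forall l, Ccv (fun N => v N l) (hnorm s (w l))).
    { intros l; unfold v, hnorm; apply Ccv_scal.
      apply Ccv_ext with (fun N => Csum (fun k => (w l) ^ k / poch s (S k)) (N + 1)).
      - intros N; rewrite Nat.add_1_r; reflexivity.
      - apply Ccv_incr, hser_series; lra. }
    assert (L := Ccv_minus _ _ _ _ (LV 1%R) (LV 0%R)).
    rewrite W1, W0 in L.
    apply Ccv_limit_le with (3 := L) (1 := fun N (_ : (0 <= N)%nat) => VB N).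
    replace (Finite (12 * D * exp (- (Re y / 2))))
      with (Finite (12 * D * exp (- (Re y / 2)) + 12 * D * exp (- (Re y / 2)) * 0))
      by (f_equal; ring).
    apply is_lim_seq_ext with
      (fun N => 12 * D * exp (- (Re y / 2)) + 12 * D * exp (- (Re y / 2)) * eN N)%R;
      [intros; ring|].
    apply is_lim_seq_plus'; [apply is_lim_seq_const|].
    rewrite Rmult_0_r; apply is_lim_seq_scal0, pow_fact_lim0. }
  rewrite Cmod_minus_comm.
  apply Ccv_limit_le with (u := fun n : nat => hnorm s (INR n) - hnorm s y)
    (v := fun _ => (12 * D * exp (- (Re y / 2)))%R) (N := S n0); auto.
  - apply is_lim_seq_const.
  - apply Ccv_minus; [apply hnorm_INR_lim; auto|apply Ccv_const].
Qed.

(** * Uniqueness of the analytic continuation *)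

Lemma Csum_cv_terms_bounded (u : nat -> C) (l : C) :
  Ccv (Csum u) l -> exists M, (0 <= M)%R /\ forall n, (Cmod (u n) <= M)%R.
Proof.
  intros H; destruct (Ccv_bounded _ _ H) as [M [HM B]].
  exists (2 * M)%R; split; [lra|]; intros n.
  replace (u n) with (Csum u (S n) - Csum u n) by (rewrite Csum_S; ring).
  eapply Rle_trans; [apply Cmod_triangle_minus|].
  generalize (B n) (B (S n)); lra.
Qed.

Lemma geom_tail_bound (u : nat -> C) (M r : R) (k N : nat) :
  (0 <= M)%R -> (0 <= r <= / 2)%R -> (forall n, (Cmod (u n) <= M * r ^ n)%R) ->
  (Cmod (Csum (fun j => u (k + j)%nat) N) <= 2 * M * r ^ k)%R.
Proof.
  intros HM Hr Hu.
  assert (Pk : (0 <= r ^ k)%R) by (apply pow_le; lra).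
  assert (B : (Cmod (Csum (fun j => u (k + j)%nat) N) <= 2 * M * r ^ k * (1 - r ^ N))%R).
  { induction N as [|N IH]; [simpl; rewrite Cmod_0; lra|].
    rewrite Csum_S; eapply Rle_trans; [apply Cmod_triangle|].
    specialize (Hu (k + N)%nat); rewrite pow_add in Hu.
    assert (PN : (0 <= r ^ N)%R) by (apply pow_le; lra).
    assert (PM : (0 <= M * r ^ k * r ^ N)%R)
      by (apply Rmult_le_pos; auto; apply Rmult_le_pos; auto).
    simpl; nra. }
  eapply Rle_trans; [exact B|].
  assert (0 <= r ^ N)%R by (apply pow_le; lra).
  assert (0 <= 2 * M * r ^ k)%R by (apply Rmult_le_pos; lra).
  nra.
Qed.

(** If s_k is the first nonzero coefficient, then near the centre s_k w^k
    dominates the tail, so the sum has no small nonzero root. *)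
Lemma pseries_zero (s : nat -> C) (w1 l1 : C) :
  w1 <> 0 -> is_pseries s w1 l1 ->
  (forall e : R, (0 < e)%R -> exists w : C, w <> 0 /\ (Cmod w < e)%R /\ is_pseries s w (RtoC 0)) ->
  forall k, s k = 0.
Proof.
  intros Hw1 H1 Hz.
  apply is_pseries_Ccv, Csum_cv_terms_bounded in H1; destruct H1 as [M [HM B]].
  assert (P1 : (0 < Cmod w1)%R) by (apply Cmod_gt_0, Hw1).
  intros k; induction k as [k IH] using (well_founded_induction Wf_nat.lt_wf).
  apply Cmod_eq_0, Rle_antisym; [|apply Cmod_ge_0].
  apply Rnot_lt_le; intros Hs.
  set (D := (2 * M / (Cmod w1 * Cmod w1 ^ k))%R).
  assert (Pk1 : (0 < Cmod w1 ^ k)%R) by (apply pow_lt; auto).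
  assert (HD : (0 <= D)%R).
  { unfold D; apply Rmult_le_pos; [lra|left; apply Rinv_0_lt_compat, Rmult_lt_0_compat; auto]. }
  assert (He : (0 < Rmin (Cmod w1 / 2) (Cmod (s k) / (D + 1)))%R)
    by (apply Rmin_pos; apply Rdiv_lt_0_compat; lra).
  destruct (Hz _ He) as [w [Hw [Hwe Hp]]].
  assert (M1 := Rmin_l (Cmod w1 / 2) (Cmod (s k) / (D + 1))).
  assert (M2 := Rmin_r (Cmod w1 / 2) (Cmod (s k) / (D + 1))).
  assert (Pw : (0 < Cmod w)%R) by (apply Cmod_gt_0, Hw).
  set (r := (Cmod w / Cmod w1)%R).
  assert (Hr : (0 <= r <= / 2)%R).
  { unfold r; split; [apply Rmult_le_pos; [lra|left; apply Rinv_0_lt_compat; auto]|].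
    apply Rmult_le_reg_r with (Cmod w1); auto.
    unfold Rdiv; rewrite Rmult_assoc, Rinv_l; lra. }
  set (u := fun n => s n * w ^ n).
  assert (Hu : forall n, (Cmod (u n) <= M * r ^ n)%R).
  { intros n; unfold u; rewrite Cmod_mult, Cmod_pow.
    specialize (B n); rewrite Cmod_mult, Cmod_pow in B.
    assert (Pn : (0 < Cmod w1 ^ n)%R) by (apply pow_lt; auto).
    unfold r, Rdiv; rewrite Rpow_mult_distr, pow_inv.
    replace (Cmod (s n) * Cmod w ^ n)%R
      with ((Cmod (s n) * Cmod w1 ^ n) * (Cmod w ^ n * / Cmod w1 ^ n))%R by (field; lra).
    apply Rmult_le_compat_r; auto.
    apply Rmult_le_pos; [apply pow_le; lra|left; apply Rinv_0_lt_compat; auto]. }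
  apply is_pseries_Ccv in Hp; fold u in Hp.
  apply Ccv_incr with (k := S k) in Hp.
  assert (Hl : (Cmod (u k) <= 2 * M * r ^ S k)%R).
  { rewrite <- Cmod_opp; replace (- u k) with (0 - u k) by ring.
    apply Ccv_limit_le with (u := fun n => Csum u (n + S k) - u k)
      (v := fun _ => (2 * M * r ^ S k)%R) (N := O).
    - intros n _; rewrite Nat.add_comm, Csum_add, Csum_S.
      rewrite (Csum_zero u k) by (intros j Hj; unfold u; rewrite IH by auto; ring).
      replace (0 + u k + Csum (fun j => u (S k + j)%nat) n - u k)
        with (Csum (fun j => u (S k + j)%nat) n) by ring.
      apply geom_tail_bound; auto.
    - apply is_lim_seq_const.
    - apply Ccv_minus; auto; apply Ccv_const. }
  unfold u in Hl; rewrite Cmod_mult, Cmod_pow in Hl.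
  assert (Pwk : (0 < Cmod w ^ k)%R) by (apply pow_lt; auto).
  assert (Hl2 : (Cmod (s k) <= D * Cmod w)%R).
  { apply Rmult_le_reg_r with (Cmod w ^ k)%R; auto.
    eapply Rle_trans; [exact Hl|]; right.
    unfold D, r; simpl; unfold Rdiv; rewrite Rpow_mult_distr, pow_inv; field; lra. }
  assert (Hl3 : (Cmod w * (D + 1) < Cmod (s k))%R).
  { apply Rmult_lt_reg_r with (/ (D + 1))%R; [apply Rinv_0_lt_compat; lra|].
    rewrite Rmult_assoc, Rinv_r by lra. unfold Rdiv in M2; lra. }
  lra.
Qed.

Lemma slit_plane_segment (x : C) (t : R) :
  slit_plane x -> (0 <= t <= 1)%R -> slit_plane (t * x).
Proof.
  unfold slit_plane; rewrite re_scal_l, im_scal_l; intros H Ht [E1 E2]; apply H.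
  destruct (Req_dec t 0) as [->|N]; [lra|].
  split.
  - apply Rmult_integral in E1; tauto.
  - nra.
Qed.

Lemma slit_plane_open (x : C) :
  slit_plane x -> exists r : R, (0 < r)%R /\ forall w : C, (Cmod w < r)%R -> slit_plane (x + w).
Proof.
  intros H; destruct (Req_dec (Im x) 0) as [E|E].
  - assert (Hx : (Re x < 1)%R) by (apply Rnot_le_lt; intros L; apply H; auto).
    exists (1 - Re x)%R; split; [lra|]; intros w Hw [_ E2].
    rewrite re_plus in E2.
    generalize (Rle_abs (Re w)) (re_le_Cmod w); lra.
  - exists (Rabs (Im x)); split; [apply Rabs_pos_lt, E|]; intros w Hw [E1 _].
    rewrite im_plus in E1; generalize (Im_le_Cmod w).
    replace (Im w) with (- Im x)%R by lra; rewrite Rabs_Ropp; lra.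
Qed.

Lemma slit_plane_disk (x : C) : (Cmod x < 1)%R -> slit_plane x.
Proof.
  intros H [_ E]; generalize (Rle_abs (Re x)) (re_le_Cmod x); lra.
Qed.

Lemma cut_plane_slit (x : C) (t : R) :
  slit_plane x -> (0 <= t <= 1)%R -> cut_plane (1 - x * t).
Proof.
  intros H Ht; unfold cut_plane; rewrite Im_minus, Re_minus, re_scal_r, im_scal_r, re_RtoC, im_RtoC.
  intros [E1 E2]; apply H.
  assert (t <> 0)%R by (intros ->; lra).
  assert (E3 : (Im x * t = 0)%R) by lra.
  apply Rmult_integral in E3.
  split; [tauto|]; nra.
Qed.

(** Distance from 0 to the segment between 1 and 1-x. *)
Lemma slit_plane_dist (x : C) :
  slit_plane x -> exists m : R, (0 < m)%R /\
    forall t : R, (0 <= t <= 1)%R -> (m <= Cmod (1 - x * t))%R.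
Proof.
  intros H; destruct (Req_dec (Im x) 0) as [E|E].
  - assert (Hx : (Re x < 1)%R) by (apply Rnot_le_lt; intros L; apply H; auto).
    exists (Rmin 1 (1 - Re x)); split; [apply Rmin_pos; lra|].
    intros t Ht; eapply Rle_trans; [|apply re_le_Cmod].
    eapply Rle_trans; [|apply Rle_abs].
    rewrite Re_minus, re_scal_r, re_RtoC.
    assert (M1 := Rmin_l 1 (1 - Re x)); assert (M2 := Rmin_r 1 (1 - Re x)); nra.
  - assert (Hx : x <> 0) by (intros Ex; apply E; rewrite Ex; reflexivity).
    assert (Px : (0 < Cmod x)%R) by (apply Cmod_gt_0, Hx).
    assert (Pi : (0 < Rabs (Im x))%R) by (apply Rabs_pos_lt, E).
    exists (Rabs (Im x) / Cmod x)%R; split; [apply Rdiv_lt_0_compat; auto|].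
    intros t Ht.
    apply Rmult_le_reg_r with (Cmod x); auto.
    unfold Rdiv; rewrite Rmult_assoc, Rinv_l, Rmult_1_r by lra.
    (* Compare with the imaginary part after rotating by the conjugate of x. *)
    rewrite <- (Cmod_conj x), <- Cmod_mult.
    eapply Rle_trans; [|apply Im_le_Cmod].
    rewrite <- (Rabs_Ropp (Im x)); right; f_equal.
    destruct x as [x1 x2]; simpl; ring.
Qed.

Lemma analytic_at_lincomb (f g : C -> C) (al be z : C) :
  analytic_at f z -> analytic_at g z -> analytic_at (fun x => al * f x + be * g x) z.
Proof.
  intros [r1 [s1 [P1 H1]]] [r2 [s2 [P2 H2]]].
  exists (Rmin r1 r2), (fun n => al * s1 n + be * s2 n); split; [apply Rmin_pos; auto|].
  intros w Hw.
  specialize (H1 w ltac:(eapply Rlt_le_trans; [exact Hw|apply Rmin_l])).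
  specialize (H2 w ltac:(eapply Rlt_le_trans; [exact Hw|apply Rmin_r])).
  apply is_pseries_Ccv in H1, H2; apply is_pseries_Ccv.
  apply Ccv_ext with (2 := Ccv_plus _ _ _ _ (Ccv_scal al _ _ H1) (Ccv_scal be _ _ H2)).
  intros n; rewrite <- !Csum_scal, <- Csum_plus; apply Csum_ext; intros; ring.
Qed.

(** Identity theorem on the star-shaped slit plane: vanishing spreads from the
    unit disk along the segment from 0 to x. *)
Lemma identity_theorem (D : C -> C) :
  (forall x, slit_plane x -> analytic_at D x) ->
  (forall x, (Cmod x < 1)%R -> D x = 0) ->
  forall x, slit_plane x -> D x = 0.
Proof.
  intros Ha Hd x Hx.
  destruct (Ceq_dec x 0) as [Ex|Nx]; [apply Hd; rewrite Ex, Cmod_0; lra|].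
  assert (Px : (0 < Cmod x)%R) by (apply Cmod_gt_0, Nx).
  set (E := fun t : R => (0 <= t <= 1)%R /\ forall u, (0 <= u <= t)%R -> D (u * x) = 0).
  destruct (completeness E) as [T [HT1 HT2]].
  { exists 1%R; intros t [Ht _]; lra. }
  { exists 0%R; split; [lra|]; intros u Hu.
    apply Hd; replace u with 0%R by lra; rewrite Cmult_0_l, Cmod_0; lra. }
  assert (T1 : (T <= 1)%R) by (apply HT2; intros t [Ht _]; lra).
  set (t0 := Rmin 1 (/ (2 * Cmod x))).
  assert (P2 : (0 < / (2 * Cmod x))%R) by (apply Rinv_0_lt_compat; lra).
  assert (Pt0 : (0 < t0)%R) by (apply Rmin_pos; lra).
  assert (T0 : (0 < T)%R).
  { apply Rlt_le_trans with t0; auto.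
    apply HT1; split; [split; [lra|apply Rmin_l]|].
    intros u Hu; apply Hd; rewrite Cmod_mult, Cmod_R, Rabs_pos_eq by lra.
    assert (M := Rmin_r 1 (/ (2 * Cmod x))); fold t0 in M.
    apply Rle_lt_trans with (/ (2 * Cmod x) * Cmod x)%R; [apply Rmult_le_compat_r; lra|].
    replace (/ (2 * Cmod x) * Cmod x)%R with (/ 2)%R by (field; lra); lra. }
  assert (Below : forall u, (0 <= u < T)%R -> D (u * x) = 0).
  { intros u Hu.
    destruct (classic (exists t, E t /\ (u < t)%R)) as [[t [[_ Et] Hut]]|N].
    - apply Et; lra.
    - exfalso; assert (T <= u)%R; [|lra].
      apply HT2; intros t Et; apply Rnot_lt_le; intros L; apply N; eauto. }
  destruct (Ha (T * x) (slit_plane_segment x T Hx ltac:(lra))) as [r [s [Pr Hs]]].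
  assert (Z : forall k, s k = 0).
  { set (e1 := (Rmin T (r / (2 * Cmod x)))%R).
    assert (Pe1 : (0 < e1)%R) by (apply Rmin_pos; [lra|apply Rdiv_lt_0_compat; lra]).
    assert (Small : forall e, (0 < e <= e1)%R -> is_pseries s (- (e * x)) (RtoC 0)).
    { intros e He.
      assert (M1 : (e1 <= T)%R) by apply Rmin_l.
      assert (M2 : (e1 <= r / (2 * Cmod x))%R) by apply Rmin_r.
      assert (Er : (Cmod (- (e * x)) < r)%R).
      { rewrite Cmod_opp, Cmod_mult, Cmod_R, Rabs_pos_eq by lra.
        apply Rle_lt_trans with (r / (2 * Cmod x) * Cmod x)%R; [apply Rmult_le_compat_r; lra|].
        replace (r / (2 * Cmod x) * Cmod x)%R with (r / 2)%R by (field; lra); lra. }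
      assert (Q := Hs (RtoC (T - e) * x)).
      replace (RtoC (T - e) * x - T * x) with (- (e * x)) in Q by (rewrite RtoC_minus; ring).
      specialize (Q Er); rewrite Below in Q by lra; exact Q. }
    apply pseries_zero with (w1 := - (e1 * x)) (l1 := RtoC 0).
    - apply Cmod_gt_0; rewrite Cmod_opp, Cmod_mult, Cmod_R, Rabs_pos_eq by lra.
      apply Rmult_lt_0_compat; auto.
    - apply Small; lra.
    - intros e He.
      set (e2 := Rmin e1 (e / (2 * Cmod x))).
      assert (Pe2 : (0 < e2)%R) by (apply Rmin_pos; [lra|apply Rdiv_lt_0_compat; lra]).
      assert (M1 : (e2 <= e1)%R) by apply Rmin_l.
      assert (M2 : (e2 <= e / (2 * Cmod x))%R) by apply Rmin_r.
      assert (Ec : Cmod (- (e2 * x)) = (e2 * Cmod x)%R)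
        by (rewrite Cmod_opp, Cmod_mult, Cmod_R, Rabs_pos_eq by lra; reflexivity).
      exists (- (e2 * x)); repeat split.
      + apply Cmod_gt_0; rewrite Ec; apply Rmult_lt_0_compat; auto.
      + rewrite Ec; apply Rle_lt_trans with (e / (2 * Cmod x) * Cmod x)%R;
          [apply Rmult_le_compat_r; lra|].
        replace (e / (2 * Cmod x) * Cmod x)%R with (e / 2)%R by (field; lra); lra.
      + apply Small; lra. }
  assert (Ball : forall w, (Cmod (w - T * x) < r)%R -> D w = 0).
  { intros w Hw; specialize (Hs w Hw); apply is_pseries_Ccv in Hs.
    apply Ccv_unique with (1 := Hs).
    apply Ccv_ext with (2 := Ccv_const 0); intros n; symmetry; apply Csum_zero.
    intros k _; rewrite Z; ring. }
  destruct (Rlt_le_dec T 1) as [L|L].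
  - exfalso.
    set (e := Rmin (1 - T) (r / (2 * Cmod x))).
    assert (Pe : (0 < e)%R) by (apply Rmin_pos; [lra|apply Rdiv_lt_0_compat; lra]).
    assert (M1 : (e <= 1 - T)%R) by apply Rmin_l.
    assert (M2 : (e <= r / (2 * Cmod x))%R) by apply Rmin_r.
    assert (Q : (T + e <= T)%R); [|lra].
    apply HT1; split; [lra|]; intros u Hu.
    destruct (Rlt_le_dec u T) as [h|h]; [apply Below; lra|].
    apply Ball; replace (u * x - T * x) with (RtoC (u - T) * x) by (rewrite RtoC_minus; ring).
    rewrite Cmod_mult, Cmod_R, Rabs_pos_eq by lra.
    apply Rle_lt_trans with (r / (2 * Cmod x) * Cmod x)%R; [apply Rmult_le_compat_r; lra|].
    replace (r / (2 * Cmod x) * Cmod x)%R with (r / 2)%R by (field; lra); lra.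
  - apply Ball; replace T with 1%R by lra.
    replace (x - 1 * x) with (RtoC 0) by ring; rewrite Cmod_0; auto.
Qed.

Lemma is_hyp2F1_unique (a b c x : C) (F G : C -> C) :
  is_hyp2F1 a b c F -> is_hyp2F1 a b c G -> slit_plane x -> F x = G x.
Proof.
  intros [F1 F2] [G1 G2] Hx; apply Ceq_minus.
  replace (F x - G x) with (1 * F x + (- (1)) * G x) by ring.
  apply (identity_theorem (fun x => 1 * F x + (- (1)) * G x)); auto.
  - intros z Hz; apply analytic_at_lincomb; auto.
  - intros z Hz; specialize (F2 z Hz); specialize (G2 z Hz).
    apply is_pseries_Ccv in F2, G2.
    rewrite (Ccv_unique _ _ _ F2 G2); ring.
Qed.

Lemma hyp2F1_eq (a b c x : C) (F : C -> C) :
  is_hyp2F1 a b c F -> slit_plane x -> hyp2F1 a b c x = F x.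
Proof.
  intros HF Hx; apply is_hyp2F1_unique with (1 := epsilon_spec _ _ (ex_intro _ F HF)); auto.
Qed.

Lemma hyp2F1_spec (a b c : C) :
  (exists F, is_hyp2F1 a b c F) -> is_hyp2F1 a b c (hyp2F1 a b c).
Proof. intros H; apply (epsilon_spec _ _ H). Qed.

(** * Existence of the analytic continuation *)

(** The binomial series in w about x0, with an error bound uniform in t. *)
Lemma pow_expansion (b x0 w : C) (m r : R) :
  (0 < m)%R -> (0 <= r < 1)%R ->
  (forall t, (0 <= t <= 1)%R -> (m <= Cmod (1 - x0 * t))%R) ->
  (Cmod w <= r * m)%R ->
  (forall l, (0 <= l <= 1)%R -> slit_plane (x0 + l * w)) ->
  exists K : R, (0 <= K)%R /\ forall t N, (0 <= t <= 1)%R ->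
    (Cmod (Cpowc (1 - (x0 + w) * t) (- b) -
       Csum (fun k => binc b k * (t ^ k * Cpowc (1 - x0 * t) (- b - INR k)) * w ^ k)%C (S N))
     <= K * bin_err b r N)%R.
Proof.
  intros Hm Hr Hd Hw Hs.
  destruct (binomial_bound b (m * (1 - r)) (1 + Cmod x0 + Cmod w)) as [K [HK B]];
    [apply Rmult_lt_0_compat; lra|].
  exists K; split; auto; intros t N Ht.
  assert (Hp : cut_plane (1 - x0 * t)).
  { apply cut_plane_slit; auto.
    specialize (Hs 0%R ltac:(lra)); replace (x0 + 0 * w) with x0 in Hs by ring; auto. }
  assert (Np := cut_plane_neq0 _ Hp).
  assert (Hpm := Hd t Ht).
  assert (Hwt : (Cmod (w * t) <= r * m)%R).
  { rewrite Cmod_mult, Cmod_R, Rabs_pos_eq by lra; generalize (Cmod_ge_0 w); nra. }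
  assert (Q := B (1 - x0 * t) (- (w * t)) N).
  replace (1 - x0 * t + - (w * t)) with (1 - (x0 + w) * t) in Q by ring.
  rewrite <- Csum_scal in Q.
  rewrite (Csum_ext _ (fun k => binc b k * (t ^ k * Cpowc (1 - x0 * t) (- b - INR k)) * w ^ k)) in Q.
  2:{ intros k _; replace (- b - INR k) with (- b + - INR k) by ring; rewrite Cpowc_plus, (Cpowc_opp _ (INR k)), Cpowc_INR by auto.
      replace (- - (w * t) / (1 - x0 * t)) with (w * (t * / (1 - x0 * t))) by (field; auto).
      rewrite !Cpow_mult_l, Cpow_inv by auto; ring. }
  eapply Rle_trans; [apply Q|].
  - intros l Hl.
    replace (1 - x0 * t + l * - (w * t)) with (1 - (x0 + l * w) * t) by ring.
    split; [apply cut_plane_slit; auto|].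
    replace (1 - (x0 + l * w) * t) with (1 - x0 * t - l * (w * t)) by ring.
    assert (T : (Cmod (l * (w * t)) <= Cmod (w * t))%R).
    { rewrite Cmod_mult, Cmod_R, Rabs_pos_eq by lra; generalize (Cmod_ge_0 (w * t)); nra. }
    split.
    + generalize (Cmod_triangle_inv (1 - x0 * t) (l * (w * t))); lra.
    + eapply Rle_trans; [apply Cmod_triangle_minus|].
      assert (Cmod (1 - x0 * t) <= 1 + Cmod x0)%R.
      { eapply Rle_trans; [apply Cmod_triangle_minus|].
        rewrite Cmod_1, Cmod_mult, Cmod_R, Rabs_pos_eq by lra; generalize (Cmod_ge_0 x0); nra. }
      assert (Cmod (w * t) <= Cmod w)%R.
      { rewrite Cmod_mult, Cmod_R, Rabs_pos_eq by lra; generalize (Cmod_ge_0 w); nra. }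
      lra.
  - apply Rmult_le_compat_l; auto; apply bin_err_le; split; [apply Cmod_ge_0|].
    rewrite Cmod_div, Cmod_opp by auto.
    apply Rmult_le_reg_r with (Cmod (1 - x0 * t)); [lra|].
    unfold Rdiv; rewrite Rmult_assoc, Rinv_l by lra.
    assert (r * m <= r * Cmod (1 - x0 * t))%R by (apply Rmult_le_compat_l; lra). lra.
Qed.

(** The two situations in which the expansion is used: near an arbitrary point
    of the slit plane, and on the whole unit disk about 0. *)
Definition expandable (x0 w : C) : Prop :=
  exists m r : R, (0 < m)%R /\ (0 <= r < 1)%R /\
    (forall t, (0 <= t <= 1)%R -> (m <= Cmod (1 - x0 * t))%R) /\
    (Cmod w <= r * m)%R /\ (forall l, (0 <= l <= 1)%R -> slit_plane (x0 + l * w)).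

(** If m bounds |1-x0 t| from below and |w| <= m/2, then the ratio w t/(1-x0 t) of
    the binomial series is at most 1/2. *)
Lemma expandable_local (x0 : C) :
  slit_plane x0 -> exists r : R, (0 < r)%R /\ forall w, (Cmod w < r)%R -> expandable x0 w.
Proof.
  intros H; destruct (slit_plane_open x0 H) as [r1 [P1 H1]].
  destruct (slit_plane_dist x0 H) as [m [Pm Hm]].
  exists (Rmin r1 (m / 2)); split; [apply Rmin_pos; lra|].
  intros w Hw; exists m, (/ 2)%R.
  assert (M1 := Rmin_l r1 (m / 2)); assert (M2 := Rmin_r r1 (m / 2)).
  repeat split; auto; try lra.
  intros l Hl; apply H1.
  rewrite Cmod_mult, Cmod_R, Rabs_pos_eq by lra; generalize (Cmod_ge_0 w); nra.
Qed.

Lemma expandable_disk (w : C) : (Cmod w < 1)%R -> expandable 0 w.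
Proof.
  intros H; exists 1%R, (Cmod w); repeat split; try lra; [apply Cmod_ge_0| |].
  - intros t _; replace (1 - 0 * t) with (RtoC 1) by ring; rewrite Cmod_1; lra.
  - intros l Hl; apply slit_plane_disk; rewrite Cplus_0_l.
    rewrite Cmod_mult, Cmod_R, Rabs_pos_eq by lra; generalize (Cmod_ge_0 w); nra.
Qed.

Lemma is_hyp2F1_pow (a b : C) :
  ~ nonpos_int a -> is_hyp2F1 a b a (fun x => Cpowc (1 - x) (- b)).
Proof.
  intros Ha.
  assert (G : forall x0 w, expandable x0 w ->
    is_pseries (fun k => binc b k * Cpowc (1 - x0) (- b - INR k)) w (Cpowc (1 - (x0 + w)) (- b))).
  { intros x0 w [m [r [Hm [Hr [Hd [Hw Hs]]]]]].
    destruct (pow_expansion b x0 w m r Hm Hr Hd Hw Hs) as [K [HK B]].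
    apply is_pseries_Ccv, Ccv_decr with 1%nat.
    apply Ccv_le with (fun N => K * bin_err b r N)%R O;
      [|apply is_lim_seq_scal0, bin_err_lim; lra].
    intros N _; rewrite Nat.add_1_r, Cmod_minus_comm.
    specialize (B 1%R N ltac:(lra)).
    rewrite (Csum_ext _ (fun k => binc b k * (RtoC 1 ^ k * Cpowc (1 - x0 * 1) (- b - INR k)) * w ^ k)).
    - replace (1 - (x0 + w)) with (1 - (x0 + w) * 1) by ring; exact B.
    - intros k _; rewrite Cpow_1_l; replace (1 - x0 * 1) with (1 - x0) by ring; ring. }
  split.
  - intros x Hx; destruct (expandable_local x Hx) as [r [Pr Hr]].
    exists r, (fun k => binc b k * Cpowc (1 - x) (- b - INR k)); split; auto.
    intros w Hw; specialize (G x (w - x) (Hr _ Hw)).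
    replace (x + (w - x)) with w in G by ring; exact G.
  - intros x Hx; specialize (G 0 x (expandable_disk x Hx)).
    rewrite Cplus_0_l in G.
    apply is_pseries_Ccv in G; apply is_pseries_Ccv.
    apply Ccv_ext with (2 := G); intros n; apply Csum_ext; intros k _.
    replace (1 - 0) with (RtoC 1) by ring; rewrite Cpowc_base1.
    unfold hyp2F1_coef, binc; field; split; [apply INR_fact_neq0|apply poch_neq0, Ha].
Qed.

Definition euler_int (al s b x : C) : C :=
  CInt (fun t => tpow (al - 1) t * wt s t * Cpowc (1 - x * t) (- b)).

Lemma Ccont_Cpowc_slit (x b : C) (t : R) :
  slit_plane x -> (0 <= t <= 1)%R -> Ccont (fun t => Cpowc (1 - x * t) b) t.
Proof.
  intros Hx Ht; apply Ccont_ext with (fun t => Cpowc (1 + t * - x) b).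
  - intros u; f_equal; ring.
  - eapply Cderiv_Ccont, Cderiv_Cpowc.
    replace (1 + t * - x) with (1 - x * t) by ring; apply cut_plane_slit; auto.
Qed.

Lemma Cmod_beta_integrand (al s : C) (t : R) :
  (2 <= Re al)%R -> (2 <= Re s)%R -> (0 <= t <= 1)%R ->
  (Cmod (tpow (al - 1) t * wt s t) <= 1)%R.
Proof.
  intros Ha Hs Ht; rewrite Cmod_mult.
  assert (H1 := Cmod_wt_le s t ltac:(lra) Ht).
  assert (H2 : (Cmod (tpow (al - 1) t) <= 1)%R).
  { apply (Cmod_tpow_le (al - 1) 0); auto; rewrite Re_minus, re_RtoC; simpl; lra. }
  generalize (Cmod_ge_0 (wt s t)) (Cmod_ge_0 (tpow (al - 1) t)); nra.
Qed.

(** Term-by-term integration of pow_expansion. *)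
Lemma euler_int_pseries (al s b x0 w : C) :
  (2 <= Re al)%R -> (2 <= Re s)%R -> expandable x0 w ->
  is_pseries (fun k => binc b k * CInt (fun t => tpow (al - 1) t * wt s t *
     (t ^ k * Cpowc (1 - x0 * t) (- b - INR k)))) w (euler_int al s b (x0 + w)).
Proof.
  intros Ha Hs [m [r [Hm [Hr [Hd [Hw Hsl]]]]]].
  destruct (pow_expansion b x0 w m r Hm Hr Hd Hw Hsl) as [K [HK B]].
  assert (S0 : slit_plane x0).
  { specialize (Hsl 0%R ltac:(lra)); replace (x0 + 0 * w) with x0 in Hsl by ring; auto. }
  assert (S1 : slit_plane (x0 + w)).
  { specialize (Hsl 1%R ltac:(lra)); replace (x0 + 1 * w) with (x0 + w) in Hsl by ring; auto. }
  set (e := fun (k : nat) t => tpow (al - 1) t * wt s t *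
     (t ^ k * Cpowc (1 - x0 * t) (- b - INR k))).
  assert (Ce : forall k, Ccont01 (e k)).
  { intros k t Ht; unfold e; apply Ccont_mult; [apply Ccont_beta; auto|].
    apply Ccont_mult; [apply Ccont_RtoC_pow|apply Ccont_Cpowc_slit; auto]. }
  assert (Cs : forall N, Ccont01 (fun t => Csum (fun k => binc b k * w ^ k * e k t) N)).
  { intros N t Ht; apply (Ccont_Csum (fun k t => binc b k * w ^ k * e k t)).
    intros k _; apply Ccont_scal, Ce, Ht. }
  assert (Cf : Ccont01 (fun t => tpow (al - 1) t * wt s t * Cpowc (1 - (x0 + w) * t) (- b))).
  { intros t Ht; apply Ccont_mult; [apply Ccont_beta; auto|apply Ccont_Cpowc_slit; auto]. }
  apply is_pseries_Ccv, Ccv_decr with 1%nat.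
  apply Ccv_le with (fun N => 2 * K * bin_err b r N)%R O;
    [|apply is_lim_seq_scal0, bin_err_lim; lra].
  intros N _; rewrite Nat.add_1_r, Cmod_minus_comm.
  rewrite (Csum_ext _ (fun k => CInt (fun t => binc b k * w ^ k * e k t))).
  2:{ intros k _; rewrite CInt_scal by apply Ce; unfold e; ring. }
  rewrite <- (CInt_Csum (fun k t => binc b k * w ^ k * e k t))
    by (intros k _ t Ht; apply Ccont_scal, Ce, Ht).
  unfold euler_int; rewrite <- CInt_minus; auto.
  rewrite Rmult_assoc; apply CInt_bound_const.
  - intros t Ht; apply Ccont_minus; [apply Cf|apply Cs]; auto.
  - intros t Ht.
    rewrite (Csum_ext _ (fun k => (tpow (al - 1) t * wt s t) *
      (binc b k * (t ^ k * Cpowc (1 - x0 * t) (- b - INR k)) * w ^ k)))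
      by (intros k _; unfold e; ring).
    rewrite Csum_scal.
    assert (Ds : forall u v z : C, u * v - u * z = u * (v - z)) by (intros; ring).
    rewrite Ds, Cmod_mult.
    assert (Q := B t N ltac:(lra)).
    assert (W := Cmod_beta_integrand al s t Ha Hs ltac:(lra)).
    rewrite <- (Rmult_1_l (K * _)).
    apply Rmult_le_compat; auto; apply Cmod_ge_0.
Qed.

(** A zero of beta would propagate to all al+k by the recurrence, contradicting
    the nonzero limit Gamma(s). *)
Lemma beta_neq0 (al s : C) : (3 <= Re al)%R -> (2 <= Re s)%R -> beta al s <> 0.
Proof.
  intros Ha Hs E.
  assert (Z : forall k : nat, beta (al + INR k) s = 0).
  { intros k.
    assert (Q := beta_add al s k ltac:(lra) Hs); rewrite E, Cmult_0_r in Q.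
    assert (N : poch (al + s) k <> 0).
    { apply poch_neq0, Re_pos_not_nonpos_int; rewrite re_plus; lra. }
    replace (beta (al + INR k) s) with (/ poch (al + s) k * (poch (al + s) k * beta (al + INR k) s))
      by (field; auto).
    rewrite Q; ring. }
  destruct (CGamma_cv s) as [_ N]; [apply Re_pos_not_nonpos_int; lra|].
  apply N, Ccv_unique with (1 := beta_lim al s 0 Ha Hs).
  apply Ccv_ext with (2 := Ccv_const 0); intros n; rewrite Z; ring.
Qed.

Lemma is_hyp2F1_euler (al s b : C) :
  (3 <= Re al)%R -> (2 <= Re s)%R ->
  is_hyp2F1 al b (al + s) (fun x => euler_int al s b x / beta al s).
Proof.
  intros Ha Hs.
  assert (N := beta_neq0 al s Ha Hs).
  assert (G : forall x0 w, expandable x0 w ->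
    is_pseries (fun k => binc b k * CInt (fun t => tpow (al - 1) t * wt s t *
     (t ^ k * Cpowc (1 - x0 * t) (- b - INR k))) / beta al s) w
     (euler_int al s b (x0 + w) / beta al s)).
  { intros x0 w E; assert (Q := euler_int_pseries al s b x0 w ltac:(lra) Hs E).
    apply is_pseries_Ccv in Q; apply is_pseries_Ccv.
    unfold Cdiv; rewrite Cmult_comm.
    apply Ccv_ext with (2 := Ccv_scal (/ beta al s) _ _ Q).
    intros n; rewrite <- Csum_scal; apply Csum_ext; intros; ring. }
  split.
  - intros x Hx; destruct (expandable_local x Hx) as [r [Pr Hr]].
    exists r; eexists; split; [exact Pr|].
    intros w Hw; specialize (G x (w - x) (Hr _ Hw)).
    replace (x + (w - x)) with w in G by ring; exact G.
  - intros x Hx; specialize (G 0 x (expandable_disk x Hx)).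
    rewrite Cplus_0_l in G.
    apply is_pseries_Ccv in G; apply is_pseries_Ccv.
    apply Ccv_ext with (2 := G); intros n; apply Csum_ext; intros k _; f_equal.
    assert (Np : poch (al + s) k <> 0).
    { apply poch_neq0, Re_pos_not_nonpos_int; rewrite re_plus; lra. }
    rewrite (CInt_ext _ (fun t => tpow (al + INR k - 1) t * wt s t)).
    + fold (beta (al + INR k) s).
      replace (beta (al + INR k) s) with (poch al k * beta al s / poch (al + s) k).
      * unfold hyp2F1_coef, binc; field; repeat split; auto; apply INR_fact_neq0.
      * rewrite <- beta_add by lra; field; auto.
    + intros t Ht; replace (1 - 0 * t) with (RtoC 1) by ring; rewrite Cpowc_base1.
      replace (al + INR k - 1) with (al - 1 + INR k) by ring; rewrite tpow_add; ring.
Qed.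

(** The relation c F(c) = (c-b) F(b;c+1) + b F(b+1;c+1) holds coefficientwise; it
    gives access to denominators for which Euler's integral diverges. *)
Lemma is_hyp2F1_lower (a b c : C) (F G : C -> C) :
  ~ nonpos_int c -> is_hyp2F1 a b (c + 1) F -> is_hyp2F1 a (b + 1) (c + 1) G ->
  is_hyp2F1 a b c (fun x => (c - b) / c * F x + b / c * G x).
Proof.
  intros Hc [F1 F2] [G1 G2]; split.
  - intros x Hx; apply analytic_at_lincomb; auto.
  - intros x Hx; specialize (F2 x Hx); specialize (G2 x Hx).
    apply is_pseries_Ccv in F2, G2; apply is_pseries_Ccv.
    apply Ccv_ext with (2 := Ccv_plus _ _ _ _ (Ccv_scal ((c - b) / c) _ _ F2)
      (Ccv_scal (b / c) _ _ G2)).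
    intros n; rewrite <- !Csum_scal, <- Csum_plus; apply Csum_ext; intros k _.
    unfold hyp2F1_coef.
    assert (N0 := not_nonpos_int_neq0 c Hc).
    assert (N1 := poch_neq0 c k Hc).
    assert (N2 := poch_neq0 (c + 1) k (not_nonpos_int_S c Hc)).
    assert (N3 := not_nonpos_int_plus c k Hc).
    assert (N4 := INR_fact_neq0 k).
    assert (Q := poch_shift b k); assert (Q2 := poch_shift c k).
    replace (b / c * (poch a k * poch (b + 1) k / (poch (c + 1) k * INR (fact k)) * x ^ k))
      with (poch a k * (poch (b + 1) k * b) / (c * (poch (c + 1) k * INR (fact k))) * x ^ k)
      by (field; auto).
    rewrite Q.
    replace (poch (c + 1) k) with (poch c k * (c + INR k) / c) by (rewrite <- Q2; field; auto).
    field; auto.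
Qed.

(** Lowering c repeatedly from a value with Re(c-al) >= 2. *)
Lemma hyp2F1_exists (al b c : C) :
  (3 <= Re al)%R -> ~ nonpos_int c -> exists F, is_hyp2F1 al b c F.
Proof.
  intros Ha.
  assert (G : forall m : nat, forall b c : C, ~ nonpos_int c ->
    (2 - INR m <= Re (c - al))%R -> exists F, is_hyp2F1 al b c F).
  { clear b c; induction m as [|m IH]; intros b c Hc Hm.
    - exists (fun x => euler_int al (c - al) b x / beta al (c - al)).
      replace c with (al + (c - al)) at 1 by ring.
      apply is_hyp2F1_euler; auto; change (INR 0) with 0%R in Hm; lra.
    - assert (Hm' : (2 - INR m <= Re (c + 1 - al))%R).
      { rewrite S_INR, Re_minus in Hm; rewrite Re_minus, re_plus, re_RtoC; lra. }
      destruct (IH b (c + 1) (not_nonpos_int_S c Hc) Hm') as [F HF].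
      destruct (IH (b + 1) (c + 1) (not_nonpos_int_S c Hc) Hm') as [F' HF'].
      eexists; apply is_hyp2F1_lower; eauto. }
  intros Hc.
  destruct (nfloor_ex (Rabs (2 - Re (c - al))) (Rabs_pos _)) as [m Hm].
  apply (G (S m)); auto.
  rewrite S_INR; generalize (Rle_abs (2 - Re (c - al))); lra.
Qed.

(** * The coefficients of the expansion *)

Definition conv (f g : nat -> C) (n : nat) : C := Csum (fun k => f k * g (n - k)%nat) (S n).

Lemma conv_0 (f g : nat -> C) : conv f g 0 = f O * g O.
Proof. unfold conv; simpl; ring. Qed.

Lemma conv_sub_r (f g g1 g2 : nat -> C) (n : nat) :
  g 0%nat = g1 0%nat -> (forall j, g (S j) = g1 (S j) - g2 j) ->
  conv f g (S n) = conv f g1 (S n) - conv f g2 n.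
Proof.
  intros E0 ES; unfold conv.
  rewrite (Csum_S _ (S n)), (Csum_S (fun k => f k * g1 (S n - k)%nat) (S n)), Nat.sub_diag, E0.
  rewrite (Csum_ext _ (fun k => f k * g1 (S n - k)%nat - f k * g2 (n - k)%nat) (S n)).
  - rewrite Csum_minus; ring.
  - intros k Hk; replace (S n - k)%nat with (S (n - k)) by lia; rewrite ES; ring.
Qed.

Lemma conv_sub_l (f f1 f2 g : nat -> C) (n : nat) :
  f 0%nat = f1 0%nat -> (forall j, f (S j) = f1 (S j) - f2 j) ->
  conv f g (S n) = conv f1 g (S n) - conv f2 g n.
Proof.
  intros E0 ES; unfold conv.
  rewrite (Csum_S_l _ (S n)), (Csum_S_l (fun k => f1 k * g (S n - k)%nat) (S n)), E0.
  rewrite (Csum_ext _ (fun k => f1 (S k) * g (S n - S k)%nat - f2 k * g (n - k)%nat) (S n)).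
  - rewrite Csum_minus; ring.
  - intros k Hk; rewrite ES; simpl; ring.
Qed.

(** Product rule for generating functions. *)
Lemma conv_deriv (f f' g g' : nat -> C) (n : nat) :
  (forall k, INR (S k) * f (S k) = f' k) -> (forall k, INR (S k) * g (S k) = g' k) ->
  INR (S n) * conv f g (S n) = conv f' g n + conv f g' n.
Proof.
  intros Hf Hg.
  assert (E : INR (S n) * conv f g (S n) =
    Csum (fun k => INR k * f k * g (S n - k)%nat) (S (S n)) +
    Csum (fun k => f k * (INR (S n - k) * g (S n - k)%nat)) (S (S n))).
  { unfold conv; rewrite <- Csum_scal, <- Csum_plus; apply Csum_ext; intros k Hk.
    replace (INR (S n)) with (INR (k + (S n - k))) by (f_equal; lia).
    rewrite RtoC_INR_plus; ring. }
  rewrite E; unfold conv; f_equal.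
  - rewrite Csum_S_l.
    rewrite (Csum_ext (fun k => INR (S k) * _ * _) (fun k => f' k * g (n - k)%nat)).
    + simpl; ring.
    + intros k Hk; rewrite Hf; reflexivity.
  - rewrite Csum_S, Nat.sub_diag.
    rewrite (Csum_ext _ (fun k => f k * g' (n - k)%nat)).
    + simpl; ring.
    + intros k Hk; replace (S n - k)%nat with (S (n - k)) by lia; rewrite Hg; reflexivity.
Qed.

Lemma conv_scal_l (z : C) (f g : nat -> C) (n : nat) :
  conv (fun k => z * f k) g n = z * conv f g n.
Proof. unfold conv; rewrite <- Csum_scal; apply Csum_ext; intros; ring. Qed.

Lemma conv_scal_r (z : C) (f g : nat -> C) (n : nat) :
  conv f (fun k => z * g k) n = z * conv f g n.
Proof. unfold conv; rewrite <- Csum_scal; apply Csum_ext; intros; ring. Qed.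

Lemma binc_S_shift (b : C) (k : nat) : INR (S k) * binc b (S k) = b * binc (b + 1) k.
Proof.
  unfold binc; rewrite poch_S_l, RtoC_fact_S; field.
  split; [apply INR_fact_neq0|apply INR_S_neq0].
Qed.

Lemma binc_pascal (b : C) (k : nat) : binc b (S k) = binc (b + 1) (S k) - binc (b + 1) k.
Proof.
  unfold binc; rewrite (poch_S_l b), RtoC_fact_S; simpl poch; rewrite RtoC_INR_S; field.
  split; [apply INR_fact_neq0|rewrite <- RtoC_INR_S; apply INR_S_neq0].
Qed.

(** Taylor coefficients in u of (1-u)^(a-1) (1-x(1-u))^(-b), the Euler integrand
    of 2F1 read at the endpoint t = 1-u = 1. *)
Definition gcoef (a b x : C) (n : nat) : C :=
  Cpowc (1 - x) (- b) * conv (fun k => binc b k * (x / (x - 1)) ^ k) (binc (1 - a)) n.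

Lemma gcoef_0 (a b x : C) : gcoef a b x 0 = Cpowc (1 - x) (- b).
Proof. unfold gcoef; rewrite conv_0, !binc_0; simpl; ring. Qed.

(** Multiplication of the generating function by 1-u. *)
Lemma gcoef_raise (a b x : C) (n : nat) :
  gcoef (a + 1) b x (S n) = gcoef a b x (S n) - gcoef a b x n.
Proof.
  unfold gcoef; rewrite (conv_sub_r _ _ (binc (1 - a)) (binc (1 - a))).
  - ring.
  - rewrite !binc_0; reflexivity.
  - intros j; rewrite binc_pascal; replace (1 - (a + 1) + 1) with (1 - a) by ring; reflexivity.
Qed.

(** Differentiation of (1-u)^a (1-x(1-u))^(-b), using x(1-u) = 1-(1-x(1-u)) to
    eliminate x. *)
Lemma gcoef_deriv (a b x : C) (n : nat) :
  1 - x <> 0 ->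
  INR (S n) * gcoef (a + 1) b x (S n) = - (a - b) * gcoef a b x n - b * gcoef a (b + 1) x n.
Proof.
  intros Hx.
  assert (Hx' : x - 1 <> 0) by (intros E; apply Hx; replace (1 - x) with (- (x - 1)) by ring;
    rewrite E; ring).
  set (z := x / (x - 1)).
  set (fb := fun k => binc b k * z ^ k); set (fb1 := fun k => binc (b + 1) k * z ^ k).
  assert (E1 : INR (S n) * conv fb (binc (1 - (a + 1))) (S n) =
    b * z * conv fb1 (binc (1 - (a + 1))) n - a * conv fb (binc (1 - a)) n).
  { rewrite (conv_deriv fb (fun k => b * z * fb1 k) _ (fun k => - a * binc (1 - a) k)).
    - rewrite conv_scal_l, conv_scal_r; ring.
    - intros k; unfold fb, fb1; rewrite Cpow_S.
      replace (INR (S k) * (binc b (S k) * (z * z ^ k)))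
        with (INR (S k) * binc b (S k) * (z * z ^ k)) by ring.
      rewrite binc_S_shift; ring.
    - intros k; rewrite binc_S_shift.
      replace (1 - (a + 1) + 1) with (1 - a) by ring; ring. }
  assert (E2 : z * conv fb1 (binc (1 - (a + 1))) n =
    conv fb (binc (1 - a)) n - / (1 - x) * conv fb1 (binc (1 - a)) n).
  { assert (Ez : z = 1 - / (1 - x)) by (unfold z; field; auto).
    destruct n as [|n].
    - rewrite !conv_0; unfold fb, fb1; rewrite !binc_0; rewrite Ez; simpl; ring.
    - rewrite (conv_sub_r fb1 _ (binc (1 - a)) (binc (1 - a))).
      + rewrite (conv_sub_l fb fb1 (fun k => z * fb1 k)).
        * rewrite conv_scal_l.
          replace (/ (1 - x)) with (1 - z) by (rewrite Ez; ring); ring.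
        * unfold fb, fb1; rewrite !binc_0; reflexivity.
        * intros j; unfold fb, fb1; rewrite binc_pascal, Cpow_S; ring.
      + rewrite !binc_0; reflexivity.
      + intros j; rewrite binc_pascal; replace (1 - (a + 1) + 1) with (1 - a) by ring; reflexivity. }
  unfold gcoef; fold z; fold fb; fold fb1.
  replace (- (b + 1)) with (- b + - (1)) by ring.
  rewrite Cpowc_plus, (Cpowc_opp _ 1), Cpowc_1 by auto.
  replace (INR (S n) * (Cpowc (1 - x) (- b) * conv fb (binc (1 - (a + 1))) (S n)))
    with (Cpowc (1 - x) (- b) * (INR (S n) * conv fb (binc (1 - (a + 1))) (S n))) by ring.
  rewrite E1.
  replace (b * z * conv fb1 (binc (1 - (a + 1))) n)
    with (b * (z * conv fb1 (binc (1 - (a + 1))) n)) by ring.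
  rewrite E2; ring.
Qed.

Lemma poch_neg_INR (n k : nat) :
  (k <= n)%nat -> (- (1)) ^ k * poch (- INR n) k * INR (fact (n - k)) = INR (fact n).
Proof.
  induction k as [|k IH]; intros Hk; [rewrite Nat.sub_0_r; simpl; ring|].
  rewrite <- IH by lia.
  replace (n - k)%nat with (S (n - S k)) by lia.
  rewrite RtoC_fact_S, Cpow_S; simpl poch.
  replace (INR n) with (INR (k + S (n - S k))) by (f_equal; lia).
  rewrite RtoC_INR_plus; ring.
Qed.

Lemma gcoef_fact_sum (a b x : C) (n : nat) :
  INR (fact n) * gcoef a b x n =
  Cpowc (1 - x) (- b) *
    sum_n (fun k : nat =>
      (- (1)) ^ k * (poch (- INR n) k * poch b k / INR (fact k))
      * poch (1 - a) (n - k) * (x / (x - 1)) ^ k) n.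
Proof.
  rewrite sum_n_Csum; unfold gcoef, conv.
  rewrite Cmult_assoc, (Cmult_comm (INR (fact n))), <- Cmult_assoc; f_equal.
  rewrite <- Csum_scal; apply Csum_ext; intros k Hk.
  rewrite <- (poch_neg_INR n k) by lia; unfold binc; field.
  split; apply INR_fact_neq0.
Qed.

(** Starting from 2F1[a,b;a;x] = (1-x)^(-b), the relation lowering the
    denominator parameter produces every 2F1[a,b;a-n;x] in closed form. *)
Lemma hyp2F1_sub_INR (a : C) (n : nat) :
  ~ nonpos_int a -> ~ pos_int a ->
  forall b, exists F, is_hyp2F1 a b (a - INR n) F /\
    forall x, slit_plane x -> poch (1 - a) n * F x = INR (fact n) * gcoef a b x n.
Proof.
  intros Ha Hp; induction n as [|n IH]; intros b.
  - exists (fun x => Cpowc (1 - x) (- b)); split.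
    + replace (a - INR 0) with a by (simpl; ring); apply is_hyp2F1_pow, Ha.
    + intros x _; rewrite gcoef_0; simpl; ring.
  - destruct (IH b) as [F [HF EF]]; destruct (IH (b + 1)) as [G [HG EG]].
    set (c := a - INR (S n)).
    assert (Ec : a - INR n = c + 1) by (unfold c; rewrite RtoC_INR_S; ring).
    rewrite Ec in HF, HG.
    assert (Hc : ~ nonpos_int c).
    { intros [k Ek].
      assert (Ea : a = RtoC (INR (S n) - INR k)).
      { rewrite RtoC_minus; rewrite RtoC_opp in Ek; unfold c in Ek.
        replace a with (a - INR (S n) + INR (S n)) by ring; rewrite Ek; ring. }
      destruct (Nat.le_gt_cases (S n) k) as [h|h].
      - apply Ha; exists (k - S n)%nat; rewrite Ea; f_equal; rewrite minus_INR by auto; ring.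
      - apply Hp; exists (n - k)%nat; rewrite Ea; f_equal.
        rewrite <- minus_INR by lia; f_equal; lia. }
    assert (Nc := not_nonpos_int_neq0 c Hc).
    exists (fun x => (c - b) / c * F x + b / c * G x); split.
    + apply is_hyp2F1_lower; auto.
    + intros x Hx; specialize (EF x Hx); specialize (EG x Hx).
      assert (N1 : 1 - x <> 0).
      { replace (1 - x) with (1 - x * 1) by ring.
        apply cut_plane_neq0, cut_plane_slit; auto; lra. }
      assert (I2 := gcoef_deriv a b x n N1); rewrite gcoef_raise in I2.
      assert (Ep : poch (1 - a) (S n) = - c * poch (1 - a) n).
      { simpl; unfold c; rewrite RtoC_INR_S; ring. }
      rewrite Ep.
      replace (- c * poch (1 - a) n * ((c - b) / c * F x + b / c * G x))
        with (- ((c - b) * (poch (1 - a) n * F x) + b * (poch (1 - a) n * G x)))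
        by (field; auto).
      rewrite EF, EG, RtoC_fact_S.
      assert (I3 : INR (S n) * gcoef a b x (S n) =
        - (a - b) * gcoef a b x n - b * gcoef a (b + 1) x n + INR (S n) * gcoef a b x n)
        by (rewrite <- I2; ring).
      replace (INR (S n) * INR (fact n) * gcoef a b x (S n))
        with (INR (fact n) * (INR (S n) * gcoef a b x (S n))) by ring.
      rewrite I3; unfold c; ring.
Qed.

Lemma poch_hyp2F1_gcoef (a b x : C) (n : nat) :
  ~ nonpos_int a -> slit_plane x -> poch_hyp2F1 a b x n = INR (fact n) * gcoef a b x n.
Proof.
  intros Ha Hx; unfold poch_hyp2F1.
  destruct (excluded_middle_informative (pos_int a)) as [Hp|Hp].
  - symmetry; apply gcoef_fact_sum.
  - destruct (hyp2F1_sub_INR a n Ha Hp b) as [F [HF EF]].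
    rewrite (hyp2F1_eq _ _ _ x F HF Hx); auto.
Qed.

(** * Taylor's formula for the Euler integrand *)

Lemma Csum_bounded {T : Type} (P : T -> Prop) (h : nat -> T -> C) (n : nat) :
  (forall k, exists K : R, (0 <= K)%R /\ forall u, P u -> (Cmod (h k u) <= K)%R) ->
  exists K : R, (0 <= K)%R /\ forall u, P u -> (Cmod (Csum (fun k => h k u) n) <= K)%R.
Proof.
  intros H; induction n as [|n [K [HK IH]]].
  - exists 0%R; split; [lra|]; intros u _; simpl; rewrite Cmod_0; lra.
  - destruct (H n) as [K' [HK' H']]; exists (K + K')%R; split; [lra|].
    intros u Hu; rewrite Csum_S; eapply Rle_trans; [apply Cmod_triangle|].
    generalize (IH u Hu) (H' u Hu); lra.
Qed.

(** Both sides grow by the same diagonal when N increases by one. *)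
Lemma conv_rearrange (f g : nat -> C) (u : C) (N : nat) :
  Csum (fun k => f k * u ^ k * Csum (fun j => g j * u ^ j) (N - k)) N =
  Csum (fun n => conv f g n * u ^ n) N.
Proof.
  induction N as [|N IH]; [reflexivity|].
  rewrite (Csum_S (fun n => conv f g n * u ^ n)), <- IH.
  rewrite (Csum_ext _ (fun k => f k * u ^ k * Csum (fun j => g j * u ^ j) (N - k) +
     u ^ N * (f k * g (N - k)%nat)) (S N)).
  - rewrite Csum_plus, Csum_scal; fold (conv f g N).
    rewrite (Csum_S _ N), Nat.sub_diag; simpl; ring.
  - intros k Hk; replace (S N - k)%nat with (S (N - k)) by lia; rewrite Csum_S.
    replace (u ^ N) with (u ^ (k + (N - k))) by (f_equal; lia).
    rewrite Cpow_add_r; ring.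
Qed.

Lemma Cmod_RtoC_pow_le1 (u : R) (k : nat) : (0 <= u <= 1)%R -> (Cmod (RtoC u ^ k) <= 1)%R.
Proof.
  intros Hu; rewrite Cmod_pow, Cmod_R, Rabs_pos_eq by lra.
  rewrite <- (pow1 k); apply pow_incr; lra.
Qed.

Lemma poly_bounded (g : nat -> C) (n : nat) :
  exists K : R, (0 <= K)%R /\ forall u : R, (0 <= u <= 1)%R ->
    (Cmod (Csum (fun k => g k * RtoC u ^ k)%C n) <= K)%R.
Proof.
  apply (Csum_bounded (fun u : R => (0 <= u <= 1)%R) (fun k u => g k * RtoC u ^ k)).
  intros k; exists (Cmod (g k)); split; [apply Cmod_ge_0|].
  intros u Hu; rewrite Cmod_mult.
  generalize (Cmod_RtoC_pow_le1 u k Hu) (Cmod_ge_0 (g k)); nra.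
Qed.

(** Only products of total degree at least N distinguish the two sides. *)
Lemma poly_prod_bound (f g : nat -> C) (N : nat) :
  exists K : R, (0 <= K)%R /\ forall u : R, (0 <= u <= 1)%R ->
    (Cmod (Csum (fun k => f k * RtoC u ^ k)%C N * Csum (fun k => g k * RtoC u ^ k)%C N -
       Csum (fun n => conv f g n * RtoC u ^ n)%C N) <= K * u ^ N)%R.
Proof.
  set (h := fun k (u : R) => f k * Csum (fun j => g (N - k + j)%nat * RtoC u ^ j) (Nat.min k N)).
  destruct (Csum_bounded (fun u : R => (0 <= u <= 1)%R) h N) as [K [HK B]].
  { intros k; destruct (poly_bounded (fun j => g (N - k + j)%nat) (Nat.min k N)) as [K [HK B]].
    exists (Cmod (f k) * K)%R; split; [apply Rmult_le_pos; auto; apply Cmod_ge_0|].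
    intros u Hu; unfold h; rewrite Cmod_mult; apply Rmult_le_compat_l; auto; apply Cmod_ge_0. }
  exists K; split; auto; intros u Hu.
  rewrite <- conv_rearrange.
  replace (_ - _) with (RtoC u ^ N * Csum (fun k => h k u) N).
  - rewrite Cmod_mult, Cmod_pow, Cmod_R, Rabs_pos_eq, Rmult_comm by lra.
    apply Rmult_le_compat_r; auto; apply pow_le; lra.
  - rewrite (Cmult_comm (Csum (fun k => f k * RtoC u ^ k) N)), <- !Csum_scal, <- Csum_minus.
    apply Csum_ext; intros k Hk; unfold h.
    rewrite Nat.min_l by lia.
    replace (Csum (fun j => g j * RtoC u ^ j) N)
      with (Csum (fun j => g j * RtoC u ^ j) (N - k + k)) by (f_equal; lia).
    rewrite Csum_add.
    rewrite (Csum_ext (fun j => g (N - k + j)%nat * RtoC u ^ (N - k + j))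
      (fun j => RtoC u ^ (N - k) * (g (N - k + j)%nat * RtoC u ^ j)))
      by (intros; rewrite Cpow_add_r; ring).
    rewrite Csum_scal.
    replace (RtoC u ^ N) with (RtoC u ^ (k + (N - k))) by (f_equal; lia).
    rewrite Cpow_add_r; ring.
Qed.

Lemma bin_err_homog (b : C) (r u : R) (N : nat) :
  bin_err b (r * u) N = (bin_err b r N * u ^ S N)%R.
Proof. unfold bin_err; rewrite Rpow_mult_distr; ring. Qed.

(** The bound u <= 1/2 keeps the base 1-u away from the branch point 0. *)
Lemma taylor_left_factor (a : C) (N : nat) :
  exists K : R, (0 <= K)%R /\ forall u : R, (0 <= u <= / 2)%R ->
    (Cmod (tpow (a - 1) (1 - u) - Csum (fun k => binc (1 - a) k * RtoC u ^ k)%C (S N))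
      <= K * u ^ S N)%R.
Proof.
  destruct (binomial_bound (1 - a) (/ 2) 1 ltac:(lra)) as [K [HK B]].
  exists (K * bin_err (1 - a) 1 N)%R; split; [apply Rmult_le_pos; auto; apply bin_err_pos; lra|].
  intros u Hu.
  assert (Q := B 1 (- u) N).
  replace (tpow (a - 1) (1 - u)) with (Cpowc (1 + - u) (- (1 - a))).
  2:{ rewrite tpow_Cpowc by lra; rewrite RtoC_minus; f_equal; ring. }
  rewrite Cpowc_base1, Cmult_1_l in Q.
  rewrite (Csum_ext _ (fun k => binc (1 - a) k * RtoC u ^ k)) in Q
    by (intros; do 2 f_equal; field).
  eapply Rle_trans; [apply Q|].
  - intros l Hl.
    replace (1 + l * - u) with (RtoC (1 - l * u)) by (rewrite RtoC_minus, RtoC_mult; ring).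
    assert (0 <= l * u <= / 2)%R by (split; nra).
    split; [apply cut_plane_RtoC_pos; lra|].
    rewrite Cmod_R, Rabs_pos_eq; lra.
  - replace (Cmod (- u / 1)) with (1 * u)%R.
    + rewrite bin_err_homog; right; ring.
    + replace (- u / 1) with (- RtoC u) by field.
      rewrite Cmod_opp, Cmod_R, Rabs_pos_eq; lra.
Qed.

Lemma slit_plane_1_sub (x : C) : slit_plane x -> 1 - x <> 0.
Proof.
  intros Hx; replace (1 - x) with (1 - x * 1) by ring.
  apply cut_plane_neq0, cut_plane_slit; auto; lra.
Qed.

Lemma Cmod_1_sub_le (x : C) (t : R) :
  (0 <= t <= 1)%R -> (Cmod (1 - x * t) <= 1 + Cmod x)%R.
Proof.
  intros Ht; eapply Rle_trans; [apply Cmod_triangle_minus|].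
  rewrite Cmod_1, Cmod_mult, Cmod_R, Rabs_pos_eq by lra; generalize (Cmod_ge_0 x); nra.
Qed.

Lemma taylor_right_factor (b x : C) (N : nat) :
  slit_plane x ->
  exists K : R, (0 <= K)%R /\ forall u : R, (0 <= u <= 1)%R ->
    (Cmod (Cpowc (1 - x * (1 - u)%R) (- b) - Cpowc (1 - x) (- b) *
       Csum (fun k => binc b k * (x / (x - 1)) ^ k * RtoC u ^ k)%C (S N)) <= K * u ^ S N)%R.
Proof.
  intros Hx; destruct (slit_plane_dist x Hx) as [m [Hm Hd]].
  assert (N1 := slit_plane_1_sub x Hx).
  assert (N2 : x - 1 <> 0) by (intros E; apply N1; replace (1 - x) with (- (x - 1)) by ring;
    rewrite E; ring).
  destruct (binomial_bound b m (1 + Cmod x) Hm) as [K [HK B]].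
  exists (K * bin_err b (Cmod (x / (1 - x))) N)%R; split;
    [apply Rmult_le_pos; auto; apply bin_err_pos, Cmod_ge_0|].
  intros u Hu.
  assert (Q := B (1 - x) (x * u) N).
  replace (1 - x * (1 - u)%R) with (1 - x + x * u) by (rewrite RtoC_minus; ring).
  rewrite (Csum_ext _ (fun k => binc b k * (x / (x - 1)) ^ k * RtoC u ^ k)) in Q.
  2:{ intros k _; rewrite <- Cmult_assoc, <- Cpow_mult_l; do 2 f_equal; field; auto. }
  eapply Rle_trans; [apply Q|].
  - intros l Hl.
    assert (Hlu : (0 <= 1 - l * u <= 1)%R) by (split; nra).
    replace (1 - x + l * (x * u)) with (1 - x * (1 - l * u)%R)
      by (rewrite RtoC_minus, RtoC_mult; ring).
    split; [apply cut_plane_slit; auto|split; [apply Hd; auto|apply Cmod_1_sub_le; auto]].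
  - replace (Cmod (x * u / (1 - x))) with (Cmod (x / (1 - x)) * u)%R.
    + rewrite bin_err_homog; right; ring.
    + replace (x * u / (1 - x)) with (x / (1 - x) * u) by (field; auto).
      rewrite Cmod_mult, (Cmod_R u), Rabs_pos_eq; lra.
Qed.

(** t^n0 times the Taylor remainder of t^(a-1) (1-xt)^(-b) at t = 1; the factor
    t^n0 makes it bounded at t = 0 once n0 is large, even when Re a <= 0. *)
Definition euler_rem (a b x : C) (n0 K : nat) (t : R) : C :=
  tpow (a + INR n0 - 1) t * Cpowc (1 - x * t) (- b) -
  RtoC t ^ n0 * Csum (fun k => gcoef a b x k * RtoC (1 - t) ^ k) K.

(** For t >= 1/2 this is Taylor's formula for a product; for t <= 1/2 the factor
    1-t is at least 1/2 and boundedness suffices. *)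
Lemma euler_rem_bound (a b x : C) (n0 N : nat) :
  slit_plane x -> (1 <= Re (a + INR n0))%R ->
  exists K : R, (0 <= K)%R /\ forall t : R, (0 < t < 1)%R ->
    (Cmod (euler_rem a b x n0 (S N) t) <= K * (1 - t) ^ S N)%R.
Proof.
  intros Hx Ha.
  destruct (taylor_left_factor a N) as [K1 [P1 B1]].
  destruct (taylor_right_factor b x N Hx) as [K2 [P2 B2]].
  set (fL := binc (1 - a)); set (fR := fun k => binc b k * (x / (x - 1)) ^ k).
  destruct (poly_prod_bound fR fL (S N)) as [K3 [P3 B3]].
  destruct (poly_bounded fL (S N)) as [K4 [P4 B4]].
  destruct (poly_bounded (gcoef a b x) (S N)) as [K5 [P5 B5]].
  destruct (slit_plane_dist x Hx) as [m [Hm Hd]].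
  set (K6 := exp (Cmod (- b) * (Rabs (ln m) + Rabs (ln (1 + Cmod x)) + PI))).
  assert (P6 : (0 < K6)%R) by apply exp_pos.
  assert (B6 : forall t, (0 <= t <= 1)%R -> (Cmod (Cpowc (1 - x * t) (- b)) <= K6)%R).
  { intros t Ht; apply Cmod_Cpowc_le; auto; split; [apply Hd|apply Cmod_1_sub_le]; auto. }
  set (p0 := Cpowc (1 - x) (- b)).
  assert (Pp := Cmod_ge_0 p0).
  set (Kn := (K6 * K1 + K4 * K2 + Cmod p0 * K3)%R).
  set (Kf := ((K6 + K5) * 2 ^ S N)%R).
  assert (P2N : (0 < 2 ^ S N)%R) by (apply pow_lt; lra).
  assert (PKn : (0 <= Kn)%R).
  { unfold Kn; assert (0 <= K6 * K1)%R by (apply Rmult_le_pos; lra).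
    assert (0 <= K4 * K2)%R by (apply Rmult_le_pos; lra).
    assert (0 <= Cmod p0 * K3)%R by (apply Rmult_le_pos; lra). lra. }
  assert (PKf : (0 <= Kf)%R) by (unfold Kf; apply Rmult_le_pos; lra).
  exists (Kn + Kf)%R; split; [lra|]; intros t Ht.
  set (u := (1 - t)%R).
  assert (Pu : (0 <= u ^ S N)%R) by (apply pow_le; unfold u; lra).
  destruct (Rle_dec (/ 2) t) as [h|h].
  - assert (Hu : (0 <= u <= / 2)%R) by (unfold u; lra).
    assert (Hu1 : (0 <= u <= 1)%R) by lra.
    assert (Et : t = (1 - u)%R) by (unfold u; ring).
    specialize (B1 u Hu); specialize (B2 u Hu1); specialize (B3 u Hu1); specialize (B4 u Hu1).
    specialize (B6 t ltac:(lra)).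
    rewrite <- Et in B1, B2.
    assert (E : euler_rem a b x n0 (S N) t = RtoC t ^ n0 *
      (Cpowc (1 - x * t) (- b) * (tpow (a - 1) t - Csum (fun k => fL k * RtoC u ^ k) (S N)) +
       Csum (fun k => fL k * RtoC u ^ k) (S N) * (Cpowc (1 - x * t) (- b) - p0 *
          Csum (fun k => fR k * RtoC u ^ k) (S N)) +
       p0 * (Csum (fun k => fR k * RtoC u ^ k) (S N) * Csum (fun k => fL k * RtoC u ^ k) (S N) -
         Csum (fun n => conv fR fL n * RtoC u ^ n) (S N)))).
    { unfold euler_rem; replace (a + INR n0 - 1) with (a - 1 + INR n0) by ring.
      rewrite tpow_add; fold u.
      rewrite (Csum_ext (fun k => gcoef a b x k * RtoC u ^ k)
        (fun k => p0 * (conv fR fL k * RtoC u ^ k))).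
      - rewrite Csum_scal; ring.
      - intros k _; unfold gcoef; fold fL fR p0; ring. }
    rewrite E, Cmod_mult.
    assert (T1 := Cmod_RtoC_pow_le1 t n0 ltac:(lra)).
    assert (T2 : (Cmod (Cpowc (1 - x * t) (- b) * (tpow (a - 1) t - Csum (fun k => fL k * RtoC u ^ k) (S N)) +
       Csum (fun k => fL k * RtoC u ^ k) (S N) * (Cpowc (1 - x * t) (- b) - p0 *
          Csum (fun k => fR k * RtoC u ^ k) (S N)) +
       p0 * (Csum (fun k => fR k * RtoC u ^ k) (S N) * Csum (fun k => fL k * RtoC u ^ k) (S N) -
         Csum (fun n => conv fR fL n * RtoC u ^ n) (S N)))%C <= Kn * u ^ S N)%R).
    { eapply Rle_trans; [apply Cmod_triangle|].
      eapply Rle_trans; [apply Rplus_le_compat_r, Cmod_triangle|].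
      rewrite !(Cmod_mult _ (_ - _)).
      unfold Kn; rewrite !Rmult_plus_distr_r, !Rmult_assoc.
      apply Rplus_le_compat; [apply Rplus_le_compat|];
        apply Rmult_le_compat; auto; try apply Cmod_ge_0; lra. }
    assert (T3 : (0 <= Kf * u ^ S N)%R) by (apply Rmult_le_pos; auto).
    eapply Rle_trans; [apply Rmult_le_compat_r; [apply Cmod_ge_0|exact T1]|].
    lra.
  - assert (Hu : (/ 2 <= u <= 1)%R) by (unfold u; lra).
    assert (T0 : (Cmod (euler_rem a b x n0 (S N) t) <= K6 + K5)%R).
    { unfold euler_rem; fold u; eapply Rle_trans; [apply Cmod_triangle_minus|].
      rewrite !Cmod_mult.
      assert (T1 := Cmod_RtoC_pow_le1 t n0 ltac:(lra)).
      assert (T2 : (Cmod (tpow (a + INR n0 - 1) t) <= 1)%R).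
      { apply (Cmod_tpow_le _ 0); [|lra]; rewrite Re_minus, re_RtoC; simpl INR; lra. }
      specialize (B5 u ltac:(lra)); specialize (B6 t ltac:(lra)).
      rewrite <- (Rmult_1_l K6), <- (Rmult_1_l K5).
      apply Rplus_le_compat; apply Rmult_le_compat; auto; apply Cmod_ge_0. }
    assert (T1 : (1 <= 2 ^ S N * u ^ S N)%R).
    { rewrite <- Rpow_mult_distr; apply pow_R1_Rle; lra. }
    assert (T2 : (K6 + K5 <= Kf * u ^ S N)%R).
    { unfold Kf; rewrite Rmult_assoc; rewrite <- (Rmult_1_r (K6 + K5)) at 1.
      apply Rmult_le_compat_l; lra. }
    assert (T3 : (0 <= Kn * u ^ S N)%R) by (apply Rmult_le_pos; auto).
    lra.
Qed.

(** * Order estimates in a sector *)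

(** N counts powers of 1/y; kap stands for the sine of the angle between the
    sector and the imaginary axis. *)
Definition bigO (kap : R) (N : nat) (h : C -> C) : Prop :=
  exists K : R, (0 <= K)%R /\ forall y : C, (1 <= Cmod y)%R -> (kap * Cmod y <= Re y)%R ->
    (Cmod (h y) <= K * / Cmod y ^ N)%R.

Lemma bigO_ext (kap : R) (N : nat) (h1 h2 : C -> C) :
  (forall y, (1 <= Cmod y)%R -> h1 y = h2 y) -> bigO kap N h1 -> bigO kap N h2.
Proof.
  intros E [K [HK B]]; exists K; split; auto; intros y H1 H2; rewrite <- E; auto.
Qed.

Lemma bigO_plus (kap : R) (N : nat) (h1 h2 : C -> C) :
  bigO kap N h1 -> bigO kap N h2 -> bigO kap N (fun y => h1 y + h2 y).
Proof.
  intros [K1 [P1 B1]] [K2 [P2 B2]]; exists (K1 + K2)%R; split; [lra|].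
  intros y H1 H2; eapply Rle_trans; [apply Cmod_triangle|].
  rewrite Rmult_plus_distr_r; apply Rplus_le_compat; auto.
Qed.

Lemma bigO_scal (kap : R) (N : nat) (z : C) (h : C -> C) :
  bigO kap N h -> bigO kap N (fun y => z * h y).
Proof.
  intros [K [P B]]; exists (Cmod z * K)%R; split; [apply Rmult_le_pos; auto; apply Cmod_ge_0|].
  intros y H1 H2; rewrite Cmod_mult, Rmult_assoc; apply Rmult_le_compat_l; auto; apply Cmod_ge_0.
Qed.

Lemma bigO_Csum (kap : R) (N : nat) (h : nat -> C -> C) (n : nat) :
  (forall k, (k < n)%nat -> bigO kap N (h k)) -> bigO kap N (fun y => Csum (fun k => h k y) n).
Proof.
  induction n as [|n IH]; intros H.
  - exists 0%R; split; [lra|]; intros; simpl; rewrite Cmod_0; lra.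
  - apply (bigO_plus kap N (fun y => Csum (fun k => h k y) n) (h n)); auto.
Qed.

Lemma bigO_inv_pow (kap : R) (N k : nat) : (N <= k)%nat -> bigO kap N (fun y => (/ y) ^ k).
Proof.
  intros H; exists 1%R; split; [lra|]; intros y H1 H2.
  assert (Ny : y <> 0) by (apply Cmod_gt_0; lra).
  rewrite Cmod_pow, Cmod_inv, Rmult_1_l, <- pow_inv by auto.
  replace k with (N + (k - N))%nat by lia; rewrite pow_add.
  assert (Q : (0 < / Cmod y <= 1)%R).
  { split; [apply Rinv_0_lt_compat; lra|rewrite <- Rinv_1; apply Rinv_le_contravar; lra]. }
  assert (0 <= (/ Cmod y) ^ N)%R by (apply pow_le; lra).
  assert ((/ Cmod y) ^ (k - N) <= 1)%R by (rewrite <- (pow1 (k - N)); apply pow_incr; lra).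
  nra.
Qed.

Lemma bigO_div (kap : R) (N : nat) (h : C -> C) :
  bigO kap N h -> bigO kap (S N) (fun y => / y * h y).
Proof.
  intros [K [P B]]; exists K; split; auto; intros y H1 H2.
  assert (Ny : y <> 0) by (apply Cmod_gt_0; lra).
  specialize (B y H1 H2).
  rewrite Cmod_mult, Cmod_inv by auto; simpl; rewrite Rinv_mult.
  replace (K * (/ Cmod y * / Cmod y ^ N))%R with (/ Cmod y * (K * / Cmod y ^ N))%R by ring.
  apply Rmult_le_compat_l; auto; left; apply Rinv_0_lt_compat; lra.
Qed.

Lemma pow_le_fact_exp (v : R) (n : nat) : (0 <= v)%R -> (v ^ n <= INR (fact n) * exp v)%R.
Proof.
  intros Hv; induction n as [|n IH] in v, Hv |- *.
  - simpl; generalize (exp_ineq1_le v); lra.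
  - assert (Q := MVT_gen (fun u => INR (fact (S n)) * exp u - u ^ S n)%R 0 v
      (fun u => INR (fact (S n)) * exp u - INR (S n) * u ^ n)%R).
    rewrite Rmin_left, Rmax_right in Q by auto; destruct Q as [c [Hc E]].
    + intros u _; set (F := INR (fact (S n))); auto_derive; auto.
      change (match n with 0%nat => 1 | S _ => INR n + 1 end)%R with (INR (S n)); ring.
    + intros u _; apply continuity_pt_filterlim.
      apply (@ex_derive_continuous R_AbsRing R_NormedModule
        (fun u => INR (fact (S n)) * exp u - u ^ S n)%R); auto_derive; auto.
    + specialize (IH c ltac:(lra)).
      rewrite exp_0, (pow_i (S n)) in E by lia.
      assert (P1 := INR_fact_lt_0 (S n)).
      assert (0 <= INR (fact (S n)) * exp c - INR (S n) * c ^ n)%R.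
      { rewrite fact_simpl, mult_INR, Rmult_assoc, <- Rmult_minus_distr_l.
        apply Rmult_le_pos; [apply pos_INR|lra]. }
      nra.
Qed.

(** In the sector Re y is comparable with |y|, so half an exponential beats any
    power. *)
Lemma bigO_exp_small (kap : R) (N j : nat) (D : R) (h : C -> C) :
  (0 < kap)%R ->
  (forall y, (1 <= Cmod y)%R -> (kap * Cmod y <= Re y)%R ->
    (Cmod (h y) <= D * Cmod y ^ j * exp (- (Re y / 2)))%R) ->
  bigO kap N h.
Proof.
  intros Hk H.
  exists (Rabs D * INR (fact (j + N)) * (2 / kap) ^ (j + N))%R; split.
  { apply Rmult_le_pos; [apply Rmult_le_pos; [apply Rabs_pos|apply pos_INR]|].
    apply pow_le; left; apply Rdiv_lt_0_compat; lra. }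
  intros y H1 H2; eapply Rle_trans; [apply H; auto|].
  set (r := Cmod y) in *; set (v := (kap * r / 2)%R).
  assert (Pr : (0 < r)%R) by lra.
  assert (Pv : (0 < v)%R) by (unfold v; assert (0 < kap * r)%R by (apply Rmult_lt_0_compat; auto); lra).
  assert (Q := pow_le_fact_exp v (j + N) ltac:(lra)).
  assert (E1 : (exp (- (Re y / 2)) <= exp (- v))%R) by (apply exp_le; unfold v; lra).
  assert (E2 : (exp (- v) <= INR (fact (j + N)) * / v ^ (j + N))%R).
  { rewrite exp_Ropp.
    assert (P1 := exp_pos v); assert (P2 : (0 < v ^ (j + N))%R) by (apply pow_lt; auto).
    apply Rmult_le_reg_r with (exp v * v ^ (j + N))%R; [apply Rmult_lt_0_compat; auto|].
    field_simplify; lra. }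
  assert (E3 : (/ v ^ (j + N) = (2 / kap) ^ (j + N) * / r ^ (j + N))%R).
  { rewrite <- !pow_inv, <- Rpow_mult_distr; f_equal; unfold v; field; lra. }
  rewrite E3 in E2.
  apply Rle_trans with (Rabs D * r ^ j * (INR (fact (j + N)) * ((2 / kap) ^ (j + N) * / r ^ (j + N))))%R.
  - assert (P3 := exp_pos (- (Re y / 2))).
    assert (P4 : (0 < r ^ j)%R) by (apply pow_lt; auto).
    apply Rle_trans with (Rabs D * r ^ j * exp (- (Re y / 2)))%R.
    + apply Rmult_le_compat_r; [lra|]; apply Rmult_le_compat_r; [lra|apply Rle_abs].
    + apply Rmult_le_compat_l; [|lra]; apply Rmult_le_pos; [apply Rabs_pos|lra].
  - right; rewrite (pow_add r); field; split; apply pow_nonzero; lra.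
Qed.

Lemma Cmod_Cpowc_pow (s y : C) (m : nat) :
  (Re s <= INR m)%R -> (1 <= Cmod y)%R ->
  (Cmod (Cpowc y s) <= exp (Rabs (Im s) * PI) * Cmod y ^ m)%R.
Proof.
  intros Hm Hy; rewrite Cmod_Cpowc.
  assert (L : (0 <= ln (Cmod y))%R).
  { rewrite <- ln_1; destruct Hy as [Hy|Hy]; [left; apply ln_increasing; lra|rewrite <- Hy; lra]. }
  rewrite <- (exp_ln (Cmod y ^ m)), ln_pow, <- exp_plus by (try apply pow_lt; lra).
  apply exp_le.
  assert (L3 : (- (Im s * Carg y) <= Rabs (Im s) * PI)%R).
  { eapply Rle_trans; [apply Rle_abs|]; rewrite Rabs_Ropp, Rabs_mult.
    apply Rmult_le_compat_l; [apply Rabs_pos|apply Carg_bound]. }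
  assert (Re s * ln (Cmod y) <= INR m * ln (Cmod y))%R by (apply Rmult_le_compat_r; auto).
  lra.
Qed.

(** f has the expansion e^y y^(-s) (c_0 + c_1/y + ...) in every closed sector
    inside the open right half-plane. *)
Definition expansion (f : C -> C) (s : C) (c : nat -> C) : Prop :=
  forall (kap : R) (N : nat), (0 < kap)%R ->
    bigO kap N (fun y => Cexp (- y) * Cpowc y s * f y - Csum (fun n => c n * (/ y) ^ n) N).

(** Allows the work to be done at an order larger than the one asked for. *)
Lemma bigO_truncate (kap : R) (N K : nat) (h : C -> C) (c : nat -> C) :
  (N <= K)%nat -> bigO kap N (fun y => h y - Csum (fun n => c n * (/ y) ^ n) K) ->
  bigO kap N (fun y => h y - Csum (fun n => c n * (/ y) ^ n) N).
Proof.
  intros HK H.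
  apply bigO_ext with (fun y => (h y - Csum (fun n => c n * (/ y) ^ n) K) +
    Csum (fun n => c (N + n)%nat * (/ y) ^ (N + n)) (K - N)).
  - intros y _; replace K with (N + (K - N))%nat at 1 by lia; rewrite Csum_add; ring.
  - apply bigO_plus; auto.
    apply (bigO_Csum kap N (fun n y => c (N + n)%nat * (/ y) ^ (N + n))).
    intros k _; apply (bigO_scal kap N (c (N + k)%nat) (fun y => (/ y) ^ (N + k))), bigO_inv_pow; lia.
Qed.

Lemma Cpowc_S (y s : C) : y <> 0 -> Cpowc y (s + 1) = y * Cpowc y s.
Proof. intros H; rewrite Cpowc_plus, Cpowc_1 by auto; ring. Qed.

Lemma expansion_hser (s : C) (i N : nat) (kap : R) :
  (2 <= Re s)%R -> (0 < kap)%R ->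
  bigO kap N (fun y => Cexp (- y) * Cpowc y s * hser (s + INR i) y -
    CGamma (s + INR i) * (/ y) ^ i).
Proof.
  intros Hs Hk.
  assert (Hsi : (2 <= Re (s + INR i))%R) by (rewrite re_plus, re_RtoC; generalize (pos_INR i); lra).
  destruct (hnorm_bound (s + INR i) kap Hsi Hk) as [K [HK B]].
  apply bigO_exp_small with (j := O) (D := K); auto.
  intros y H1 H2.
  assert (Ny : y <> 0) by (apply Cmod_gt_0; lra).
  specialize (B y Ny H2).
  replace (Cexp (- y) * Cpowc y s * hser (s + INR i) y - CGamma (s + INR i) * (/ y) ^ i)
    with ((/ y) ^ i * (hnorm (s + INR i) y - CGamma (s + INR i))).
  2:{ unfold hnorm; rewrite Cpowc_plus, Cpowc_INR, Cpow_inv by auto.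
      field; apply Cpow_nz, Ny. }
  rewrite Cmod_mult, Cmod_pow, Cmod_inv by auto.
  assert (Q : ((/ Cmod y) ^ i <= 1)%R).
  { rewrite <- (pow1 i); apply pow_incr; split; [left; apply Rinv_0_lt_compat; lra|].
    rewrite <- Rinv_1; apply Rinv_le_contravar; lra. }
  simpl (Cmod y ^ 0)%R; rewrite Rmult_1_r, <- (Rmult_1_l (K * _)).
  apply Rmult_le_compat; auto; [|apply Cmod_ge_0].
  apply pow_le; left; apply Rinv_0_lt_compat; lra.
Qed.

(** * The coefficients of Phi1 in y *)

Definition phi_coef (a b c x : C) (n : nat) : C :=
  poch a n / poch c n * hyp2F1 (a + INR n) b (c + INR n) x.

Lemma poch_ratio_lim (a c : C) (j : nat) :
  ~ nonpos_int a -> ~ nonpos_int c ->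
  Ccv (fun k => Cpowc (INR (k + S j)) (c - a) * (poch a (S (k + S j)) / poch c (S (k + S j))))
    (CGamma c / CGamma a).
Proof.
  intros Ha Hc.
  destruct (CGamma_cv a Ha) as [La Na]; destruct (CGamma_cv c Hc) as [Lc Nc].
  assert (Li := Ccv_inv _ _ Na (fun n => gam_u_neq0 a n Ha) La).
  assert (L := Ccv_incr _ _ (S j) (Ccv_mult _ _ _ _ Lc Li)).
  apply Ccv_ext with (2 := L); intros k; unfold gam_u.
  set (n := (k + S j)%nat).
  replace (Cpowc (INR n) c) with (Cpowc (INR n) (c - a) * Cpowc (INR n) a)
    by (rewrite <- Cpowc_plus; f_equal; ring).
  field; repeat split; [apply poch_neq0, Hc| |apply Cpowc_neq0|apply INR_fact_neq0];
    apply poch_neq0, Ha.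
Qed.

(** Both sides satisfy the same first-order recurrence in k, so they are
    proportional; multiplied by k^s they have the same nonzero limit.  The limit
    is read at n = k+j+1, since Euler's sequence at n contains (z)_(n+1). *)
Lemma poch_ratio_beta (a s : C) (j k : nat) :
  ~ nonpos_int a -> ~ nonpos_int (a + s) -> (3 <= Re (a + INR (S (S j))))%R -> (2 <= Re s)%R ->
  poch a (S (S j) + k) / poch (a + s) (S (S j) + k) =
  CGamma (a + s) / (CGamma a * CGamma s) * beta (a + INR (S (S j)) + INR k) s.
Proof.
  intros Ha Hc Hre Hs.
  set (c := a + s) in *; set (n0 := S (S j)) in *.
  assert (Hsn : ~ nonpos_int s) by (apply Re_pos_not_nonpos_int; lra).
  destruct (CGamma_cv a Ha) as [_ Na]; destruct (CGamma_cv c Hc) as [_ Nc].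
  destruct (CGamma_cv s Hsn) as [_ Ns].
  set (al := a + INR n0) in *.
  set (kappa := CGamma c / (CGamma a * CGamma s)).
  set (D := fun k => poch a (n0 + k) / poch c (n0 + k) - kappa * beta (al + INR k) s).
  assert (Pc : forall n, poch c n <> 0) by (intros; apply poch_neq0, Hc).
  assert (Pa : forall n, poch a n <> 0) by (intros; apply poch_neq0, Ha).
  assert (Rec : forall k, D k = poch c n0 / poch a n0 * D 0%nat *
    (poch a (n0 + k) / poch c (n0 + k))).
  { intros i; unfold D; rewrite Nat.add_0_r, !poch_add.
    fold al.
    assert (Q := beta_add al s i ltac:(lra) Hs).
    replace (al + s) with (c + INR n0) in Q by (unfold al, c; ring).
    assert (P2 : poch (c + INR n0) i <> 0) by (apply poch_neq0, not_nonpos_int_add, Hc).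
    replace (beta (al + INR i) s) with (poch al i * beta al s / poch (c + INR n0) i)
      by (rewrite <- Q; field; auto).
    replace (beta (al + INR 0) s) with (beta al s) by (f_equal; simpl; ring).
    field; auto. }
  assert (L1 : Ccv (fun k => Cpowc (INR (k + S j)) s * (poch a (n0 + k) / poch c (n0 + k)))
    (CGamma c / CGamma a)).
  { apply Ccv_ext with (2 := poch_ratio_lim a c j Ha Hc); intros i.
    replace (c - a) with s by (unfold c; ring).
    replace (n0 + i)%nat with (S (i + S j)) by (unfold n0; lia); reflexivity. }
  assert (L2 : Ccv (fun k => Cpowc (INR (k + S j)) s * D k) 0).
  { replace (RtoC 0) with (CGamma c / CGamma a - kappa * CGamma s)
      by (unfold kappa; field; auto).
    apply Ccv_ext with (2 := Ccv_minus _ _ _ _ L1 (Ccv_scal kappa _ _ (beta_lim al s j Hre Hs))).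
    intros i; unfold D; ring. }
  assert (L3 := Ccv_scal (poch c n0 / poch a n0 * D 0%nat) _ _ L1).
  assert (Z : poch c n0 / poch a n0 * D 0%nat * (CGamma c / CGamma a) = 0).
  { apply Ccv_unique with (1 := L3); apply Ccv_ext with (2 := L2).
    intros i; rewrite (Rec i); ring. }
  assert (D0 : D 0%nat = 0).
  { replace (D 0%nat) with (poch a n0 / poch c n0 * (CGamma a / CGamma c) *
      (poch c n0 / poch a n0 * D 0%nat * (CGamma c / CGamma a))) by (field; auto).
    rewrite Z; ring. }
  assert (Dk := Rec k); rewrite D0 in Dk; unfold D in Dk.
  apply Ceq_minus; rewrite Dk; ring.
Qed.

Lemma phi_coef_euler (a s b x : C) (j k : nat) :
  ~ nonpos_int a -> ~ nonpos_int (a + s) -> (3 <= Re (a + INR (S (S j))))%R -> (2 <= Re s)%R ->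
  slit_plane x ->
  phi_coef a b (a + s) x (S (S j) + k) = CGamma (a + s) / (CGamma a * CGamma s) *
    euler_int (a + INR (S (S j)) + INR k) s b x.
Proof.
  intros Ha Hc Hre Hs Hx; unfold phi_coef.
  rewrite poch_ratio_beta by auto.
  set (n0 := S (S j)) in *.
  assert (Hre' : (3 <= Re (a + INR n0 + INR k))%R)
    by (rewrite re_plus, re_RtoC; generalize (pos_INR k); lra).
  assert (Q := is_hyp2F1_euler (a + INR n0 + INR k) s b Hre' Hs).
  assert (N := beta_neq0 _ s Hre' Hs).
  replace (a + INR (n0 + k)) with (a + INR n0 + INR k) by (rewrite RtoC_INR_plus; ring).
  replace (a + s + INR (n0 + k)) with (a + INR n0 + INR k + s) by (rewrite RtoC_INR_plus; ring).
  rewrite (hyp2F1_eq _ _ _ _ _ Q Hx).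
  set (kappa := CGamma (a + s) / (CGamma a * CGamma s)); field; exact N.
Qed.

Lemma Ccont_euler_rem (a b x : C) (n0 K : nat) (t : R) :
  slit_plane x -> (2 <= Re (a + INR n0))%R -> (0 <= t <= 1)%R -> Ccont (euler_rem a b x n0 K) t.
Proof.
  intros Hx Ha Ht; unfold euler_rem; apply Ccont_minus; apply Ccont_mult.
  - apply Ccont_tpow; rewrite Re_minus, re_RtoC; lra.
  - apply Ccont_Cpowc_slit; auto.
  - apply (Ccont_RtoC_pow n0).
  - apply (Ccont_Csum (fun k t => gcoef a b x k * RtoC (1 - t) ^ k)); intros k _.
    apply Ccont_scal, (Ccont_reflect (fun u => RtoC u ^ k)), Ccont_RtoC_pow.
Qed.

(** Expanding the regular part of Euler's integrand at t = 1 turns the leading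
    terms into exact moments and leaves a remainder of high order there. *)
Lemma euler_int_expand (a s b x : C) (n0 k K : nat) :
  (3 <= Re (a + INR n0))%R -> (2 <= Re s)%R -> slit_plane x ->
  euler_int (a + INR n0 + INR k) s b x =
  Csum (fun i => gcoef a b x i * (INR (fact (n0 + k)) / poch (s + INR i) (S (n0 + k)))) K +
  CInt (fun t => RtoC t ^ k * (euler_rem a b x n0 K t * wt s t)).
Proof.
  intros Ha Hs Hx.
  assert (Hsi : forall i : nat, (2 <= Re (s + INR i))%R)
    by (intros i; rewrite re_plus, re_RtoC; generalize (pos_INR i); lra).
  assert (Cm : forall i, Ccont01 (fun t => RtoC t ^ (n0 + k) * wt (s + INR i) t)).
  { intros i t _; apply Ccont_mult; [apply (Ccont_RtoC_pow (n0 + k))|apply Ccont_wt; auto]. }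
  rewrite (Csum_ext _ (fun i => CInt (fun t => gcoef a b x i *
    (RtoC t ^ (n0 + k) * wt (s + INR i) t)))).
  2:{ intros i _; rewrite CInt_scal by auto; fold (moment (s + INR i) (n0 + k)).
      rewrite moment_eq by auto; reflexivity. }
  rewrite <- (CInt_Csum (fun i t => gcoef a b x i * (RtoC t ^ (n0 + k) * wt (s + INR i) t)))
    by (intros i _ t Ht; apply Ccont_scal, Cm, Ht).
  rewrite <- CInt_plus.
  - apply CInt_ext; intros t Ht; unfold euler_rem.
    rewrite (Csum_ext _ (fun i => (RtoC t ^ (n0 + k) * wt s t) *
      (gcoef a b x i * RtoC (1 - t) ^ i))) by (intros i _; rewrite wt_add; ring).
    rewrite Csum_scal.
    replace (a + INR n0 + INR k - 1) with (a + INR n0 - 1 + INR k) by ring.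
    rewrite tpow_add, Cpow_add_r; ring.
  - intros t Ht; apply (Ccont_Csum (fun i t => gcoef a b x i *
      (RtoC t ^ (n0 + k) * wt (s + INR i) t))); intros i _; apply Ccont_scal, Cm, Ht.
  - intros t Ht; apply Ccont_mult; [apply Ccont_RtoC_pow|].
    apply Ccont_mult; [apply Ccont_euler_rem; auto; lra|apply Ccont_wt; auto].
Qed.

(** * The contribution of the remainder *)

Lemma Csum_Re_pos (v : nat -> R) (n : nat) :
  (forall k, (0 <= v k)%R) -> (0 <= Re (Csum (fun k => RtoC (v k)) n))%R.
Proof. intros H; induction n as [|n IH]; [simpl; lra|rewrite Csum_S, re_plus, re_RtoC; specialize (H n); lra]. Qed.

Lemma exp_partial_le (v : R) (N : nat) :
  (0 <= v)%R -> (Re (Csum (fun n => RtoC (v ^ n / INR (fact n))) N) <= exp v)%R.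
Proof.
  intros Hv.
  assert (L := proj1 (proj1 (Ccv_Re_Im _ _) (Cexp_series v))).
  rewrite Cexp_RtoC, re_RtoC in L.
  assert (L' : is_lim_seq (fun n => Re (Csum (fun n => RtoC (v ^ n / INR (fact n))) n)) (exp v)).
  { apply is_lim_seq_ext with (2 := L); intros n; f_equal; apply Csum_ext; intros k _.
    rewrite RtoC_div, RtoC_pow by apply INR_fact_neq_0; reflexivity. }
  apply (is_lim_seq_incr_compare _ _ L').
  intros n; rewrite Csum_S, re_plus, re_RtoC.
  assert (0 <= v ^ n / INR (fact n))%R; [|lra].
  apply Rmult_le_pos; [apply pow_le, Hv|left; apply Rinv_0_lt_compat, INR_fact_lt_0].
Qed.

Lemma Cmod_exp_term (w : C) (n : nat) :
  Cmod (w ^ n / INR (fact n)) = (Cmod w ^ n / INR (fact n))%R.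
Proof. rewrite Cmod_div, Cmod_pow, Cmod_INR by apply INR_fact_neq0; reflexivity. Qed.

Lemma pow_ratio_le1 (e : R) (n m : nat) : (0 < e <= 1)%R -> (n <= m)%nat -> (1 <= / e ^ m * e ^ n)%R.
Proof.
  intros He H; replace m with (n + (m - n))%nat by lia; rewrite pow_add.
  assert (P1 : (0 < e ^ n)%R) by (apply pow_lt; lra).
  assert (P2 : (0 < e ^ (m - n) <= 1)%R).
  { split; [apply pow_lt; lra|rewrite <- (pow1 (m - n)); apply pow_incr; lra]. }
  replace (/ (e ^ n * e ^ (m - n)) * e ^ n)%R with (/ e ^ (m - n))%R by (field; lra).
  rewrite <- Rinv_1 at 1; apply Rinv_le_contravar; lra.
Qed.

(** A bounded number of terms of the exponential series costs only a small
    exponential: rescale the variable by e. *)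
Lemma exp_head_le (rho : nat -> C) (w : C) (P e : R) (n0 : nat) :
  (0 < e <= 1)%R -> (0 <= P)%R -> (forall n, (n < n0)%nat -> (Cmod (rho n) <= P)%R) ->
  (Cmod (Csum (fun n => rho n * (w ^ n / INR (fact n)))%C n0) <= P * (/ e ^ n0 * exp (e * Cmod w)))%R.
Proof.
  intros He HP Hr.
  assert (Pe : (0 < / e ^ n0)%R) by (apply Rinv_0_lt_compat, pow_lt; lra).
  eapply Rle_trans.
  { apply Cmod_Csum_le with (g := fun n => (P * / e ^ n0 * ((e * Cmod w) ^ n / INR (fact n)))%R).
    intros n Hn; rewrite Cmod_mult, Cmod_exp_term, Rpow_mult_distr.
    assert (Pw : (0 <= Cmod w ^ n / INR (fact n))%R).
    { apply Rmult_le_pos; [apply pow_le, Cmod_ge_0|left; apply Rinv_0_lt_compat, INR_fact_lt_0]. }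
    assert (Q := pow_ratio_le1 e n n0 He ltac:(lia)).
    replace (P * / e ^ n0 * (e ^ n * Cmod w ^ n / INR (fact n)))%R
      with (P * ((/ e ^ n0 * e ^ n) * (Cmod w ^ n / INR (fact n))))%R
      by (field; split; [apply INR_fact_neq_0|apply pow_nonzero; lra]).
    apply Rmult_le_compat; auto; [apply Cmod_ge_0|].
    rewrite <- (Rmult_1_l (Cmod w ^ n / INR (fact n))) at 1; apply Rmult_le_compat_r; auto. }
  rewrite (Csum_ext _ (fun n => RtoC (P * / e ^ n0) * RtoC ((e * Cmod w) ^ n / INR (fact n))))
    by (intros; rewrite <- RtoC_mult; reflexivity).
  rewrite Csum_scal, re_scal_l, <- Rmult_assoc.
  apply Rmult_le_compat_l; [apply Rmult_le_pos; lra|].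
  apply exp_partial_le, Rmult_le_pos; [lra|apply Cmod_ge_0].
Qed.

Definition exp_tail (n0 : nat) (y : C) (M : nat) (t : R) : C :=
  Csum (fun k => RtoC t ^ k * (y ^ (n0 + k) / INR (fact (n0 + k)))) M.

(** The truncated tail of the exponential series divided by t^n0.  For t away
    from 0 it is compared with e^(ty); for small t each term is small. *)
Lemma exp_tail_bound (j : nat) (y : C) (M : nat) (t e : R) :
  (0 < e <= 1)%R -> (0 <= t <= 1)%R ->
  (Cmod (exp_tail (S j) y M t) <= / e ^ S j *
    (exp (t * Re y) + / e ^ S j * exp (e * Cmod y) +
     2 * exp (2 * Cmod y) * (Cmod y ^ S (j + M) / INR (fact (j + M)))))%R.
Proof.
  intros He Ht; set (n0 := S j).
  set (tau := (2 * exp (2 * Cmod y) * (Cmod y ^ S (j + M) / INR (fact (j + M))))%R).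
  assert (Py := Cmod_ge_0 y).
  assert (Fp : forall n, (0 < / INR (fact n))%R) by (intros; apply Rinv_0_lt_compat, INR_fact_lt_0).
  assert (Ptau : (0 <= tau)%R).
  { unfold tau; apply Rmult_le_pos; [generalize (exp_pos (2 * Cmod y)); lra|].
    apply Rmult_le_pos; [apply pow_le, Py|left; apply Fp]. }
  assert (Pe : (0 < e ^ n0)%R) by (apply pow_lt; lra).
  assert (He1 : (1 <= / e ^ n0)%R) by (generalize (pow_ratio_le1 e 0 n0 He ltac:(lia)); simpl; lra).
  assert (P1 := exp_pos (t * Re y)); assert (P2 := exp_pos (e * Cmod y)).
  destruct (Rle_dec t e) as [h|h].
  - assert (B : (Cmod (exp_tail n0 y M t) <= / e ^ n0 * exp (e * Cmod y))%R).
    { unfold exp_tail; eapply Rle_trans.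
      { apply Cmod_Csum_le with (g := fun k => (/ e ^ n0 *
          ((e * Cmod y) ^ (n0 + k) / INR (fact (n0 + k))))%R).
        intros k _; rewrite Cmod_mult, Cmod_exp_term, Cmod_pow, Cmod_R, Rabs_pos_eq by lra.
        rewrite Rpow_mult_distr, (pow_add e).
        replace (/ e ^ n0 * (e ^ n0 * e ^ k * Cmod y ^ (n0 + k) / INR (fact (n0 + k))))%R
          with (e ^ k * (Cmod y ^ (n0 + k) / INR (fact (n0 + k))))%R
          by (field; split; [apply INR_fact_neq_0|lra]).
        apply Rmult_le_compat_r; [|apply pow_incr; lra].
        apply Rmult_le_pos; [apply pow_le, Py|left; apply Fp]. }
      rewrite (Csum_ext _ (fun k => RtoC (/ e ^ n0) *
        RtoC ((e * Cmod y) ^ (n0 + k) / INR (fact (n0 + k)))))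
        by (intros; rewrite <- RtoC_mult; reflexivity).
      rewrite Csum_scal, re_scal_l; apply Rmult_le_compat_l; [lra|].
      assert (Pey : (0 <= e * Cmod y)%R) by (apply Rmult_le_pos; lra).
      eapply Rle_trans; [|apply (exp_partial_le _ (n0 + M) Pey)].
      rewrite Csum_add, re_plus.
      assert (0 <= Re (Csum (fun n => RtoC ((e * Cmod y) ^ n / INR (fact n))) n0))%R; [|lra].
      apply Csum_Re_pos; intros k; apply Rmult_le_pos; [apply pow_le, Pey|left; apply Fp]. }
    eapply Rle_trans; [exact B|]; apply Rmult_le_compat_l; [lra|].
    assert (1 * exp (e * Cmod y) <= / e ^ n0 * exp (e * Cmod y))%R
      by (apply Rmult_le_compat_r; lra).
    lra.
  - assert (E : RtoC t ^ n0 * exp_tail n0 y M t =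
      Csum (fun n => (t * y) ^ n / INR (fact n)) (n0 + M) -
      Csum (fun n => 1 * ((t * y) ^ n / INR (fact n))) n0).
    { rewrite Csum_add.
      rewrite (Csum_ext (fun n => 1 * _) (fun n => (t * y) ^ n / INR (fact n)))
        by (intros; ring).
      unfold exp_tail; rewrite <- Csum_scal.
      rewrite (Csum_ext (fun k => (t * y) ^ (n0 + k) / _)
        (fun k => RtoC t ^ n0 * (RtoC t ^ k * (y ^ (n0 + k) / INR (fact (n0 + k)))))).
      - ring.
      - intros k _; rewrite Cpow_mult_l, (Cpow_add_r t); unfold Cdiv; ring. }
    assert (Mty : (Cmod (t * y) <= Cmod y)%R)
      by (rewrite Cmod_mult, Cmod_R, Rabs_pos_eq by lra; nra).
    assert (Pty := Cmod_ge_0 (t * y)).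
    assert (B1 := Cexp_series_bound (t * y) (j + M)).
    change (S (j + M)) with (n0 + M)%nat in B1 at 1.
    assert (B1' : (2 * exp (2 * Cmod (t * y)) * (Cmod (t * y) ^ S (j + M) / INR (fact (j + M))) <= tau)%R).
    { unfold tau; apply Rmult_le_compat.
      - generalize (exp_pos (2 * Cmod (t * y))); lra.
      - apply Rmult_le_pos; [apply pow_le, Pty|left; apply Fp].
      - apply Rmult_le_compat_l; [lra|apply exp_le; lra].
      - apply Rmult_le_compat_r; [left; apply Fp|apply pow_incr; lra]. }
    assert (B2 := exp_head_le (fun _ => RtoC 1) (t * y) 1 e n0 He ltac:(lra)
      (fun n _ => Req_le _ _ Cmod_1)).
    assert (B2' : (exp (e * Cmod (t * y)) <= exp (e * Cmod y))%R).
    { apply exp_le, Rmult_le_compat_l; lra. }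
    assert (B3 : Cmod (Cexp (t * y)) = exp (t * Re y)) by (rewrite Cmod_Cexp, re_scal_l; reflexivity).
    assert (Q : (Cmod (RtoC t ^ n0 * exp_tail n0 y M t) <=
      exp (t * Re y) + / e ^ n0 * exp (e * Cmod y) + tau)%R).
    { rewrite E; eapply Rle_trans; [apply Cmod_triangle_minus|].
      set (S1 := Csum (fun n => (t * y) ^ n / INR (fact n)) (n0 + M)) in *.
      assert (Cmod S1 <= exp (t * Re y) + tau)%R.
      { generalize (Cmod_triangle_inv S1 (Cexp (t * y))); lra. }
      assert (/ e ^ n0 * exp (e * Cmod (t * y)) <= / e ^ n0 * exp (e * Cmod y))%R
        by (apply Rmult_le_compat_l; lra).
      lra. }
    rewrite Cmod_mult, Cmod_pow, Cmod_R, Rabs_pos_eq in Q by lra.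
    apply Rmult_le_reg_l with (e ^ n0)%R; auto.
    rewrite <- Rmult_assoc, Rinv_r, Rmult_1_l by lra.
    eapply Rle_trans; [|exact Q].
    apply Rmult_le_compat_r; [apply Cmod_ge_0|apply pow_incr; lra].
Qed.

Lemma finite_bound (rho : nat -> C) (n : nat) :
  exists P : R, (0 <= P)%R /\ forall k, (k < n)%nat -> (Cmod (rho k) <= P)%R.
Proof.
  induction n as [|n [P [HP IH]]]; [exists 0%R; split; [lra|intros; lia]|].
  exists (P + Cmod (rho n))%R; assert (Q := Cmod_ge_0 (rho n)); split; [lra|].
  intros k Hk; destruct (Nat.eq_dec k n) as [->|N]; [lra|].
  specialize (IH k ltac:(lia)); lra.
Qed.

(** Moments of a function of order (1-t)^K generate an entire function that is
    O(e^y y^(-K-1)) in the sector; finitely many other coefficients only add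
    a polynomial. *)
Lemma remainder_bound (kap : R) (rho : nat -> C) (j K : nat) (kappa : C) (g : R -> C) (A : R)
    (r : C -> C) :
  (0 < kap)%R -> Ccont01 g -> (0 <= A)%R ->
  (forall t, (0 < t < 1)%R -> (Cmod (g t) <= A * (1 - t) ^ K)%R) ->
  (forall k, rho (S j + k)%nat = kappa * CInt (fun t => RtoC t ^ k * g t)) ->
  (forall y, Ccv (Csum (fun n => rho n * (y ^ n / INR (fact n)))) (r y)) ->
  exists D : R, (0 <= D)%R /\ forall y, (1 <= Cmod y)%R -> (kap * Cmod y <= Re y)%R ->
    (Cmod (r y) <= D * (exp (Re y) / Re y ^ S K + exp (Re y / 2)))%R.
Proof.
  intros Hk Hg HA Bg Hrho Hr.
  set (n0 := S j) in *.
  destruct (finite_bound rho n0) as [P [HP BP]].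
  set (e := Rmin (kap / 2) 1).
  assert (He : (0 < e <= 1)%R) by (split; [apply Rmin_pos; lra|apply Rmin_r]).
  assert (He2 : (e <= kap / 2)%R) by apply Rmin_l.
  set (H := (/ e ^ n0)%R).
  assert (PH : (0 < H)%R) by (apply Rinv_0_lt_compat, pow_lt; lra).
  assert (Pk := Cmod_ge_0 kappa).
  set (D1 := (P * H)%R); set (D2 := (2 * Cmod kappa * (H * A))%R).
  assert (PD1 : (0 <= D1)%R) by (apply Rmult_le_pos; lra).
  assert (PD2 : (0 <= D2)%R)
    by (unfold D2; apply Rmult_le_pos; [lra|apply Rmult_le_pos; lra]).
  (* As e <= kap/2, the errors e^(e|y|) are at most e^(Re y/2). *)
  exists (D1 + D2 * H + D2 * INR (fact K))%R; split.
  { assert (0 <= D2 * H)%R by (apply Rmult_le_pos; lra).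
    assert (0 <= D2 * INR (fact K))%R by (apply Rmult_le_pos; auto; apply pos_INR). lra. }
  intros y H1 H2.
  assert (Pre : (0 < Re y)%R) by nra.
  set (q := Re y) in *.
  assert (Hey : (exp (e * Cmod y) <= exp (q / 2))%R) by (apply exp_le; nra).
  assert (B1 : (Cmod (Csum (fun n => rho n * (y ^ n / INR (fact n)))%C n0) <= D1 * exp (q / 2))%R).
  { eapply Rle_trans; [apply (exp_head_le rho y P e n0); auto|].
    unfold D1; rewrite Rmult_assoc; fold H.
    apply Rmult_le_compat_l; auto; apply Rmult_le_compat_l; lra. }
  set (tau := fun M : nat => (2 * exp (2 * Cmod y) * (Cmod y ^ S (j + M) / INR (fact (j + M))))%R).
  assert (Ptau : forall M, (0 <= tau M)%R).
  { intros M; unfold tau; apply Rmult_le_pos; [generalize (exp_pos (2 * Cmod y)); lra|].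
    apply Rmult_le_pos; [apply pow_le; lra|left; apply Rinv_0_lt_compat, INR_fact_lt_0]. }
  assert (CE : forall M, Ccont01 (exp_tail n0 y M)).
  { intros M t _; unfold exp_tail.
    apply (Ccont_Csum (fun k t => RtoC t ^ k * (y ^ (n0 + k) / INR (fact (n0 + k)))%C)).
    intros k _; apply Ccont_mult; [apply Ccont_RtoC_pow|apply Ccont_const]. }
  assert (B2 : forall M, (Cmod (Csum (fun k => rho (n0 + k)%nat *
      (y ^ (n0 + k) / INR (fact (n0 + k))))%C M) <=
    D2 * (exp q * (INR (fact K) / q ^ S K) + (H * exp (q / 2) + tau M)))%R).
  { intros M.
    assert (E : Csum (fun k => rho (n0 + k)%nat * (y ^ (n0 + k) / INR (fact (n0 + k)))) M =
      kappa * CInt (fun t => exp_tail n0 y M t * g t)).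
    { assert (Cf : forall k, Ccont01 (fun t => (y ^ (n0 + k) / INR (fact (n0 + k))) *
        (RtoC t ^ k * g t))).
      { intros k t Ht; apply Ccont_scal, Ccont_mult; [apply Ccont_RtoC_pow|apply Hg, Ht]. }
      rewrite (Csum_ext _ (fun k => kappa * CInt (fun t =>
        (y ^ (n0 + k) / INR (fact (n0 + k))) * (RtoC t ^ k * g t)))).
      - rewrite Csum_scal; f_equal.
        rewrite <- (CInt_Csum (fun k t => (y ^ (n0 + k) / INR (fact (n0 + k))) *
          (RtoC t ^ k * g t))) by auto.
        apply CInt_ext; intros t Ht; unfold exp_tail.
        rewrite (Cmult_comm _ (g t)), <- Csum_scal; apply Csum_ext; intros; ring.
      - intros k _; rewrite Hrho, CInt_scal; [ring|].
        intros t Ht; apply Ccont_mult; [apply Ccont_RtoC_pow|apply Hg, Ht]. }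
    rewrite E, Cmod_mult.
    set (L := fun t => (exp (- q * (1 - t)) * (1 - t) ^ K)%R).
    assert (BI : (Cmod (CInt (fun t => exp_tail n0 y M t * g t)%C) <=
      2 * RInt (fun t => H * A * (exp q * L t + (H * exp (q / 2) + tau M)))%R 0 1)%R).
    { apply CInt_bound.
      - intros t Ht; apply Ccont_mult; [apply CE, Ht|apply Hg, Ht].
      - intros t _; unfold L; apply (@ex_derive_continuous R_AbsRing R_NormedModule).
        auto_derive; auto.
      - intros t Ht; rewrite Cmod_mult.
        assert (Q1 := exp_tail_bound j y M t e He ltac:(lra)).
        change (Re y) with q in Q1; fold n0 in Q1; fold H in Q1.
        change (2 * exp (2 * Cmod y) * (Cmod y ^ S (j + M) / INR (fact (j + M))))%R
          with (tau M) in Q1.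
        assert (Q2 := Bg t Ht).
        assert (PL : (0 <= (1 - t) ^ K <= 1)%R).
        { split; [apply pow_le; lra|].
          apply Rle_trans with (1 ^ K)%R; [apply pow_incr; lra|rewrite pow1; lra]. }
        assert (Ee : exp (t * q) = (exp q * exp (- q * (1 - t)))%R)
          by (rewrite <- exp_plus; f_equal; ring).
        assert (P3 := exp_pos (t * q)); assert (P4 := exp_pos (q / 2)).
        assert (PHe : (H * exp (e * Cmod y) <= H * exp (q / 2))%R)
          by (apply Rmult_le_compat_l; lra).
        assert (PHq : (0 <= H * exp (q / 2))%R) by (apply Rmult_le_pos; lra).
        specialize (Ptau M).
        apply Rle_trans with ((H * (exp (t * q) + H * exp (q / 2) + tau M)) * (A * (1 - t) ^ K))%R.
        + apply Rmult_le_compat; auto; try apply Cmod_ge_0.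
          eapply Rle_trans; [exact Q1|]; apply Rmult_le_compat_l; lra.
        + replace ((H * (exp (t * q) + H * exp (q / 2) + tau M)) * (A * (1 - t) ^ K))%R
            with (H * A * (exp (t * q) * (1 - t) ^ K + (H * exp (q / 2) + tau M) * (1 - t) ^ K))%R
            by ring.
          apply Rmult_le_compat_l; [apply Rmult_le_pos; lra|].
          unfold L; rewrite Ee, Rmult_assoc.
          apply Rplus_le_compat_l.
          rewrite <- (Rmult_1_r (H * exp (q / 2) + tau M)) at 2.
          apply Rmult_le_compat_l; lra. }
    assert (EI : RInt (fun t => H * A * (exp q * L t + (H * exp (q / 2) + tau M)))%R 0 1 =
      (H * A * (exp q * RInt L 0 1 + (H * exp (q / 2) + tau M)))%R).
    { apply is_RInt_unique, (is_RInt_scal (V := R_NormedModule)).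
      apply (is_RInt_plus (V := R_NormedModule)).
      - apply (is_RInt_scal (V := R_NormedModule)), (RInt_correct (V := R_CompleteNormedModule)).
        apply ex_RInt_laplace.
      - assert (Q := is_RInt_const (V := R_NormedModule) 0 1 (H * exp (q / 2) + tau M)%R).
        unfold scal in Q; simpl in Q; unfold mult in Q; simpl in Q.
        rewrite Rminus_0_r, Rmult_1_l in Q; exact Q. }
    rewrite EI in BI.
    assert (IL := RInt_laplace K q Pre); change (RInt L 0 1 <= INR (fact K) / q ^ S K)%R in IL.
    apply Rle_trans with (Cmod kappa * (2 * (H * A * (exp q * RInt L 0 1 +
      (H * exp (q / 2) + tau M)))))%R; [apply Rmult_le_compat_l; auto|].
    unfold D2.
    replace (Cmod kappa * (2 * (H * A * (exp q * RInt L 0 1 + (H * exp (q / 2) + tau M)))))%R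
      with (2 * Cmod kappa * (H * A) * (exp q * RInt L 0 1 + (H * exp (q / 2) + tau M)))%R by ring.
    apply Rmult_le_compat_l; [exact PD2|].
    apply Rplus_le_compat_r, Rmult_le_compat_l; [left; apply exp_pos|exact IL]. }
  set (B0 := (D2 * (exp q * (INR (fact K) / q ^ S K) + H * exp (q / 2)))%R).
  assert (Fin : (Cmod (r y) <= D1 * exp (q / 2) + B0)%R).
  { apply Ccv_limit_le with (u := fun M => Csum (fun n => rho n * (y ^ n / INR (fact n))) (M + n0))
      (v := fun M => (D1 * exp (q / 2) + B0 + D2 * tau M)%R) (N := O).
    - intros M _; rewrite Nat.add_comm, Csum_add.
      eapply Rle_trans; [apply Cmod_triangle|].
      specialize (B2 M); unfold B0; lra.
    - replace (Finite (D1 * exp (q / 2) + B0)) with (Finite (D1 * exp (q / 2) + B0 + 0))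
        by (f_equal; ring).
      apply is_lim_seq_plus'; [apply is_lim_seq_const|].
      apply is_lim_seq_scal0; unfold tau; apply is_lim_seq_scal0.
      apply is_lim_seq_ext with (fun M => Cmod y ^ S (M + j) / INR (fact (M + j)))%R.
      + intros M; rewrite (Nat.add_comm M j); reflexivity.
      + apply (is_lim_seq_incr_n (fun M => Cmod y ^ S M / INR (fact M))%R j), pow_fact_lim0.
    - apply Ccv_incr, Hr. }
  eapply Rle_trans; [exact Fin|].
  assert (PqK : (0 < q ^ S K)%R) by (apply pow_lt; auto).
  assert (T1 : (0 <= exp q / q ^ S K)%R)
    by (apply Rmult_le_pos; [left; apply exp_pos|left; apply Rinv_0_lt_compat; auto]).
  assert (T2 := exp_pos (q / 2)).
  assert (T3 : (0 <= D1 + D2 * H)%R).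
  { assert (0 <= D2 * H)%R by (apply Rmult_le_pos; lra). lra. }
  assert (T4 : (0 <= D2 * INR (fact K))%R) by (apply Rmult_le_pos; auto; apply pos_INR).
  unfold B0.
  replace (D1 * exp (q / 2) + D2 * (exp q * (INR (fact K) / q ^ S K) + H * exp (q / 2)))%R
    with ((D1 + D2 * H) * exp (q / 2) + D2 * INR (fact K) * (exp q / q ^ S K))%R
    by (field; lra).
  assert (0 <= (D1 + D2 * H) * (exp q / q ^ S K))%R by (apply Rmult_le_pos; auto).
  assert (0 <= D2 * INR (fact K) * exp (q / 2))%R by (apply Rmult_le_pos; lra).
  rewrite Rmult_plus_distr_l, !Rmult_plus_distr_r; rewrite Rmult_plus_distr_r in *; lra.
Qed.

Lemma bigO_remainder (kap : R) (s : C) (N m : nat) (D : R) (r : C -> C) :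
  (0 < kap)%R -> (Re s <= INR m)%R -> (0 <= D)%R ->
  (forall y, (1 <= Cmod y)%R -> (kap * Cmod y <= Re y)%R ->
    (Cmod (r y) <= D * (exp (Re y) / Re y ^ S (N + m) + exp (Re y / 2)))%R) ->
  bigO kap N (fun y => Cexp (- y) * Cpowc y s * r y).
Proof.
  intros Hk Hm HD B.
  set (E := exp (Rabs (Im s) * PI)).
  assert (PE : (0 < E)%R) by apply exp_pos.
  destruct (bigO_exp_small kap N m (E * D) (fun y => RtoC (E * D * Cmod y ^ m * exp (- (Re y / 2)))) Hk)
    as [K2 [HK2 B2]].
  { intros y H1 H2; rewrite Cmod_R, Rabs_pos_eq; [lra|].
    apply Rmult_le_pos; [|left; apply exp_pos].
    apply Rmult_le_pos; [apply Rmult_le_pos; lra|apply pow_le; lra]. }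
  set (K1 := (E * D * / kap ^ S (N + m))%R).
  assert (HK1 : (0 <= K1)%R).
  { unfold K1; apply Rmult_le_pos; [apply Rmult_le_pos; lra|].
    left; apply Rinv_0_lt_compat, pow_lt, Hk. }
  exists (K1 + K2)%R; split; [lra|]; intros y H1 H2.
  specialize (B y H1 H2); specialize (B2 y H1 H2).
  rewrite Cmod_R, Rabs_pos_eq in B2.
  2:{ apply Rmult_le_pos; [|left; apply exp_pos].
      apply Rmult_le_pos; [apply Rmult_le_pos; lra|apply pow_le; lra]. }
  rewrite !Cmod_mult, Cmod_Cexp, re_opp.
  assert (Q := Cmod_Cpowc_pow s y m Hm H1); fold E in Q.
  set (q := Re y) in *; set (v := Cmod y) in *.
  assert (Pq : (0 < q)%R) by nra.
  assert (Pv : (0 < v ^ m)%R) by (apply pow_lt; lra).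
  assert (Pe := exp_pos (- q)).
  apply Rle_trans with (exp (- q) * (E * v ^ m) * (D * (exp q / q ^ S (N + m) + exp (q / 2))))%R.
  { apply Rmult_le_compat; auto; [apply Rmult_le_pos; [lra|apply Cmod_ge_0]|apply Cmod_ge_0|].
    apply Rmult_le_compat_l; [lra|exact Q]. }
  assert (E1 : (exp (- q) * exp q = 1)%R)
    by (rewrite <- exp_plus; replace (- q + q)%R with 0%R by ring; apply exp_0).
  assert (E2 : (exp (- q) * exp (q / 2) = exp (- (q / 2)))%R)
    by (rewrite <- exp_plus; f_equal; field).
  assert (PqK : (0 < q ^ S (N + m))%R) by (apply pow_lt; auto).
  replace (exp (- q) * (E * v ^ m) * (D * (exp q / q ^ S (N + m) + exp (q / 2))))%R
    with (E * D * v ^ m * ((exp (- q) * exp q) / q ^ S (N + m)) +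
      E * D * v ^ m * (exp (- q) * exp (q / 2)))%R by (field; lra).
  rewrite E1, E2, Rmult_plus_distr_r.
  apply Rplus_le_compat; [|exact B2].
  assert (Pkv : (0 < (kap * v) ^ S (N + m))%R) by (apply pow_lt, Rmult_lt_0_compat; lra).
  assert (T : (/ q ^ S (N + m) <= / (kap * v) ^ S (N + m))%R).
  { apply Rinv_le_contravar; auto; apply pow_incr; split; [apply Rmult_le_pos; lra|exact H2]. }
  apply Rle_trans with (E * D * v ^ m * / (kap * v) ^ S (N + m))%R.
  { unfold Rdiv; rewrite Rmult_1_l; apply Rmult_le_compat_l; auto.
    apply Rmult_le_pos; [apply Rmult_le_pos|]; lra. }
  rewrite Rpow_mult_distr; unfold K1.
  assert (PN : (0 < v ^ N)%R) by (apply pow_lt; lra).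
  replace (E * D * v ^ m * / (kap ^ S (N + m) * v ^ S (N + m)))%R
    with (E * D * / kap ^ S (N + m) * / v ^ N * / v)%R.
  2:{ change (v ^ S (N + m))%R with (v * v ^ (N + m))%R; rewrite (pow_add v).
      field; repeat split; try lra; apply pow_nonzero; lra. }
  rewrite <- (Rmult_1_r (E * D * / kap ^ S (N + m) * / v ^ N)) at 2.
  apply Rmult_le_compat_l.
  - apply Rmult_le_pos; [exact HK1|left; apply Rinv_0_lt_compat; auto].
  - rewrite <- Rinv_1; apply Rinv_le_contravar; lra.
Qed.

(** * The expansion when the real part of c-a is large *)

Definition phi_asym (a b c x : C) (n : nat) : C :=
  CGamma c / CGamma a * (gcoef a b x n * poch (c - a) n).

Definition has_expansion (a b c x : C) : Prop :=
  (forall y, Ccv (Csum (fun n => phi_coef a b c x n * (y ^ n / INR (fact n)))) (Phi1 a b c x y)) /\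
  expansion (Phi1 a b c x) (c - a) (phi_asym a b c x).

Lemma Csum_exchange (h : nat -> nat -> C) (N K : nat) :
  Csum (fun n => Csum (fun i => h i n) K) N = Csum (fun i => Csum (fun n => h i n) N) K.
Proof.
  induction N as [|N IH].
  - symmetry; apply Csum_zero; reflexivity.
  - rewrite Csum_S, IH, <- Csum_plus; reflexivity.
Qed.

Lemma Ccv_Csum (u : nat -> nat -> C) (l : nat -> C) (K : nat) :
  (forall i, (i < K)%nat -> Ccv (u i) (l i)) ->
  Ccv (fun n => Csum (fun i => u i n) K) (Csum l K).
Proof.
  induction K as [|K IH]; intros H; [apply (Ccv_const 0)|].
  apply (Ccv_plus (fun n => Csum (fun i => u i n) K) (u K)); auto.
Qed.

Lemma ex_series_exp (v : R) : ex_series (fun n => v ^ n / INR (fact n))%R.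
Proof.
  exists (exp v); apply is_series_ext with (2 := is_exp_Reals v).
  intros n; rewrite pow_n_pow; reflexivity.
Qed.

(** Watson's lemma.  The order K of the Taylor polynomial exceeds the order N of
    the expansion by Re s, to compensate for the normalising factor y^s. *)
Lemma has_expansion_base (a b c x : C) :
  ~ nonpos_int a -> ~ nonpos_int c -> slit_plane x -> (2 <= Re (c - a))%R ->
  has_expansion a b c x.
Proof.
  intros Ha Hc Hx Hs.
  set (s := c - a) in *.
  assert (Ec : c = a + s) by (unfold s; ring).
  destruct (nfloor_ex (Rabs (3 - Re a)) (Rabs_pos _)) as [j Hj].
  assert (Hre : (3 <= Re (a + INR (S (S j))))%R).
  { rewrite re_plus, re_RtoC, !S_INR; generalize (Rle_abs (3 - Re a)); lra. }
  set (n0 := S (S j)) in *.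
  assert (Hsn : ~ nonpos_int s) by (apply Re_pos_not_nonpos_int; lra).
  destruct (CGamma_cv a Ha) as [_ Na]; destruct (CGamma_cv s Hsn) as [_ Ns].
  set (kappa := CGamma c / (CGamma a * CGamma s)).
  assert (Hsi : forall i : nat, (2 <= Re (s + INR i))%R)
    by (intros i; rewrite re_plus, re_RtoC; generalize (pos_INR i); lra).
  set (g := fun K t => euler_rem a b x n0 K t * wt s t).
  assert (Cg : forall K, Ccont01 (g K)).
  { intros K t Ht; apply Ccont_mult; [apply Ccont_euler_rem; auto; lra|apply Ccont_wt; auto]. }
  assert (Bg : forall N, exists A, (0 <= A)%R /\ forall t, (0 < t < 1)%R ->
    (Cmod (g (S N) t) <= A * (1 - t) ^ S N)%R).
  { intros N; destruct (euler_rem_bound a b x n0 N Hx ltac:(lra)) as [A [HA B]].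
    exists A; split; auto; intros t Ht; unfold g; rewrite Cmod_mult.
    rewrite <- (Rmult_1_r (A * _)).
    apply Rmult_le_compat; auto; try apply Cmod_ge_0.
    apply Cmod_wt_le; lra. }
  set (main := fun K n => kappa * Csum (fun i => gcoef a b x i *
    (INR (fact n) / poch (s + INR i) (S n))) K).
  set (rho := fun K n => phi_coef a b c x n - main K n).
  assert (Hrho : forall K k, rho K (n0 + k)%nat = kappa * CInt (fun t => RtoC t ^ k * g K t)).
  { intros K k; unfold rho, main, n0, kappa.
    rewrite Ec, phi_coef_euler by (auto; rewrite <- Ec; auto); fold n0.
    rewrite (euler_int_expand a s b x n0 k K) by auto; unfold g; ring. }
  assert (Main : forall K y, Ccv (Csum (fun n => main K n * (y ^ n / INR (fact n))))
    (Csum (fun i => kappa * gcoef a b x i * hser (s + INR i) y) K)).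
  { intros K y.
    apply Ccv_ext with (fun N => Csum (fun i => kappa * gcoef a b x i *
      Csum (fun n => y ^ n / poch (s + INR i) (S n)) N) K).
    - intros N; unfold main.
      rewrite (Csum_ext (fun n => _ * (y ^ n / INR (fact n))) (fun n => Csum (fun i =>
        kappa * gcoef a b x i * (y ^ n / poch (s + INR i) (S n))) K)).
      + rewrite Csum_exchange; apply Csum_ext; intros i _; rewrite <- Csum_scal; reflexivity.
      + intros n _; rewrite <- Csum_scal, Cmult_comm, <- Csum_scal.
        apply Csum_ext; intros i _; field.
        split; [apply poch_neq0, Re_pos_not_nonpos_int; specialize (Hsi i); lra|apply INR_fact_neq0].
    - apply Ccv_Csum; intros i _; apply Ccv_scal, hser_series; auto. }
  assert (Conv : forall y, Ccv (Csum (fun n => phi_coef a b c x n * (y ^ n / INR (fact n))))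
    (Phi1 a b c x y)).
  { intros y.
    (* Subtracting a single Taylor term already leaves bounded coefficients. *)
    destruct (Bg O) as [A [HA B]].
    destruct (finite_bound (rho 1%nat) n0) as [P [HP BP]].
    set (Q := (P + Cmod kappa * (2 * A))%R).
    assert (PQ : (0 <= Cmod kappa * (2 * A))%R) by (apply Rmult_le_pos; [apply Cmod_ge_0|lra]).
    assert (BQ : forall n, (Cmod (rho 1%nat n) <= Q)%R).
    { intros n; unfold Q; destruct (Nat.lt_ge_cases n n0) as [h|h].
      - specialize (BP n h); lra.
      - replace n with (n0 + (n - n0))%nat by lia; rewrite Hrho, Cmod_mult.
        assert (Cmod (CInt (fun t => RtoC t ^ (n - n0) * g 1%nat t)%C) <= 2 * A)%R.
        { apply CInt_bound_const.
          - intros t Ht; apply Ccont_mult; [apply (Ccont_RtoC_pow (n - n0))|apply Cg, Ht].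
          - intros t Ht; rewrite Cmod_mult.
            assert (T1 := Cmod_RtoC_pow_le1 t (n - n0) ltac:(lra)).
            assert (T2 := B t Ht); rewrite pow_1 in T2.
            assert (T3 := Cmod_ge_0 (g 1%nat t)); assert (T4 := Cmod_ge_0 (RtoC t ^ (n - n0))).
            nra. }
        assert (Cmod kappa * Cmod (CInt (fun t => RtoC t ^ (n - n0) * g 1%nat t)%C) <=
          Cmod kappa * (2 * A))%R by (apply Rmult_le_compat_l; auto; apply Cmod_ge_0).
        lra. }
    destruct (Csum_cv_abs (fun n => rho 1%nat n * (y ^ n / INR (fact n)))
      (fun n => Q * (Cmod y ^ n / INR (fact n)))%R) as [l Hl].
    - intros n; rewrite Cmod_mult, Cmod_exp_term; apply Rmult_le_compat_r; auto.
      apply Rmult_le_pos; [apply pow_le, Cmod_ge_0|left; apply Rinv_0_lt_compat, INR_fact_lt_0].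
    - apply (ex_series_scal (K := R_AbsRing) (V := R_NormedModule) Q
        (fun n => Cmod y ^ n / INR (fact n))%R), ex_series_exp.
    - assert (L := Ccv_plus _ _ _ _ Hl (Main 1%nat y)).
      assert (L' : Ccv (Csum (fun n => phi_coef a b c x n * (y ^ n / INR (fact n))))
        (l + Csum (fun i => kappa * gcoef a b x i * hser (s + INR i) y) 1)).
      { apply Ccv_ext with (2 := L); intros n; rewrite <- Csum_plus; apply Csum_ext.
        intros k _; unfold rho; ring. }
      replace (Phi1 a b c x y) with
        (l + Csum (fun i => kappa * gcoef a b x i * hser (s + INR i) y) 1)
        by (symmetry; apply (CSeries_unique _ _ L')); exact L'. }
  split; auto.
  intros kap N Hk; fold s.
  destruct (nfloor_ex (Rabs (Re s)) (Rabs_pos _)) as [m Hm].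
  assert (Hm' : (Re s <= INR (S m))%R) by (rewrite S_INR; generalize (Rle_abs (Re s)); lra).
  set (K := (N + S m)%nat).
  set (r := fun y => Phi1 a b c x y - Csum (fun i => kappa * gcoef a b x i * hser (s + INR i) y) K).
  assert (Hr : forall y, Ccv (Csum (fun n => rho K n * (y ^ n / INR (fact n)))) (r y)).
  { intros y; apply Ccv_ext with (2 := Ccv_minus _ _ _ _ (Conv y) (Main K y)).
    intros n; rewrite <- Csum_minus; apply Csum_ext; intros k _; unfold rho; ring. }
  assert (EK : K = S (N + m)) by (unfold K; lia).
  destruct (Bg (N + m)%nat) as [A [HA B]]; rewrite <- EK in B.
  destruct (remainder_bound kap (rho K) (S j) K kappa (g K) A r Hk (Cg K) HA B (Hrho K) Hr)
    as [D [HD BD]].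
  assert (O1 := bigO_remainder kap s N (S m) D r Hk Hm' HD BD).
  apply (bigO_truncate kap N K); [unfold K; lia|].
  apply bigO_ext with (fun y => Cexp (- y) * Cpowc y s * r y +
    Csum (fun i => kappa * gcoef a b x i * (Cexp (- y) * Cpowc y s * hser (s + INR i) y -
      CGamma (s + INR i) * (/ y) ^ i)) K).
  - intros y _; unfold r.
    rewrite (Csum_ext (fun i => kappa * gcoef a b x i * (_ - _)) (fun i =>
      (Cexp (- y) * Cpowc y s) * (kappa * gcoef a b x i * hser (s + INR i) y) -
      phi_asym a b c x i * (/ y) ^ i)).
    + rewrite Csum_minus, Csum_scal; ring.
    + intros i _; unfold phi_asym, kappa; fold s; rewrite CGamma_poch by auto; field; auto.
  - apply bigO_plus; auto.
    apply (bigO_Csum kap N (fun i y => kappa * gcoef a b x i *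
      (Cexp (- y) * Cpowc y s * hser (s + INR i) y - CGamma (s + INR i) * (/ y) ^ i))).
    intros i _; apply (bigO_scal kap N (kappa * gcoef a b x i)), expansion_hser; auto.
Qed.

(** * Lowering c, and the general case *)

(** Only large n occur, because the existence of the continuation is established
    for Re(a+n) >= 3. *)
Lemma phi_coef_lower (a b c x : C) (n : nat) :
  ~ nonpos_int c -> slit_plane x -> (3 <= Re (a + INR n))%R ->
  phi_coef a b c x n = (c - b) / c * phi_coef a b (c + 1) x n +
    b / c * phi_coef a (b + 1) (c + 1) x n + / c * (INR n * phi_coef a b (c + 1) x n).
Proof.
  intros Hc Hx Hre; unfold phi_coef.
  set (ga := c + INR n).
  assert (Hg : ~ nonpos_int ga) by (apply not_nonpos_int_add, Hc).
  replace (c + 1 + INR n) with (ga + 1) by (unfold ga; ring).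
  assert (H1 := hyp2F1_spec _ _ _ (hyp2F1_exists (a + INR n) b (ga + 1) Hre (not_nonpos_int_S _ Hg))).
  assert (H2 := hyp2F1_spec _ _ _ (hyp2F1_exists (a + INR n) (b + 1) (ga + 1) Hre
    (not_nonpos_int_S _ Hg))).
  rewrite (hyp2F1_eq _ _ _ x _ (is_hyp2F1_lower _ _ _ _ _ Hg H1 H2) Hx).
  set (F := hyp2F1 (a + INR n) b (ga + 1) x); set (F' := hyp2F1 (a + INR n) (b + 1) (ga + 1) x).
  assert (N0 := not_nonpos_int_neq0 c Hc).
  assert (N1 := poch_neq0 c n Hc).
  assert (N2 := not_nonpos_int_neq0 ga Hg).
  replace (poch (c + 1) n) with (poch c n * ga / c)
    by (unfold ga; rewrite <- poch_shift; field; auto).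
  replace (RtoC (INR n)) with (ga - c) by (unfold ga; ring).
  field; auto.
Qed.

Lemma phi_coef_S (a b c x : C) (n : nat) :
  ~ nonpos_int c ->
  phi_coef a b c x (S n) = a / c * phi_coef (a + 1) b (c + 1) x n.
Proof.
  intros Hc; unfold phi_coef; rewrite !poch_S_l.
  replace (a + INR (S n)) with (a + 1 + INR n) by (rewrite RtoC_INR_S; ring).
  replace (c + INR (S n)) with (c + 1 + INR n) by (rewrite RtoC_INR_S; ring).
  field; split; [apply poch_neq0, not_nonpos_int_S, Hc|apply not_nonpos_int_neq0, Hc].
Qed.

Lemma bigO_weaken (kap : R) (N : nat) (h : C -> C) : bigO kap (S N) h -> bigO kap N h.
Proof.
  intros [K [HK B]]; exists K; split; auto; intros y H1 H2.
  eapply Rle_trans; [apply B; auto|]; apply Rmult_le_compat_l; auto.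
  apply Rinv_le_contravar; [apply pow_lt; lra|].
  assert (0 < Cmod y ^ N)%R by (apply pow_lt; lra); simpl; nra.
Qed.

(** A polynomial is negligible against e^y in the sector. *)
Lemma bigO_poly (kap : R) (N : nat) (s : C) (d : nat -> C) (n0 : nat) :
  (0 < kap)%R ->
  bigO kap N (fun y => Cexp (- y) * Cpowc y s * Csum (fun n => d n * (y ^ n / INR (fact n))) n0).
Proof.
  intros Hk.
  destruct (finite_bound d n0) as [P [HP BP]].
  destruct (nfloor_ex (Rabs (Re s)) (Rabs_pos _)) as [m Hm].
  assert (Hm' : (Re s <= INR (S m))%R) by (rewrite S_INR; generalize (Rle_abs (Re s)); lra).
  set (e := Rmin (kap / 2) 1).
  assert (He : (0 < e <= 1)%R) by (split; [apply Rmin_pos; lra|apply Rmin_r]).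
  assert (He2 : (e <= kap / 2)%R) by apply Rmin_l.
  set (E := exp (Rabs (Im s) * PI)).
  assert (PE : (0 < E)%R) by apply exp_pos.
  apply bigO_exp_small with (j := S m) (D := (E * (P * / e ^ n0))%R); auto.
  intros y H1 H2; rewrite !Cmod_mult, Cmod_Cexp, re_opp.
  assert (Q1 := Cmod_Cpowc_pow s y (S m) Hm' H1); fold E in Q1.
  assert (Q2 := exp_head_le d y P e n0 He HP BP).
  assert (Q3 : (exp (e * Cmod y) <= exp (Re y / 2))%R) by (apply exp_le; nra).
  assert (E2 : (exp (- Re y) * exp (Re y / 2) = exp (- (Re y / 2)))%R)
    by (rewrite <- exp_plus; f_equal; field).
  rewrite <- E2.
  assert (Pe : (0 < / e ^ n0)%R) by (apply Rinv_0_lt_compat, pow_lt; lra).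
  assert (P1 := exp_pos (- Re y)).
  apply Rle_trans with (exp (- Re y) * (E * Cmod y ^ S m) * (P * (/ e ^ n0 * exp (Re y / 2))))%R;
    [|right; ring].
  apply Rmult_le_compat; [apply Rmult_le_pos; [lra|apply Cmod_ge_0]|apply Cmod_ge_0| |].
  - apply Rmult_le_compat_l; lra.
  - eapply Rle_trans; [exact Q2|].
    apply Rmult_le_compat_l; auto; apply Rmult_le_compat_l; lra.
Qed.

Lemma phi_asym_0 (a b c x : C) :
  ~ nonpos_int a -> ~ nonpos_int c ->
  phi_asym a b c x 0 = / c * (a / (c + 1)) * phi_asym (a + 1) b (c + 1 + 1) x 0.
Proof.
  intros Ha Hc; unfold phi_asym; rewrite !gcoef_0; simpl poch.
  rewrite !CGamma_S by (auto; apply not_nonpos_int_S, Hc).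
  destruct (CGamma_cv a Ha) as [_ Na].
  assert (N1 := not_nonpos_int_neq0 a Ha); assert (N2 := not_nonpos_int_neq0 c Hc).
  assert (N3 := not_nonpos_int_neq0 _ (not_nonpos_int_S c Hc)).
  field; auto.
Qed.

Lemma phi_asym_S (a b c x : C) (n : nat) :
  ~ nonpos_int a -> ~ nonpos_int c -> 1 - x <> 0 ->
  phi_asym a b c x (S n) = (c - b) / c * phi_asym a b (c + 1) x n +
    b / c * phi_asym a (b + 1) (c + 1) x n +
    / c * (a / (c + 1)) * phi_asym (a + 1) b (c + 1 + 1) x (S n).
Proof.
  intros Ha Hc Hx; unfold phi_asym.
  rewrite !CGamma_S by (auto; apply not_nonpos_int_S, Hc).
  destruct (CGamma_cv a Ha) as [_ Na].
  assert (N1 := not_nonpos_int_neq0 a Ha); assert (N2 := not_nonpos_int_neq0 c Hc).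
  assert (N3 := not_nonpos_int_neq0 _ (not_nonpos_int_S c Hc)).
  replace (c + 1 + 1 - (a + 1)) with (c + 1 - a) by ring.
  rewrite (poch_S_l (c - a)).
  replace (c - a + 1) with (c + 1 - a) by ring; simpl poch.
  set (p := poch (c + 1 - a) n).
  assert (I2 := gcoef_deriv a b x n Hx).
  assert (E : (c - a) * gcoef a b x (S n) = (c - b) * gcoef a b x n +
    b * gcoef a (b + 1) x n + (c + 1 - a + INR n) * gcoef (a + 1) b x (S n)).
  { replace ((c + 1 - a + INR n) * gcoef (a + 1) b x (S n))
      with ((c - a) * gcoef (a + 1) b x (S n) + INR (S n) * gcoef (a + 1) b x (S n))
      by (rewrite RtoC_INR_S; ring).
    rewrite I2, gcoef_raise; ring. }
  replace (CGamma c / CGamma a * (gcoef a b x (S n) * ((c - a) * p)))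
    with (CGamma c / CGamma a * (((c - a) * gcoef a b x (S n)) * p)) by ring.
  rewrite E; field; auto.
Qed.

(** The two terms with c+1 carry an extra factor 1/y relative to y^(a-c), and the
    term y Phi1[a+1,b;c+2] has the right order already. *)
Lemma has_expansion_lower (a b c x : C) :
  ~ nonpos_int a -> ~ nonpos_int c -> slit_plane x ->
  has_expansion a b (c + 1) x -> has_expansion a (b + 1) (c + 1) x ->
  has_expansion (a + 1) b (c + 1 + 1) x -> has_expansion a b c x.
Proof.
  intros Ha Hc Hx [S1 X1] [S2 X2] [S3 X3].
  assert (N2 := not_nonpos_int_neq0 c Hc).
  destruct (nfloor_ex (Rabs (3 - Re a)) (Rabs_pos _)) as [n0' Hn0].
  set (n0 := S n0').
  assert (Hre : forall n, (n0 <= n)%nat -> (3 <= Re (a + INR n))%R).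
  { intros n Hn; rewrite re_plus, re_RtoC.
    assert (INR n0 <= INR n)%R by (apply le_INR; auto).
    unfold n0 in *; rewrite S_INR in *; generalize (Rle_abs (3 - Re a)); lra. }
  set (A1 := phi_coef a b (c + 1) x) in *.
  set (A2 := phi_coef a (b + 1) (c + 1) x) in *.
  set (d := fun n => phi_coef a b c x n -
    ((c - b) / c * A1 n + b / c * A2 n + / c * (INR n * A1 n))).
  assert (Hd : forall n, (n0 <= n)%nat -> d n = 0).
  { intros n Hn; unfold d, A1, A2; rewrite (phi_coef_lower a b c x n) by auto; ring. }
  set (p := fun y => Csum (fun n => d n * (y ^ n / INR (fact n))) n0).
  assert (Sp : forall y, Ccv (Csum (fun n => d n * (y ^ n / INR (fact n)))) (p y)).
  { intros y; apply Ccv_ext_ge with (fun _ => p y) n0; [|apply Ccv_const].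
    intros n Hn; replace n with (n0 + (n - n0))%nat by lia; rewrite Csum_add.
    rewrite (Csum_zero (fun k => d (n0 + k)%nat * _)) by (intros; rewrite Hd by lia; ring).
    unfold p; ring. }
  set (f1 := Phi1 a b (c + 1) x) in *; set (f2 := Phi1 a (b + 1) (c + 1) x) in *.
  set (f3 := Phi1 (a + 1) b (c + 1 + 1) x) in *.
  set (de := / c * (a / (c + 1))).
  (* The factor n is the operator y d/dy, which shifts both a and c. *)
  assert (S4 : forall y, Ccv (Csum (fun n => INR n * A1 n * (y ^ n / INR (fact n))))
    (a / (c + 1) * y * f3 y)).
  { intros y; apply Ccv_decr with 1%nat.
    apply Ccv_ext with (2 := Ccv_scal (a / (c + 1) * y) _ _ (S3 y)).
    intros N; rewrite Nat.add_1_r, Csum_S_l, <- Csum_scal.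
    rewrite (Csum_ext (fun k => INR (S k) * _ * _) (fun n => a / (c + 1) * y *
      (phi_coef (a + 1) b (c + 1 + 1) x n * (y ^ n / INR (fact n))))).
    - simpl INR; ring.
    - intros n _; unfold A1; rewrite phi_coef_S by (apply not_nonpos_int_S, Hc).
      rewrite RtoC_fact_S, Cpow_S; field.
      repeat split; [apply INR_fact_neq0| |apply INR_S_neq0].
      apply (not_nonpos_int_neq0 _ (not_nonpos_int_S c Hc)). }
  assert (SE : forall y, Ccv (Csum (fun n => phi_coef a b c x n * (y ^ n / INR (fact n))))
    ((c - b) / c * f1 y + b / c * f2 y + de * (y * f3 y) + p y)).
  { intros y.
    assert (L := Ccv_plus _ _ _ _ (Ccv_plus _ _ _ _ (Ccv_plus _ _ _ _
      (Ccv_scal ((c - b) / c) _ _ (S1 y)) (Ccv_scal (b / c) _ _ (S2 y)))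
      (Ccv_scal (/ c) _ _ (S4 y))) (Sp y)).
    replace (de * (y * f3 y)) with (/ c * (a / (c + 1) * y * f3 y)) by (unfold de; ring).
    apply Ccv_ext with (2 := L); intros n; cbv beta.
    rewrite <- !Csum_scal, <- !Csum_plus; apply Csum_ext; intros k _; unfold d; ring. }
  assert (PE : forall y, Phi1 a b c x y =
    (c - b) / c * f1 y + b / c * f2 y + de * (y * f3 y) + p y)
    by (intros y; apply (CSeries_unique _ _ (SE y))).
  split; [intros y; rewrite PE; apply SE|].
  intros kap N Hk.
  set (s := c - a).
  replace (c + 1 - a) with (s + 1) in X1, X2 by (unfold s; ring).
  replace (c + 1 + 1 - (a + 1)) with (s + 1) in X3 by (unfold s; ring).
  apply (bigO_truncate kap N (S N)); [lia|].
  apply bigO_weaken.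
  assert (O1 := bigO_scal _ _ ((c - b) / c) _ (bigO_div _ _ _ (X1 kap N Hk))).
  assert (O2 := bigO_scal _ _ (b / c) _ (bigO_div _ _ _ (X2 kap N Hk))).
  assert (O3 := bigO_scal _ _ de _ (X3 kap (S N) Hk)).
  assert (O4 := bigO_poly kap (S N) s d n0 Hk).
  assert (O := bigO_plus _ _ _ _ (bigO_plus _ _ _ _ (bigO_plus _ _ _ _ O1 O2) O3) O4).
  apply bigO_ext with (2 := O); intros y Hy; cbv beta.
  assert (Ny : y <> 0) by (apply Cmod_gt_0; lra).
  rewrite PE; fold (p y).
  rewrite (Cpowc_S y s Ny).
  assert (EC : Csum (fun n => phi_asym a b c x n * (/ y) ^ n) (S N) =
    (c - b) / c * (/ y * Csum (fun n => phi_asym a b (c + 1) x n * (/ y) ^ n) N) +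
    b / c * (/ y * Csum (fun n => phi_asym a (b + 1) (c + 1) x n * (/ y) ^ n) N) +
    de * Csum (fun n => phi_asym (a + 1) b (c + 1 + 1) x n * (/ y) ^ n) (S N)).
  { rewrite !Csum_S_l, phi_asym_0 by auto; fold de.
    rewrite (Csum_ext (fun k => phi_asym a b c x (S k) * (/ y) ^ S k) (fun k =>
      (c - b) / c * (/ y * (phi_asym a b (c + 1) x k * (/ y) ^ k)) +
      b / c * (/ y * (phi_asym a (b + 1) (c + 1) x k * (/ y) ^ k)) +
      de * (phi_asym (a + 1) b (c + 1 + 1) x (S k) * (/ y) ^ S k))).
    - rewrite !Csum_plus, !Csum_scal; simpl; ring.
    - intros k _; rewrite phi_asym_S by (auto; apply slit_plane_1_sub, Hx).
      fold de; rewrite (Cpow_S (/ y)); ring. }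
  rewrite EC; field; auto.
Qed.

Lemma has_expansion_all (a b c x : C) :
  ~ nonpos_int a -> ~ nonpos_int c -> slit_plane x -> has_expansion a b c x.
Proof.
  intros Ha Hc Hx.
  assert (G : forall m : nat, forall a b c : C, ~ nonpos_int a -> ~ nonpos_int c ->
    (2 - INR m <= Re (c - a))%R -> has_expansion a b c x).
  { clear a b c Ha Hc; induction m as [|m IH]; intros a b c Ha Hc Hm.
    - change (INR 0) with 0%R in Hm; apply has_expansion_base; auto; lra.
    - rewrite S_INR, Re_minus in Hm.
      assert (Hc1 := not_nonpos_int_S c Hc).
      apply has_expansion_lower; auto; apply IH; auto;
        try apply not_nonpos_int_S; auto; rewrite Re_minus, !re_plus, !re_RtoC; lra. }
  destruct (nfloor_ex (Rabs (2 - Re (c - a))) (Rabs_pos _)) as [m Hm].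
  apply (G (S m)); auto.
  rewrite S_INR; generalize (Rle_abs (2 - Re (c - a))); lra.
Qed.

(** * The sector, and the theorem *)

Lemma slit_plane_of_arg (x : C) : x <> 1 -> (Rabs (Carg (1 - x)) < PI)%R -> slit_plane x.
Proof.
  intros Hx1 Hx [E1 E2].
  assert (E3 : (Re x <> 1)%R).
  { intros E; apply Hx1, C_ext; rewrite ?re_RtoC, ?im_RtoC; auto. }
  assert (I : Im (1 - x) = 0%R) by (rewrite Im_minus, im_RtoC; lra).
  assert (Rx : Re (1 - x) = (1 - Re x)%R) by (rewrite Re_minus, re_RtoC; reflexivity).
  assert (Mx : Cmod (1 - x) = (Re x - 1)%R).
  { replace (1 - x) with (RtoC (1 - Re x)) by (apply C_ext; simpl in *; lra).
    rewrite Cmod_R, Rabs_left; lra. }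
  unfold Carg in Hx; rewrite I, Rx, Mx in Hx.
  destruct (Rle_dec 0 0) as [_|h]; [|lra].
  replace ((1 - Re x) / (Re x - 1))%R with (- (1))%R in Hx by (field; lra).
  rewrite acos_opp, acos_1, Rminus_0_r, Rabs_pos_eq in Hx; generalize PI_RGT_0; lra.
Qed.

Lemma sector_cone (delta : R) (y : C) :
  (0 < delta <= PI / 2)%R -> y <> 0 -> sector delta y -> (sin delta * Cmod y <= Re y)%R.
Proof.
  intros Hd Hy Hs; unfold sector in Hs.
  assert (Py : (0 < Cmod y)%R) by (apply Cmod_gt_0, Hy).
  assert (Pa := Rabs_pos (Carg y)).
  assert (Q : (sin delta <= cos (Carg y))%R).
  { rewrite <- cos_shift.
    replace (cos (Carg y)) with (cos (Rabs (Carg y)))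
      by (unfold Rabs; destruct Rcase_abs; rewrite ?cos_neg; reflexivity).
    apply cos_decr_1; lra. }
  rewrite cos_Carg in Q by auto.
  apply (Rmult_le_compat_r (Cmod y)) in Q; [|lra].
  unfold Rdiv in Q; rewrite Rmult_assoc, Rinv_l, Rmult_1_r in Q by lra; exact Q.
Qed.

Lemma expansion_remainder_small (a b c x : C) (delta : R) (N : nat) (eps : R) :
  ~ nonpos_int a -> ~ nonpos_int c -> slit_plane x -> (0 < delta <= PI / 2)%R -> (0 < eps)%R ->
  exists M : R, forall y : C, (M < Cmod y)%R -> sector delta y ->
    (Cmod (Phi1 a b c x y -
       Csum (fun n => phi_asym a b c x n * (Cexp y * Cpowc y (a - c - INR n)))%C (S N))
     <= eps * Cmod (Cexp y * Cpowc y (a - c - INR N)))%R.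
Proof.
  intros Ha Hc Hx Hd He.
  assert (Hk : (0 < sin delta)%R) by (apply sin_gt_0; generalize PI_RGT_0; lra).
  destruct (has_expansion_all a b c x Ha Hc Hx) as [_ X].
  destruct (X (sin delta) (S N) Hk) as [K [HK B]].
  assert (HKe : (0 <= K / eps)%R)
    by (apply Rmult_le_pos; [auto|left; apply Rinv_0_lt_compat; auto]).
  exists (1 + K / eps)%R; intros y Hy Hs.
  assert (Ny : y <> 0) by (apply Cmod_gt_0; lra).
  specialize (B y ltac:(lra) (sector_cone delta y Hd Ny Hs)).
  assert (Ep : forall n : nat, Cpowc y (a - c - INR n) = / Cpowc y (c - a) * (/ y) ^ n).
  { intros n; replace (a - c - INR n) with (- (c - a) + - INR n) by ring.
    rewrite Cpowc_plus, !Cpowc_opp, Cpowc_INR, Cpow_inv by auto; reflexivity. }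
  assert (Ne := Cexp_neq0 y); assert (Np := Cpowc_neq0 y (c - a)).
  set (S0 := Csum (fun n => phi_asym a b c x n * (/ y) ^ n) (S N)) in *.
  replace (Phi1 a b c x y - _)
    with (Cexp y * / Cpowc y (c - a) * (Cexp (- y) * Cpowc y (c - a) * Phi1 a b c x y - S0)).
  2:{ rewrite (Csum_ext _ (fun n => Cexp y * / Cpowc y (c - a) *
        (phi_asym a b c x n * (/ y) ^ n))) by (intros; rewrite Ep; ring).
      rewrite Csum_scal; fold S0; rewrite Cexp_opp; field; auto. }
  rewrite Ep, Cmult_assoc, Cmod_mult, (Cmod_mult _ ((/ y) ^ N)), Cmod_pow, Cmod_inv by auto.
  set (W := Cmod (Cexp y * / Cpowc y (c - a))).
  assert (PW : (0 <= W)%R) by apply Cmod_ge_0.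
  replace (eps * (W * (/ Cmod y) ^ N))%R with (W * (eps * (/ Cmod y) ^ N))%R by ring.
  apply Rmult_le_compat_l; auto; eapply Rle_trans; [exact B|].
  rewrite <- pow_inv; simpl.
  assert (P1 : (0 < / Cmod y)%R) by (apply Rinv_0_lt_compat; lra).
  assert (PN : (0 < (/ Cmod y) ^ N)%R) by (apply pow_lt; auto).
  rewrite <- Rmult_assoc; apply Rmult_le_compat_r; [lra|].
  apply Rmult_le_reg_r with (Cmod y); [lra|].
  rewrite Rmult_assoc, Rinv_l, Rmult_1_r by lra.
  replace K with (eps * (K / eps))%R at 1 by (field; lra).
  apply Rmult_le_compat_l; lra.
Qed.

Theorem corollary3p3 (a b c : C) (delta : R) (x : C)
  (ha : ~ nonpos_int a) (hc : ~ nonpos_int c)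
  (hdelta : (0 < delta <= PI / 2)%R)
  (hx1 : x <> 1) (hx : (Rabs (Carg (1 - x)) < PI)%R) :
  is_asymp_expansion (within (sector delta) C_infinity)
    (fun y : C => Phi1 a b c x y)
    (fun n : nat => CGamma c / CGamma a *
       (poch_hyp2F1 a b x n * poch (c - a) n / INR (fact n)))
    (fun (n : nat) (y : C) => Cexp y * Cpowc y (a - c - INR n))
  /\
  is_equiv (within (sector delta) C_infinity)
    (fun y : C => Phi1 a b c x y)
    (fun y : C => CGamma c / CGamma a * Cpowc (1 - x) (- b)
       * Cpowc y (a - c) * Cexp y).
Proof.
  assert (Hx := slit_plane_of_arg x hx1 hx).
  split.
  - intros N eps.
    destruct (expansion_remainder_small a b c x delta N eps ha hc Hx hdelta (cond_pos eps))
      as [M HM].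
    exists M; intros y Hy Hs.
    change (Cmod (Phi1 a b c x y - sum_n (fun n => CGamma c / CGamma a *
        (poch_hyp2F1 a b x n * poch (c - a) n / INR (fact n)) *
        (Cexp y * Cpowc y (a - c - INR n)))%C N)
      <= eps * Cmod (Cexp y * Cpowc y (a - c - INR N)))%R.
    rewrite sum_n_Csum.
    rewrite (Csum_ext _ (fun n => phi_asym a b c x n * (Cexp y * Cpowc y (a - c - INR n)))).
    + apply HM; auto.
    + intros n _; unfold phi_asym; rewrite poch_hyp2F1_gcoef by auto.
      f_equal; f_equal; field; apply INR_fact_neq0.
  - intros eps.
    destruct (CGamma_cv a ha) as [_ Na]; destruct (CGamma_cv c hc) as [_ Nc].
    set (G := CGamma c / CGamma a * Cpowc (1 - x) (- b)).
    assert (NG : G <> 0).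
    { unfold G; apply Cmult_neq_0; [|apply Cpowc_neq0].
      apply Cmod_gt_0; rewrite Cmod_div by auto.
      apply Rdiv_lt_0_compat; apply Cmod_gt_0; auto. }
    assert (PG : (0 < Cmod G)%R) by (apply Cmod_gt_0, NG).
    destruct (expansion_remainder_small a b c x delta 0 (eps * Cmod G) ha hc Hx hdelta
      (Rmult_lt_0_compat _ _ (cond_pos eps) PG)) as [M HM].
    exists M; intros y Hy Hs; specialize (HM y Hy Hs).
    change (Cmod (G * Cpowc y (a - c) * Cexp y - Phi1 a b c x y)
      <= eps * Cmod (G * Cpowc y (a - c) * Cexp y))%R.
    replace (a - c - INR 0) with (a - c) in HM by (simpl; ring).
    replace (G * Cpowc y (a - c) * Cexp y - Phi1 a b c x y)
      with (- (Phi1 a b c x y -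
        Csum (fun n => phi_asym a b c x n * (Cexp y * Cpowc y (a - c - INR n))) 1)).
    + rewrite Cmod_opp; eapply Rle_trans; [exact HM|].
      rewrite !Cmod_mult; right; ring.
    + simpl Csum; unfold phi_asym; rewrite gcoef_0; simpl poch.
      replace (a - c - 0) with (a - c) by ring.
      unfold G; ring.
Qed.
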